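(* Let $K$ be an algebraically closed field of characteristic zero, $n\ge 1$ and $r,s\ge 0$ integers. The rational Schur algebra $S(n,r,s)$ is isomorphic to the unital associative $K$-algebra given by generators $e_i,f_i$ for $1\le i\le n-1$ and $H_i$ for $1\le i\le n$ subject to the relations: (a) $H_iH_j=H_jH_i$; (b) $e_if_j-f_je_i=\delta_{ij}(H_j-H_{j+1})$; (c) $H_ie_j-e_jH_i=(\epsilon_i,\alpha_j)e_j$ and $H_if_j-f_jH_i=-(\epsilon_i,\alpha_j)f_j$; (d) $H_1+\cdots+H_n=r-s$; (e) $\prod_{k=-r}^{s}(H_S+k)=0$ for each proper subset $S$ of $\{1,\ldots,n\}$, where $H_S=\sum_{i\in S}H_i$.
   Context: Here $\epsilon_1,\ldots,\epsilon_n$ is the standard orthonormal basis of the weight lattice of $\mathfrak{gl}_n$ and $\alpha_j=\epsilon_j-\epsilon_{j+1}$, so $(\epsilon_i,\alpha_j)=\delta_{i,j}-\delta_{i,j+1}$. Let $G=\mathrm{GL}(n)$ over $K$, let $c_{ij}$ be the coordinate functions of the generic matrix $C$ and $d_{ij}$ the entries of $C^{-1}$. Let $A(n,r,s)\subset K[G]$ be the subcoalgebra spanned by all products $\prod c_{ij}^{a_{ij}}\prod d_{ij}^{b_{ij}}$ with $a_{ij},b_{ij}\geq 0$, $\sum a_{ij}=r$, $\sum b_{ij}=s$. The rational Schur algebra is the dual algebra $S(n,r,s)=A(n,r,s)^*$; equivalently it is the image of the natural representation $U(\mathfrak{gl}_n)\to \mathrm{End}_K(E^{\otimes r}\otimes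 (E^* )^{\otimes s})$, where $E=K^n$ is the natural module. *)

(* Defs.v *)
From HB Require Import structures.
From mathcomp Require Import all_boot all_order all_algebra.
From mathcomp Require Import boolp functions.
From mathcomp Require Import monalg.

Set Implicit Arguments.
Unset Strict Implicit.
Unset Printing Implicit Defensive.

Import GRing.Theory.
Local Open Scope ring_scope.
Local Open Scope quotient_scope.

Section Span.
Variables (R : pzRingType) (V : lmodType R) (X : V -> Prop).

Inductive span_spec : V -> Prop :=
| Span0 : span_spec 0
| SpanZD a x v : X x -> span_spec v -> span_spec (a *: x + v).

Definition span : {pred V} := fun v => `[< span_spec v >].

Lemma span_submod_closed : submod_closed span.
Proof.
have spanD u v : span_spec u -> span_spec v -> span_spec (u + v).
  elim=> [|a x w Xx _ IH] hv; first by rewrite add0r.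
  by rewrite -addrA; apply: SpanZD => //; exact: IH.
have spanZ a v : span_spec v -> span_spec (a *: v).
  elim=> [|b x w Xx _ IH]; first by rewrite scaler0; exact: Span0.
  by rewrite scalerDr scalerA; exact: SpanZD.
split=> [|a u v /asboolP hu /asboolP hv]; apply/asboolP; first exact: Span0.
by apply: spanD => //; exact: spanZ.
Qed.

HB.instance Definition _ := GRing.isSubmodClosed.Build R V span
  span_submod_closed.

Lemma span_gen x : X x -> x \in span.
Proof.
by move=> Xx; apply/asboolP; rewrite -[x]addr0 -[x]scale1r; apply: SpanZD => //; exact: Span0.
Qed.

End Span.

Section IdealGen.
Variables (R : pzRingType) (X : R -> Prop).

Inductive ideal_spec : R -> Prop :=
| IdealGen x : X x -> ideal_spec x
| Ideal0 : ideal_spec 0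
| IdealB x y : ideal_spec x -> ideal_spec y -> ideal_spec (x - y)
| IdealMl a x : ideal_spec x -> ideal_spec (a * x)
| IdealMr a x : ideal_spec x -> ideal_spec (x * a).

Definition ideal_gen : {pred R} := fun x => `[< ideal_spec x >].

Lemma ideal_gen_zmod_closed : zmod_closed ideal_gen.
Proof.
split=> [|x y /asboolP hx /asboolP hy]; apply/asboolP; first exact: Ideal0.
exact: IdealB.
Qed.

HB.instance Definition _ := GRing.isZmodClosed.Build R ideal_gen
  ideal_gen_zmod_closed.

Lemma ideal_gen_sub x : X x -> x \in ideal_gen.
Proof. by move=> Xx; apply/asboolP; exact: IdealGen. Qed.

Lemma ideal_genMl a x : x \in ideal_gen -> a * x \in ideal_gen.
Proof. by move=> /asboolP hx; apply/asboolP; exact: IdealMl. Qed.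

Lemma ideal_genMr a x : x \in ideal_gen -> x * a \in ideal_gen.
Proof. by move=> /asboolP hx; apply/asboolP; exact: IdealMr. Qed.

End IdealGen.

(* The quotient of a K-algebra by the ideal generated by X. It may be the zero
   ring, so it is a pzRingType and an lmodType, not an algType; the scalar
   compatibility laws are alg_quot_scalerAl and presented_scalerAr below. *)
Section AlgQuot.
Variables (K : comNzRingType) (A : lalgType K) (X : A -> Prop).

Definition alg_quot := @Quotient.quot A (ideal_gen X).

HB.instance Definition _ := GRing.Zmodule.on alg_quot.
HB.instance Definition _ := EqQuotient.on alg_quot.

Definition aq_pi (x : A) : alg_quot := \pi_alg_quot x.

Lemma aq_piE x y : (aq_pi x = aq_pi y) <-> (x - y \in ideal_gen X).
Proof.
rewrite (Quotient.idealrBE (ideal_gen X)); split=> [h|/eqP h]; last exact: h.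
by apply/eqP; exact: h.
Qed.

Lemma aq_piB : {morph aq_pi : x y / x - y}.
Proof. by move=> x y; exact: (raddfB (\pi_alg_quot)). Qed.

Lemma aq_piD : {morph aq_pi : x y / x + y}.
Proof. by move=> x y; exact: (raddfD (\pi_alg_quot)). Qed.

Lemma aq_reprK x : aq_pi (repr x) = x.
Proof. exact: reprK. Qed.

Definition aq_one : alg_quot := aq_pi 1.
Definition aq_mul (x y : alg_quot) : alg_quot := aq_pi (repr x * repr y).
Definition aq_scale (a : K) (x : alg_quot) : alg_quot := aq_pi (a *: repr x).

Lemma aq_piM x y : aq_mul (aq_pi x) (aq_pi y) = aq_pi (x * y).
Proof.
apply/aq_piE; set x' := repr _; set y' := repr _.
have hx : x' - x \in ideal_gen X by apply/aq_piE; rewrite aq_reprK.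
have hy : y' - y \in ideal_gen X by apply/aq_piE; rewrite aq_reprK.
rewrite -(subrKA (x' * y)) -mulrBr -mulrBl.
by apply: rpredD; [exact: ideal_genMl | exact: ideal_genMr].
Qed.

Lemma aq_piZ a x : aq_scale a (aq_pi x) = aq_pi (a *: x).
Proof.
apply/aq_piE; rewrite -scalerBr -[_ - _]mul1r scalerAl ideal_genMl //.
by apply/aq_piE; rewrite aq_reprK.
Qed.

Lemma aq_mulA : associative aq_mul.
Proof.
move=> x y z; rewrite -(aq_reprK x) -(aq_reprK y) -(aq_reprK z).
by rewrite !aq_piM mulrA.
Qed.

Lemma aq_mul1x : left_id aq_one aq_mul.
Proof. by move=> x; rewrite -(aq_reprK x) aq_piM mul1r. Qed.

Lemma aq_mulx1 : right_id aq_one aq_mul.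
Proof. by move=> x; rewrite -(aq_reprK x) aq_piM mulr1. Qed.

Lemma aq_mulDl : left_distributive aq_mul +%R.
Proof.
move=> x y z; rewrite -(aq_reprK x) -(aq_reprK y) -(aq_reprK z).
by rewrite -aq_piD !aq_piM -aq_piD mulrDl.
Qed.

Lemma aq_mulDr : right_distributive aq_mul +%R.
Proof.
move=> x y z; rewrite -(aq_reprK x) -(aq_reprK y) -(aq_reprK z).
by rewrite -aq_piD !aq_piM -aq_piD mulrDr.
Qed.

HB.instance Definition _ := GRing.Zmodule_isPzRing.Build alg_quot
  aq_mulA aq_mul1x aq_mulx1 aq_mulDl aq_mulDr.

Lemma aq_scaleA a b x : aq_scale a (aq_scale b x) = aq_scale (a * b) x.
Proof. by rewrite -(aq_reprK x) !aq_piZ scalerA. Qed.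

Lemma aq_scale1 : left_id 1 aq_scale.
Proof. by move=> x; rewrite -(aq_reprK x) aq_piZ scale1r. Qed.

Lemma aq_scaleDr : right_distributive aq_scale +%R.
Proof.
move=> a x y; rewrite -(aq_reprK x) -(aq_reprK y).
by rewrite -aq_piD !aq_piZ -aq_piD scalerDr.
Qed.

Lemma aq_scaleDl x : {morph aq_scale^~ x : a b / a + b}.
Proof. by move=> a b; rewrite -(aq_reprK x) !aq_piZ -aq_piD scalerDl. Qed.

HB.instance Definition _ := GRing.Zmodule_isLmodule.Build K alg_quot
  aq_scaleA aq_scale1 aq_scaleDr aq_scaleDl.

Lemma aq_pi_is_linear : linear aq_pi.
Proof. by move=> a x y; rewrite aq_piD -aq_piZ. Qed.

HB.instance Definition _ := GRing.isLinear.Build K A alg_quot *:%R aq_pi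
  aq_pi_is_linear.

Lemma aq_pi_is_monoid_morphism : monoid_morphism aq_pi.
Proof. by split=> // x y; rewrite -aq_piM. Qed.

HB.instance Definition _ := GRing.isMonoidMorphism.Build A alg_quot aq_pi
  aq_pi_is_monoid_morphism.

Lemma aq_pi_eq0 x : (aq_pi x = 0) <-> (x \in ideal_gen X).
Proof. by rewrite -(raddf0 aq_pi) aq_piE subr0. Qed.

Lemma alg_quot_scalerAl (a : K) (x y : alg_quot) : a *: (x * y) = (a *: x) * y.
Proof.
rewrite -(aq_reprK x) -(aq_reprK y) -rmorphM -!linearZ -rmorphM /=.
by rewrite scalerAl.
Qed.

End AlgQuot.

(* The free associative unital K-algebra on I is the monoid algebra of the
   monoid of words on I. *)
Notation free_alg K I := {malg K[{fmonom I}]}.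

Definition free_gen (K : comNzRingType) (I : choiceType) (i : I) :
  free_alg K I := << fmu i >>.

Section Presented.
Variables (K : comNzRingType) (I : choiceType) (X : free_alg K I -> Prop).

Definition presented := alg_quot X.

HB.instance Definition _ := GRing.PzRing.on presented.
HB.instance Definition _ := GRing.Lmodule.on presented.

Lemma presented_scalerAr (a : K) (x y : presented) : a *: (x * y) = x * (a *: y).
Proof.
rewrite -(aq_reprK x) -(aq_reprK y) -rmorphM -!linearZ -rmorphM /=.
congr aq_pi.
have malgCr c (g : free_alg K I) : g * c%:MP = c *: g.
  rewrite malgM_def malgZ_def fgmulgU; apply: eq_bigr => m _.
  by rewrite mulm1 mulrC.
by rewrite -!malgCr mulrA.
Qed.

End Presented.

Section RationalSchur.
Variables (K : fieldType) (n : nat).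

(* K is infinite in all uses, so K[GL_n] is the algebra of functions on GL_n(K)
   generated by the c_ij and d_ij; the operations on functions are pointwise. *)
Definition GLn := {g : 'M[K]_n | g \in unitmx}.

Lemma GLn_mul_subproof (g h : GLn) : val g *m val h \in unitmx.
Proof. by rewrite unitmx_mul (valP g) (valP h). Qed.

Definition GLn_one : GLn := exist _ 1%:M (unitmx1 K n).
Definition GLn_mul (g h : GLn) : GLn :=
  exist _ (val g *m val h) (GLn_mul_subproof g h).

Lemma GLn_mulA : associative GLn_mul.
Proof. by move=> g h k; apply: val_inj; rewrite /= mulmxA. Qed.

Lemma GLn_mul1g : left_id GLn_one GLn_mul.
Proof. by move=> g; apply: val_inj; rewrite /= mul1mx. Qed.

Lemma GLn_mulg1 : right_id GLn_one GLn_mul.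
Proof. by move=> g; apply: val_inj; rewrite /= mulmx1. Qed.

(* K^o is K as a module over itself. *)
Local Notation KG := (GLn -> K^o).

Definition coord_c (i j : 'I_n) : KG :=
  fun g => val g i j.
Definition coord_d (i j : 'I_n) : KG :=
  fun g => invmx (val g) i j.

Definition bimonomial (a b : 'M[nat]_n) : KG :=
  (\prod_i \prod_j coord_c i j ^+ a i j) *
  (\prod_i \prod_j coord_d i j ^+ b i j).

Definition is_bimonomial (r s : nat) (f : KG) : Prop :=
  exists a b : 'M[nat]_n,
    [/\ (\sum_i \sum_j a i j = r)%N, (\sum_i \sum_j b i j = s)%N
      & f = bimonomial a b].

Definition ratA_pred (r s : nat) : {pred KG} := span (is_bimonomial r s).

HB.instance Definition _ r s := GRing.SubmodClosed.on (ratA_pred r s).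

Section Comultiplication.

Let A := ratA_pred.

(* f(xy) = \sum_i u_i(x) v_i(y) *)
Definition is_comul (f : KG) (t : seq ((KG) * (KG))) :=
  forall x y, f (GLn_mul x y) = \sum_(p <- t) p.1 x * p.2 y.

Let fscaleAl a (f g : KG) : a *: (f * g) = a *: f * g.
Proof. by apply/funext => x; exact: mulrA. Qed.

Let fscaleAr a (f g : KG) : a *: (f * g) = f * (a *: g).
Proof. by apply/funext => x; exact: mulrCA. Qed.

Lemma ratAM r s r' s' f g :
  f \in A r s -> g \in A r' s' -> f * g \in A (r + r')%N (s + s')%N.
Proof.
move=> /asboolP + /asboolP hg; elim=> [|a u v [c [d [<- <- ->]]] _ IH].
  by rewrite mul0r rpred0.
rewrite mulrDl rpredD // -fscaleAl rpredZ //.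
elim: hg {IH} => [|a' u' v' [c' [d' [<- <- ->]]] _ IH].
  by rewrite mulr0 rpred0.
rewrite mulrDr rpredD // -fscaleAr rpredZ //.
apply: span_gen; exists (c + c'), (d + d'); split.
- rewrite -big_split; apply: eq_bigr => i _ /=; rewrite -big_split.
  by apply: eq_bigr => j _; rewrite mxE.
- rewrite -big_split; apply: eq_bigr => i _ /=; rewrite -big_split.
  by apply: eq_bigr => j _; rewrite mxE.
rewrite /bimonomial mulrACA; congr (_ * _); rewrite -big_split;
  by apply: eq_bigr => i _ /=; rewrite -big_split;
     apply: eq_bigr => j _; rewrite mxE exprD.
Qed.

Lemma ratA1 : 1 \in A 0 0.
Proof.
apply: span_gen; exists 0, 0; split.
- by rewrite big1 // => i _; rewrite big1 // => j _; rewrite mxE.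
- by rewrite big1 // => i _; rewrite big1 // => j _; rewrite mxE.
rewrite /bimonomial [X in X * _]big1 ?[X in _ * X]big1 ?mul1r // => i _;
  by rewrite big1 // => j _; rewrite mxE expr0.
Qed.

Let dm (i j : 'I_n) : 'M[nat]_n := \matrix_(k, l) nat_of_bool ((k == i) && (l == j)).

Lemma sum_dm i j : (\sum_k \sum_l dm i j k l = 1)%N.
Proof.
rewrite (bigD1 i) //= (bigD1 j) //= mxE !eqxx big1 ?big1 // => [k kNi|l lNj].
  by rewrite big1 // => l _; rewrite mxE (negPf kNi).
by rewrite mxE (negPf lNj) andbF.
Qed.

Lemma sum_0m : (\sum_(k < n) \sum_(l < n) (0%R : 'M[nat]_n) k l = 0)%N.
Proof. by rewrite big1 // => i _; rewrite big1 // => j _; rewrite mxE. Qed.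

Lemma prod_dm (R : comPzRingType) (F : 'I_n -> 'I_n -> R) i j :
  \prod_k \prod_l F k l ^+ dm i j k l = F i j.
Proof.
rewrite (bigD1 i) //= (bigD1 j) //= mxE !eqxx expr1.
rewrite big1 ?mulr1 => [|l lNj]; last by rewrite mxE (negPf lNj) andbF.
by rewrite big1 ?mulr1 // => k kNi; rewrite big1 // => l _; rewrite mxE (negPf kNi).
Qed.

Lemma prod_0m (R : comPzRingType) (F : 'I_n -> 'I_n -> R) :
  \prod_k \prod_l F k l ^+ (0%R : 'M[nat]_n) k l = 1.
Proof. by rewrite big1 // => i _; rewrite big1 // => j _; rewrite mxE. Qed.

Lemma coord_c_ratA i j : coord_c i j \in A 1 0.
Proof.
apply: span_gen; exists (dm i j), 0; split; rewrite ?sum_dm ?sum_0m //.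
by rewrite /bimonomial prod_dm prod_0m mulr1.
Qed.

Lemma coord_d_ratA i j : coord_d i j \in A 0 1.
Proof.
apply: span_gen; exists 0, (dm i j); split; rewrite ?sum_dm ?sum_0m //.
by rewrite /bimonomial prod_dm prod_0m mul1r.
Qed.

Let comul_ok r s f := exists2 t, is_comul f t &
  all (fun p => (p.1 \in A r s) && (p.2 \in A r s)) t.

Lemma comul_ok1 : comul_ok 0 0 1.
Proof.
exists [:: (1, 1)]; first by move=> x y; rewrite big_seq1 /= mulr1.
by rewrite /= ratA1.
Qed.

Lemma comul_okM r s r' s' f g :
  comul_ok r s f -> comul_ok r' s' g -> comul_ok (r + r') (s + s') (f * g).
Proof.
move=> [t ft /allP tA] [t' gt' /allP tA'].
exists [seq (p.1 * q.1, p.2 * q.2) | p <- t, q <- t'].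
  move=> x y; rewrite big_allpairs_dep /= -[LHS]/(f _ * g _) ft gt' mulr_suml.
  apply: eq_bigr => p _; rewrite mulr_sumr; apply: eq_bigr => q _.
  by rewrite mulrACA.
apply/allP=> _ /allpairsP [[p q] [/= /tA /andP[p1 p2] /tA' /andP[q1 q2] ->]] /=.
by rewrite !ratAM.
Qed.

Lemma comul_okX r s f k : comul_ok r s f -> comul_ok (k * r) (k * s) (f ^+ k).
Proof.
move=> hf; elim: k => [|k IH]; first exact: comul_ok1.
by rewrite exprS !mulSn; exact: comul_okM.
Qed.

Lemma comul_ok_prod (I : finType) (r s : I -> nat) (F : I -> KG) :
  (forall i, comul_ok (r i) (s i) (F i)) ->
  comul_ok (\sum_i r i) (\sum_i s i) (\prod_i F i).
Proof.
move=> hF; elim/big_rec3: _ => [|i f b a _ IH]; first exact: comul_ok1.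
exact: comul_okM.
Qed.

Lemma comul_ok_c i j : comul_ok 1 0 (coord_c i j).
Proof.
exists [seq (coord_c i k, coord_c k j) | k <- enum 'I_n].
  by move=> x y; rewrite big_map big_enum /= /coord_c /= mxE.
by apply/allP=> _ /mapP [k _ ->] /=; rewrite !coord_c_ratA.
Qed.

Lemma comul_ok_d i j : comul_ok 0 1 (coord_d i j).
Proof.
exists [seq (coord_d k j, coord_d i k) | k <- enum 'I_n].
  move=> x y; rewrite big_map big_enum /= /coord_d /=.
  have -> : invmx (val x *m val y) = invmx (val y) *m invmx (val x).
    have xyU := GLn_mul_subproof x y.
    apply: (row_full_inj (A := val x *m val y)); first by rewrite -row_full_unit in xyU.
    rewrite mulmxV // -mulmxA (mulmxA (val y)) mulmxV ?(valP y) //.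
    by rewrite mul1mx mulmxV ?(valP x).
  by rewrite mxE; apply: eq_bigr => k _; rewrite mulrC.
by apply/allP=> _ /mapP [k _ ->] /=; rewrite !coord_d_ratA.
Qed.

(* A(n,r,s) is a subcoalgebra of K[GL_n]. *)
Lemma ratA_subcoalgebra r s f : f \in A r s ->
  exists2 t, is_comul f t &
    all (fun p => (p.1 \in A r s) && (p.2 \in A r s)) t.
Proof.
move=> /asboolP; elim=> [|a u v [c [d [hc hd ->]]] _ [t vt tA]].
  by exists [::] => // x y; rewrite big_nil.
have [t' ut' tA'] : comul_ok r s (bimonomial c d).
  have -> : r = (\sum_i \sum_j c i j * 1 + \sum_i \sum_j d i j * 0)%N.
    rewrite -hc [X in (_ + X)%N]big1 ?addn0 => [|i _].
      by apply: eq_bigr => i _; apply: eq_bigr => j _; rewrite muln1.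
    by rewrite big1 // => j _; rewrite muln0.
  have -> : s = (\sum_i \sum_j c i j * 0 + \sum_i \sum_j d i j * 1)%N.
    rewrite -hd [X in (X + _)%N]big1 ?add0n => [|i _].
      by apply: eq_bigr => i _; apply: eq_bigr => j _; rewrite muln1.
    by rewrite big1 // => j _; rewrite muln0.
  apply: comul_okM; apply: comul_ok_prod => i; apply: comul_ok_prod => j.
    exact/comul_okX/comul_ok_c.
  exact/comul_okX/comul_ok_d.
exists ([seq (a *: p.1, p.2) | p <- t'] ++ t).
  move=> x y; rewrite big_cat big_map /= -[LHS]/(a * _ + v _) vt ut'.
  congr (_ + _); rewrite mulr_sumr; apply: eq_bigr => p _; exact: mulrA.
rewrite all_cat tA andbT; apply/allP => _ /mapP [p /(allP tA') /andP[p1 p2] ->] /=.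
by rewrite rpredZ.
Qed.

End Comultiplication.

Section Dual.
Variables r s : nat.

Record ratA := RatA { ratA_val :> KG; _ : ratA_val \in ratA_pred r s }.

HB.instance Definition _ := [isSub for ratA_val].
HB.instance Definition _ := [Choice of ratA by <:].
HB.instance Definition _ := [SubChoice_isSubLmodule of ratA by <:].

Lemma ratAP (f : ratA) : ratA_val f \in ratA_pred r s. Proof. exact: valP. Qed.

Lemma ratA_valD (f g : ratA) : ratA_val (f + g) = ratA_val f + ratA_val g.
Proof. exact: (raddfD (val : ratA -> KG)). Qed.

Lemma ratA_valZ a (f : ratA) : ratA_val (a *: f) = a *: ratA_val f.
Proof. exact: (linearZZ (val : {linear ratA -> KG})). Qed.

Lemma ratA_val_sum (I : Type) (t : seq I) (F : I -> ratA) :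
  ratA_val (\sum_(i <- t) F i) = \sum_(i <- t) ratA_val (F i).
Proof. exact: (raddf_sum (val : ratA -> KG)). Qed.

Lemma ratA_comul (f : ratA) : exists t : seq (ratA * ratA),
  forall x y, f (GLn_mul x y) = \sum_(p <- t) p.1 x * p.2 y.
Proof.
have [t ft /allP tA] := ratA_subcoalgebra (ratAP f).
exists [seq (insubd 0 p.1, insubd 0 p.2) | p <- t] => x y.
rewrite ft big_map; apply: eq_big_seq => p /tA /andP[p1 p2] /=.
by rewrite !insubdK.
Qed.

(* y |-> f(xy) *)
Lemma translate_subproof (f : ratA) (x : GLn) :
  (fun y => f (GLn_mul x y)) \in ratA_pred r s.
Proof.
have [t ft] := ratA_comul f.
rewrite [X in X \in _](_ : _ = ratA_val (\sum_(p <- t) p.1 x *: p.2)).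
  exact: ratAP.
rewrite ratA_val_sum; apply/funext => y; rewrite ft fct_sumE.
by apply: eq_bigr => p _; rewrite ratA_valZ.
Qed.

Definition translate f x : ratA := RatA (translate_subproof f x).

Lemma translate_comul (f : ratA) (t : seq (ratA * ratA)) (x : GLn) :
  (forall x y, f (GLn_mul x y) = \sum_(p <- t) p.1 x * p.2 y) ->
  translate f x = \sum_(p <- t) p.1 x *: p.2.
Proof.
move=> ft; apply: val_inj; rewrite /= ratA_val_sum; apply/funext => y.
rewrite fct_sumE -[LHS]/(f (GLn_mul x y)) ft.
by apply: eq_bigr => p _; rewrite ratA_valZ.
Qed.

Definition ratSchur := {scalar ratA}.

HB.instance Definition _ := gen_eqMixin ratSchur.
HB.instance Definition _ := gen_choiceMixin ratSchur.

Lemma ratSchurP (phi psi : ratSchur) :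
  (forall f : ratA, phi f = psi f) -> phi = psi.
Proof.
move: phi psi => [phi [[a1] [c1]]] [psi [[a2] [c2]]] /= /funext E.
rewrite -{psi}E in a2 c2 *.
by rewrite (Prop_irrelevance a1 a2) (Prop_irrelevance c1 c2).
Qed.

(* x |-> psi (y |-> f(xy)), that is (id (x) psi) (Delta f) *)
Lemma contract_subproof (psi : ratSchur) (f : ratA) :
  (fun x => psi (translate f x)) \in ratA_pred r s.
Proof.
have [t ft] := ratA_comul f.
rewrite [X in X \in _](_ : _ = ratA_val (\sum_(p <- t) psi p.2 *: p.1)).
  exact: ratAP.
rewrite ratA_val_sum; apply/funext => x; rewrite (translate_comul x ft) fct_sumE.
by rewrite linear_sum; apply: eq_bigr => p _; rewrite linearZ ratA_valZ /= mulrC.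
Qed.

Definition contract psi f : ratA := RatA (contract_subproof psi f).

Lemma contract_comul psi (f : ratA) (t : seq (ratA * ratA)) :
  (forall x y, f (GLn_mul x y) = \sum_(p <- t) p.1 x * p.2 y) ->
  contract psi f = \sum_(p <- t) psi p.2 *: p.1.
Proof.
move=> ft; apply: val_inj; rewrite /= ratA_val_sum; apply/funext => x.
rewrite fct_sumE -[LHS]/(psi (translate f x)) (translate_comul x ft) linear_sum.
by apply: eq_bigr => p _; rewrite linearZ ratA_valZ /= mulrC.
Qed.

Lemma translateP a f g x :
  translate (a *: f + g) x = a *: translate f x + translate g x.
Proof.
apply: val_inj; rewrite -[RHS]/(ratA_val _) ratA_valD ratA_valZ.
apply/funext => y; rewrite -[LHS]/((a *: f + g : ratA) (GLn_mul x y)).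
by rewrite ratA_valD ratA_valZ.
Qed.

Lemma contractP a psi f g :
  contract psi (a *: f + g) = a *: contract psi f + contract psi g.
Proof.
apply: val_inj; rewrite -[RHS]/(ratA_val _) ratA_valD ratA_valZ.
apply/funext => x; rewrite -[LHS]/(psi (translate (a *: f + g) x)).
by rewrite translateP linearP.
Qed.

Definition rs_of (phi : ratA -> K) (phiL : scalar phi) : ratSchur :=
  HB.pack_for ratSchur phi (GRing.isLinear.Build K ratA K *%R phi phiL).


Lemma rs_zero_subproof : scalar (fun _ : ratA => 0 : K).
Proof. by move=> a f g; rewrite mulr0 addr0. Qed.

Lemma rs_opp_subproof (phi : ratSchur) : scalar (fun f => - phi f).
Proof. by move=> a f g; rewrite linearP opprD mulrN. Qed.

Lemma rs_add_subproof (phi psi : ratSchur) : scalar (fun f => phi f + psi f).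
Proof. by move=> a f g; rewrite !linearP mulrDr addrACA. Qed.

Lemma rs_scale_subproof a (phi : ratSchur) : scalar (fun f => a * phi f).
Proof. by move=> b f g; rewrite linearP mulrDr mulrCA. Qed.

Lemma rs_one_subproof : scalar (fun f : ratA => f GLn_one).
Proof. by move=> a f g; rewrite ratA_valD ratA_valZ. Qed.

Lemma rs_mul_subproof (phi psi : ratSchur) :
  scalar (fun f => phi (contract psi f)).
Proof. by move=> a f g; rewrite contractP linearP. Qed.

Definition rs_zero := rs_of rs_zero_subproof.
Definition rs_opp phi := rs_of (rs_opp_subproof phi).
Definition rs_add phi psi := rs_of (rs_add_subproof phi psi).
Definition rs_scale a phi := rs_of (rs_scale_subproof a phi).

(* The unit is the counit of A(n,r,s), evaluation at the identity matrix. *)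
Definition rs_one := rs_of rs_one_subproof.

(* Convolution: phi applied to (id (x) psi)(Delta f); see ratSchurME. *)
Definition rs_mul phi psi := rs_of (rs_mul_subproof phi psi).

Let rs_addA : associative rs_add.
Proof. by move=> p q u; apply: ratSchurP => f; exact: addrA. Qed.
Let rs_addC : commutative rs_add.
Proof. by move=> p q; apply: ratSchurP => f; exact: addrC. Qed.
Let rs_add0 : left_id rs_zero rs_add.
Proof. by move=> p; apply: ratSchurP => f; exact: add0r. Qed.
Let rs_addN : left_inverse rs_zero rs_opp rs_add.
Proof. by move=> p; apply: ratSchurP => f; exact: addNr. Qed.

HB.instance Definition _ := GRing.isZmodule.Build ratSchur
  rs_addA rs_addC rs_add0 rs_addN.

Let rs_scaleA a b phi : rs_scale a (rs_scale b phi) = rs_scale (a * b) phi.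
Proof. by apply: ratSchurP => f; exact: mulrA. Qed.
Let rs_scale1 : left_id 1 rs_scale.
Proof. by move=> phi; apply: ratSchurP => f; exact: mul1r. Qed.
Let rs_scaleDr : right_distributive rs_scale +%R.
Proof. by move=> a p q; apply: ratSchurP => f; exact: mulrDr. Qed.
Let rs_scaleDl phi : {morph rs_scale^~ phi : a b / a + b}.
Proof. by move=> a b; apply: ratSchurP => f; exact: mulrDl. Qed.

HB.instance Definition _ := GRing.Zmodule_isLmodule.Build K ratSchur
  rs_scaleA rs_scale1 rs_scaleDr rs_scaleDl.

Let rs_mulA : associative rs_mul.
Proof.
move=> p q u; apply: ratSchurP => f; rewrite -[LHS]/(p (contract (rs_mul q u) f)).
rewrite -[RHS]/(p (contract q (contract u f))); congr (p _).
apply: val_inj; apply/funext => x.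
rewrite -[LHS]/(q (contract u (translate f x))).
rewrite -[RHS]/(q (translate (contract u f) x)); congr (q _).
apply: val_inj; apply/funext => y.
rewrite -[LHS]/(u (translate (translate f x) y)).
rewrite -[RHS]/(u (translate f (GLn_mul x y))); congr (u _).
by apply: val_inj; apply/funext => z; rewrite /= GLn_mulA.
Qed.

Let rs_mul1x : left_id rs_one rs_mul.
Proof.
move=> p; apply: ratSchurP => f; rewrite -[LHS]/(p (translate f GLn_one)).
by congr (p _); apply: val_inj; apply/funext => x; rewrite /= GLn_mul1g.
Qed.

Let rs_mulx1 : right_id rs_one rs_mul.
Proof.
move=> p; apply: ratSchurP => f; rewrite -[LHS]/(p (contract rs_one f)).
by congr (p _); apply: val_inj; apply/funext => x; rewrite /= GLn_mulg1.
Qed.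

Let rs_mulDl : left_distributive rs_mul +%R.
Proof. by move=> p q u; apply: ratSchurP. Qed.

Let rs_mulDr : right_distributive rs_mul +%R.
Proof.
move=> p q u; apply: ratSchurP => f.
rewrite -[RHS]/(p (contract q f) + p (contract u f)) -raddfD.
rewrite -[LHS]/(p (contract (q + u) f)); congr (p _).
by apply: val_inj; rewrite -[RHS]/(ratA_val _) ratA_valD.
Qed.

HB.instance Definition _ := GRing.Zmodule_isPzRing.Build ratSchur
  rs_mulA rs_mul1x rs_mulx1 rs_mulDl rs_mulDr.

Lemma ratSchur1E (f : ratA) : (1 : ratSchur) f = f GLn_one.
Proof. by []. Qed.

(* If Delta f = \sum_p p.1 (x) p.2 then
   (phi psi)(f) = \sum_p phi(p.1) psi(p.2); such p exist by ratA_comul. *)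
Lemma ratSchurME (phi psi : ratSchur) (f : ratA) (t : seq (ratA * ratA)) :
  (forall x y, f (GLn_mul x y) = \sum_(p <- t) p.1 x * p.2 y) ->
  (phi * psi) f = \sum_(p <- t) phi p.1 * psi p.2.
Proof.
move=> ft; rewrite -[LHS]/(phi (contract psi f)) (contract_comul psi ft).
by rewrite linear_sum; apply: eq_bigr => p _; rewrite linearZ /= mulrC.
Qed.

Lemma ratSchurDE (phi psi : ratSchur) (f : ratA) :
  (phi + psi) f = phi f + psi f.
Proof. by []. Qed.

Lemma ratSchurZE a (phi : ratSchur) (f : ratA) : (a *: phi) f = a * phi f.
Proof. by []. Qed.

Lemma ratSchur_scalerAl (a : K) (x y : ratSchur) : a *: (x * y) = (a *: x) * y.
Proof. exact: ratSchurP. Qed.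

Lemma ratSchur_scalerAr (a : K) (x y : ratSchur) : a *: (x * y) = x * (a *: y).
Proof.
apply: ratSchurP => f; have [t ft] := ratA_comul f.
rewrite ratSchurZE !(ratSchurME _ _ ft) mulr_sumr.
by apply: eq_bigr => p _; rewrite ratSchurZE mulrCA.
Qed.

End Dual.

End RationalSchur.

Section Presentation.
Variables (K : fieldType) (n r s : nat).

(* e_i and f_i for i < n - 1, and H_i for i < n (all indices from 0). *)
Definition gen_index : Type := ('I_n.-1 + 'I_n.-1 + 'I_n)%type.
HB.instance Definition _ := Choice.on gen_index.

Local Notation F := (free_alg K gen_index).

Definition gen_e (i : 'I_n.-1) : F := free_gen K (inl (inl i) : gen_index).
Definition gen_f (i : 'I_n.-1) : F := free_gen K (inl (inr i) : gen_index).
Definition gen_H (i : 'I_n) : F := free_gen K (inr i : gen_index).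

Lemma ord_succ_subproof (j : 'I_n.-1) : (j.+1 < n)%N.
Proof. by rewrite -ltn_predRL. Qed.

Definition ord_cur (j : 'I_n.-1) : 'I_n := widen_ord (leq_pred n) j.
Definition ord_succ (j : 'I_n.-1) : 'I_n := Ordinal (ord_succ_subproof j).

(* The weight lattice Z^n with its standard form. *)
Definition eps (i : 'I_n) : 'rV[int]_n := delta_mx 0 i.
Definition alpha (j : 'I_n.-1) : 'rV[int]_n := eps (ord_cur j) - eps (ord_succ j).
Definition wform (u v : 'rV[int]_n) : int := \sum_k u 0 k * v 0 k.

Lemma wform_eps_alpha i j :
  wform (eps i) (alpha j) = (i == ord_cur j)%:R - (i == ord_succ j)%:R.
Proof.
rewrite /wform (bigD1 i) //= big1 ?addr0 => [|k kNi].
  by rewrite !mxE !eqxx mul1r.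
by rewrite !mxE eqxx (negPf kNi) mul0r.
Qed.

Definition H_sum (S : {set 'I_n}) : F := \sum_(i in S) gen_H i.

(* Each relation u = v is recorded as the element u - v of the free algebra. *)
Inductive relator : F -> Prop :=
| RelHH i j : relator (gen_H i * gen_H j - gen_H j * gen_H i)
| RelEF i j : relator (gen_e i * gen_f j - gen_f j * gen_e i
    - (i == j)%:R *: (gen_H (ord_cur j) - gen_H (ord_succ j)))
| RelHE i j : relator (gen_H i * gen_e j - gen_e j * gen_H i
    - (wform (eps i) (alpha j))%:~R *: gen_e j)
| RelHF i j : relator (gen_H i * gen_f j - gen_f j * gen_H i
    - (- (wform (eps i) (alpha j))%:~R *: gen_f j))
| RelTrace : relator (\sum_i gen_H i - (r%:R - s%:R)%:A)
(* The range -r <= k <= s is shifted by r. *)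
| RelProd (S : {set 'I_n}) : S \proper [set: 'I_n] ->
    relator (\prod_(0 <= k < (r + s).+1) (H_sum S + (k%:R - r%:R)%:A)).

Definition ratSchur_presented := presented relator.

HB.instance Definition _ := GRing.PzRing.on ratSchur_presented.
HB.instance Definition _ := GRing.Lmodule.on ratSchur_presented.

End Presentation.

(* Main.v *)
From HB Require Import structures.
Require Import Defs.
From mathcomp Require Import all_boot all_order all_algebra.
From mathcomp Require Import perm boolp functions finmap monalg zify ring.

(** Let B be the presented algebra and S the rational Schur algebra. The theorem
    holds because sending e_i, f_i, H_i to the matrix units E_(i,i+1), E_(i+1,i),
    E_ii, acting by left invariant vector fields, defines a morphism from B to S
    which is onto since S is an image of U(gl_n), and injective since B is
    semisimple and all its simple modules are S-modules.

    The morphism. A matrix X defines a derivation [ldiff X] of functions on GL_n,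
    the derivative along g |-> g (1 + t X); it preserves A(n,r,s), and its value
    at the identity is an element [vfield X] of S. Derivations are determined by
    their values on the coordinate functions, whence [vfield_bracket] and
    [vfield_trace]. The derivation attached to a diagonal 0-1 matrix is
    diagonalisable on A(n,r,s) with integer eigenvalues between -s and r, which
    is relation (e) ([vfield_diag_prod]).

    Surjectivity. As A(n,r,s) is finite dimensional, it is enough that a function
    killed by the image is zero ([ratSchur_bidual]). All iterated invariant
    derivatives of such a function vanish at the identity, and in characteristic
    zero this makes it vanish along every curve t |-> 1 + t X
    ([invariant_derivatives_separate]).

    Injectivity. By (e) the H_i are simultaneously diagonalisable on every
    B-module, with finitely many weights ([weight_spanning]), so the e_i and f_i
    are nilpotent in B. The Serre relations are not among the relations: they
    follow, because in the adjoint action a vector killed by f_i of positive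
    weight generates an infinite chain under e_i ([ad_sl2_eq0], [ad_root]). One
    gets elements E_ij of B satisfying the relations of gl_n, hence a central
    Casimir element, which acts on a highest weight vector of weight l by
    (l, l + 2 rho); this is strictly increasing on dominant weights
    ([casimir_eig_lt]). The usual arguments then show that the regular module is
    generated by highest weight vectors ([hw_span_full]) and that highest weight
    vectors of the same weight have the same annihilator in the following sense:
    a left ideal killing one of them kills the other ([hwvec_annihilator]).

    Finally the weights of highest weight vectors of B are dominant and bounded
    by (e) and (d), and for each such weight A(n,r,s) contains a highest weight
    vector, a product of minors of the matrices C and C^-1 ([exists_hwfun]). The
    kernel of the morphism kills it, hence kills all highest weight vectors of
    B, hence kills 1 ([ideal_eq0]). *)

Set Implicit Arguments.
Unset Strict Implicit.
Unset Printing Implicit Defensive.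

Import Order.TTheory GRing.Theory Num.Theory.
Local Open Scope ring_scope.
Local Open Scope quotient_scope.

(** * Commutators, sl2 and root vectors *)

Section Commutator.
Variable B : pzRingType.
Implicit Types x y z : B.

Definition ad x y := x * y - y * x.

Fact ad_is_zmod_morphism x : zmod_morphism (ad x).
Proof. by move=> y z; rewrite /ad mulrBr mulrBl !opprD !opprK addrACA. Qed.

HB.instance Definition _ x :=
  GRing.isZmodMorphism.Build B B (ad x) (ad_is_zmod_morphism x).

Lemma adC x y : ad x y = - ad y x.
Proof. by rewrite /ad opprB. Qed.

Lemma adxx x : ad x x = 0.
Proof. exact: subrr. Qed.

Lemma adM x y z : ad x (y * z) = ad x y * z + y * ad x z.
Proof. by rewrite /ad mulrBl mulrBr !mulrA addrA subrK. Qed.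

Lemma ad_ad x y z : ad x (ad y z) = ad (ad x y) z + ad y (ad x z).
Proof.
rewrite [ad y z]/ad (raddfB (ad x)) /= !adM opprD [- _ - _]addrC addrACA.
by rewrite -[X in X + _]/(ad _ _) -[X in _ + X]/(ad _ _).
Qed.

Lemma adDl x y z : ad (x + y) z = ad x z + ad y z.
Proof. by rewrite adC (raddfD (ad z)) /= opprD -!adC. Qed.

Lemma adNl x z : ad (- x) z = - ad x z.
Proof. by rewrite adC (raddfN (ad z)) /= opprK adC. Qed.

Lemma adBl x y z : ad (x - y) z = ad x z - ad y z.
Proof. by rewrite adDl adNl. Qed.

Lemma adMnl x k z : ad (x *+ k) z = ad x z *+ k.
Proof. by rewrite adC (raddfMn (ad z)) /= -mulNrn -adC. Qed.

Lemma ad_eq0P x y : ad x y = 0 <-> x * y = y * x.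
Proof. by rewrite /ad; split=> [/eqP|->]; rewrite ?subrr // subr_eq0 => /eqP. Qed.

End Commutator.

(** A lowest weight vector of positive weight m + 1 generates an infinite chain:
    F (E^(k+1) x) = - (k + 1) (m + 1 + k) E^k x, and the coefficients do not
    vanish. *)
Lemma sl2_lowest_eq0 (V : zmodType) (E F h : {additive V -> V}) (N m : nat) (x : V) :
  (forall (v : V) k, v *+ k.+1 = 0 -> v = 0) ->
  (forall v, E (F v) - F (E v) = h v) ->
  (forall v, h (E v) - E (h v) = E v *+ 2) ->
  F x = 0 -> h x = x *+ m.+1 -> iter N E x = 0 -> x = 0.
Proof.
move=> tf EF hE Fx hx.
have hk k : h (iter k E x) = iter k E x *+ (m.+1 + k.*2).
  elim: k => [|k IH]; first by rewrite addn0.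
  by rewrite iterS -[LHS](subrK (E (h (iter k E x)))) hE IH raddfMn -mulrnDr;
    congr (_ *+ _); rewrite doubleS; lia.
have FE v : F (E v) = E (F v) - h v by rewrite -EF subKr.
have Fk k : F (iter k.+1 E x) = - (iter k E x *+ (k.+1 * (m.+1 + k))).
  elim: k => [|k IH]; first by rewrite /= FE Fx raddf0 sub0r hx mul1n addn0.
  rewrite iterS FE IH hk raddfN raddfMn -iterS -opprD -mulrnDr.
  by congr (- (_ *+ _)); rewrite -muln2; lia.
elim: N => [|N IH] // EN; apply: IH.
apply: (tf _ (N.+1 * (m.+1 + N)).-1); rewrite prednK; last by lia.
by rewrite -[LHS]opprK -Fk EN raddf0 oppr0.
Qed.

(** The relations of gl_n among the Chevalley generators, with nilpotency of the
    e_i and f_i in place of the Serre relations. The families are indexed by nat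
    and only constrained below n. *)
Record gl_system (B : pzRingType) (n : nat) (e f H : nat -> B) : Prop := GlSystem {
  gl_HH : forall i j, (i < n)%N -> (j < n)%N -> ad (H i) (H j) = 0;
  gl_ef : forall i j, (i.+1 < n)%N -> (j.+1 < n)%N ->
    ad (e i) (f j) = (H i - H i.+1) *+ (i == j);
  gl_He : forall i j, (i < n)%N -> (j.+1 < n)%N ->
    ad (H i) (e j) = e j *+ (i == j) - e j *+ (i == j.+1);
  gl_Hf : forall i j, (i < n)%N -> (j.+1 < n)%N ->
    ad (H i) (f j) = f j *+ (i == j.+1) - f j *+ (i == j);
  gl_eN : forall i, (i.+1 < n)%N -> exists N, e i ^+ N = 0;
  gl_fN : forall i, (i.+1 < n)%N -> exists N, f i ^+ N = 0 }.

(** The Chevalley involution; it halves the work on brackets of matrix units. *)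
Lemma gl_system_swap (B : pzRingType) n (e f H : nat -> B) :
  gl_system n e f H -> gl_system n (fun i => - f i) (fun i => - e i) (fun i => - H i).
Proof.
case=> HH ef He Hf eN fN; split=> i.
- by move=> j ? ?; rewrite adNl (raddfN (ad _)) /= HH // !oppr0.
- move=> j hi hj; rewrite adNl (raddfN (ad _)) /= opprK adC ef // -opprD eq_sym.
  by case: eqP => [->|]; rewrite ?mulr0n ?oppr0 // !mulr1n.
- by move=> j hi hj; rewrite adNl (raddfN (ad _)) /= opprK Hf // !mulNrn opprK addrC.
- by move=> j hi hj; rewrite adNl (raddfN (ad _)) /= opprK He // !mulNrn opprK addrC.
- by move=> /fN [N fN0]; exists N; rewrite exprNn fN0 mulr0.
- by move=> /eN [N eN0]; exists N; rewrite exprNn eN0 mulr0.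
Qed.

Section RootVectors.
Variables (B : pzRingType) (n : nat) (e f H : nat -> B).
Hypothesis sys : gl_system n e f H.
Hypothesis B_torsion_free : forall (v : B) k, v *+ k.+1 = 0 -> v = 0.

(** Left and right multiplication by x commute and are nilpotent, so that their
    difference is: ad^k y is a sum of terms x^a y x^b with a + b = k. *)
Lemma ad_nilp (x y : B) N : x ^+ N = 0 -> iter N.*2 (ad x) y = 0.
Proof.
move=> xN; have xK k : (N <= k)%N -> x ^+ k = 0.
  by move=> /subnKC <-; rewrite exprD xN mul0r.
pose P k z := forall a b, (k + a + b >= N.*2)%N -> x ^+ a * z * x ^+ b = 0.
suff Pk k : P k (iter k (ad x) y).
  by rewrite -[LHS]mul1r -[LHS]mulr1; apply: (Pk _ 0 0); rewrite !addn0.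
elim: k => [|k IH] a b h.
  have [/xK->|h1] := leqP N a; first by rewrite !mul0r.
  by rewrite (xK b) ?mulr0 //; lia.
rewrite iterS [ad _ _]/ad mulrBr mulrBl; set z := iter k _ _ in IH *.
rewrite (_ : x ^+ a * (x * z) * x ^+ b = x ^+ a.+1 * z * x ^+ b); last by rewrite exprSr !mulrA.
rewrite (_ : x ^+ a * (z * x) * x ^+ b = x ^+ a * z * x ^+ b.+1); last by rewrite exprS !mulrA.
by rewrite !IH ?subrr //; lia.
Qed.

Lemma ad_sl2_eq0 k m x : (k.+1 < n)%N -> ad (f k) x = 0 ->
  ad (H k - H k.+1) x = x *+ m.+1 -> x = 0.
Proof.
move=> hk fx hx; have [N eN] := gl_eN sys hk.
apply: (@sl2_lowest_eq0 _ (ad (e k)) (ad (f k)) (ad (H k - H k.+1)) N.*2 m) => //.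
- by move=> v /=; rewrite ad_ad (gl_ef sys) // eqxx addrK.
- move=> v /=; rewrite ad_ad addrK adBl !(gl_He sys) //; last exact: ltnW.
  rewrite !eqxx (gtn_eqF (ltnSn k)) (ltn_eqF (ltnSn k)) subr0 sub0r opprK.
  by rewrite adDl -mulr2n.
- exact: ad_nilp.
Qed.

(** The matrix unit E_(i, i + d + 1), as an iterated commutator. *)
Fixpoint root_vec i d := if d is d'.+1 then ad (root_vec i d') (e (i + d)) else e i.

Lemma rootS i d : root_vec i d.+1 = ad (root_vec i d) (e (i + d.+1)).
Proof. by []. Qed.

Lemma ad_H_root k i d : (k < n)%N -> (i + d.+1 < n)%N ->
  ad (H k) (root_vec i d) = root_vec i d *+ (k == i) - root_vec i d *+ (k == i + d.+1)%N.
Proof.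
move=> hk; elim: d => [|d IH] hd; first by rewrite /= (gl_He sys) ?addn1 // -addn1.
rewrite rootS ad_ad IH ?(gl_He sys); [|lia..].
rewrite adBl !adMnl (raddfB (ad _)) /= !(raddfMn (ad _)) /= -rootS addnS.
by rewrite addrA subrK !addnS.
Qed.

Lemma ad_fe i j : (i.+1 < n)%N -> (j.+1 < n)%N ->
  ad (f i) (e j) = - (H i - H i.+1) *+ (i == j).
Proof.
move=> hi hj; rewrite adC (gl_ef sys) // eq_sym mulNrn.
by case: eqP => // ->.
Qed.

(** If x has weight a for h_k and e_k f_k x = a x in the adjoint action, then
    f_k kills e_k x, which has positive weight a + 2. *)
Lemma ad_e_eq0 k a x : (k.+1 < n)%N -> ad (H k - H k.+1) x = x *+ a ->
  ad (e k) (ad (f k) x) = x *+ a -> ad (e k) x = 0.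
Proof.
move=> hk hx efx; apply: (@ad_sl2_eq0 k a.+1) => //.
  by rewrite ad_ad efx ad_fe // eqxx mulr1n adNl hx addNr.
rewrite ad_ad hx (raddfMn (ad _)) /= adBl !(gl_He sys) //; last exact: ltnW.
rewrite !eqxx (gtn_eqF (ltnSn k)) (ltn_eqF (ltnSn k)) subr0 sub0r opprK.
by rewrite adDl -mulr2n -mulrnDr.
Qed.

Lemma ad_ee i j : (i.+1 < n)%N -> (j.+1 < n)%N -> (i.+1 < j)%N || (j.+1 < i)%N ->
  ad (e i) (e j) = 0.
Proof.
move=> hi hj hij; apply: (@ad_e_eq0 i 0) => //.
  rewrite adBl !(gl_He sys) //; last exact: ltnW.
  have [-> -> -> ->] : [/\ i == j = false, i == j.+1 = false, i.+1 == j = false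
    & i.+1 == j.+1 = false] by split; lia.
  by rewrite !subrr.
by rewrite ad_fe // (_ : i == j = false) ?raddf0 //; lia.
Qed.

Lemma ad_e_root i d : (i.+1 + d.+1 < n)%N -> ad (e i) (root_vec i.+1 d) = root_vec i d.+1.
Proof.
elim: d => [|d IH] hd; first by rewrite /= addn1.
rewrite rootS ad_ad IH; last by lia.
by rewrite [ad (e i) (e _)]ad_ee ?raddf0 ?addr0 1?[RHS]rootS ?addnS ?addSn //; lia.
Qed.

(** The brackets with f_k follow from the definition and the vanishing of brackets
    with e_k for shorter roots, and the vanishing of brackets with e_k follows
    from the brackets with f_k by the sl2 argument; hence the joint induction.
    The Serre relations are the cases d = 0 and d = 1. *)
Lemma ad_root d i : (i + d.+1 < n)%N -> [/\
   forall k, (k.+1 < n)%N -> k != i -> k != (i + d)%N -> ad (f k) (root_vec i d) = 0,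
   forall d', d = d'.+1 -> ad (f i) (root_vec i d) = root_vec i.+1 d',
   forall d', d = d'.+1 -> ad (f (i + d)%N) (root_vec i d) = - root_vec i d' &
   forall k, (k.+1 < n)%N -> k.+1 != i -> k != (i + d.+1)%N -> ad (e k) (root_vec i d) = 0].
Proof.
elim/ltn_ind: d i => d IH i hd.
have F0 k : (k.+1 < n)%N -> k != i -> k != (i + d)%N -> ad (f k) (root_vec i d) = 0.
  move=> hk ki kid; case: d IH hd kid => [|d] IH hd kid.
    by rewrite /= ad_fe ?(negPf ki) //; lia.
  rewrite rootS ad_ad [ad (f k) (e _)]ad_fe //; last by lia.
  rewrite (negPf kid) mulr0n raddf0 addr0; have [Ek|kid'] := eqVneq k (i + d)%N; last first.
    by have [F0' _ _ _] := IH d (ltnSn d) i ltac:(lia); rewrite F0' // adC raddf0 oppr0.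
  case: d IH hd kid Ek => [|d] IH hd kid Ek; first by lia.
  rewrite Ek.
  have [_ _ F2' _] := IH d.+1 (ltnSn _) i ltac:(lia).
  rewrite (F2' d) //.
  have [_ _ _ E0] := IH d (ltnW (ltnSn _)) i ltac:(lia).
  by rewrite adNl adC E0 ?oppr0 //; lia.
have F1 d' : d = d'.+1 -> ad (f i) (root_vec i d) = root_vec i.+1 d'.
  move=> Ed; rewrite {}Ed in IH hd F0 *; rewrite rootS ad_ad [ad (f i) (e _)]ad_fe //; [|lia..].
  rewrite (_ : i == _ = false) ?raddf0 ?addr0; last by lia.
  case: d' IH hd F0 => [|d'] IH hd F0.
    rewrite /= ad_fe ?eqxx; [|lia..]; rewrite adNl adBl !(gl_He sys); [|lia..].
    have [i1 i2] : (i == i.+1) = false /\ (i == i.+2) = false by split; lia.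
    by rewrite addn1 eqxx eqSS i1 i2 subrr sub0r subr0 opprK.
  by have [_ F1' _ _] := IH d'.+1 (ltnSn _) i ltac:(lia); rewrite (F1' d') // rootS addSn !addnS.
have F2 d' : d = d'.+1 -> ad (f (i + d)%N) (root_vec i d) = - root_vec i d'.
  move=> Ed; rewrite {}Ed in IH hd F0 F1 *; rewrite rootS ad_ad.
  have [F0' _ _ _] := IH d' (ltnSn _) i ltac:(lia).
  rewrite F0'; [|lia..]; rewrite ad_fe ?eqxx; [|lia..].
  rewrite adC raddf0 oppr0 add0r (raddfN (ad _)) /= -adC adBl !ad_H_root; [|lia..].
  have [-> -> ->] : [/\ (i + d'.+1 == i)%N = false, ((i + d'.+1).+1 == i)%N = false
    & ((i + d'.+1).+1 == i + d'.+1)%N = false] by split; lia.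
  by rewrite eqxx subrr subr0 sub0r.
split=> // k hk ki kid.
case: d IH hd F0 F1 F2 kid => [|d] IH hd F0 F1 F2 kid.
  have [->|kni] := eqVneq k i; first exact: adxx.
  by rewrite /= ad_ee //; lia.
have wt : ad (H k - H k.+1) (root_vec i d.+1) = root_vec i d.+1 *+ ((k == i) + (k == i + d.+1)%N).
  rewrite adBl !ad_H_root //; try lia.
  rewrite (negPf ki) (negPf kid) (_ : k.+1 == (i + d.+2)%N = (k == i + d.+1)%N); last by lia.
  by rewrite subr0 sub0r opprK -mulrnDr.
apply: ad_e_eq0 wt _ => //.
have [Ek|kni] := eqVneq k i.
  rewrite Ek (F1 d) // ad_e_root; last by lia.
  by rewrite (_ : i == _ = false) ?addn0 //; lia.
have [Ek|knid] := eqVneq k (i + d.+1)%N; last by rewrite F0 // raddf0.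
by rewrite Ek (F2 d) // (raddfN (ad _)) /= -adC -rootS.
Qed.

End RootVectors.

(** The matrix units: below the diagonal they are obtained from those above it
    through the Chevalley involution. *)
Definition gl_unit (B : pzRingType) (e f H : nat -> B) (i j : nat) : B :=
  if (i < j)%N then root_vec e i (j - i.+1)
  else if (j < i)%N then - root_vec (fun k => - f k) j (i - j.+1) else H i.

Section MatrixUnits.
Variables (B : pzRingType).
Hypothesis B_torsion_free : forall (v : B) k, v *+ k.+1 = 0 -> v = 0.

Lemma eq_root (e e' : nat -> B) : e =1 e' -> root_vec e =2 root_vec e'.
Proof. by move=> ee i; elim=> [|d /= ->]; rewrite /= ee. Qed.

Lemma gl_unit_swap (e f H : nat -> B) i j :
  gl_unit (fun k => - f k) (fun k => - e k) (fun k => - H k) i j = - gl_unit e f H j i.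
Proof.
rewrite /gl_unit; case: ltngtP => [ij|ji|->] //; first by rewrite opprK.
by congr (- _); apply: eq_root => k; rewrite opprK.
Qed.

Lemma gl_unit_up (e f H : nat -> B) i d : gl_unit e f H i (i + d.+1) = root_vec e i d.
Proof. by rewrite /gl_unit ifT ?addnS; [congr root_vec; lia | lia]. Qed.

Lemma gl_unit_dn (e f H : nat -> B) i d :
  gl_unit e f H (i + d.+1) i = - root_vec (fun k => - f k) i d.
Proof.
rewrite /gl_unit ifF ?ifT ?addnS; try lia.
by congr (- root_vec _ _ _); lia.
Qed.

Lemma gl_unit_diag (e f H : nat -> B) i : gl_unit e f H i i = H i.
Proof. by rewrite /gl_unit ltnn. Qed.

Lemma gl_unit_simple (e f H : nat -> B) i : gl_unit e f H i i.+1 = e i.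
Proof. by rewrite -addn1 gl_unit_up. Qed.

Variant nat_cmp_spec (i j : nat) : Prop :=
  | CmpUp d of j = (i + d.+1)%N
  | CmpDn d of i = (j + d.+1)%N
  | CmpEq of i = j.

Lemma nat_cmpP i j : nat_cmp_spec i j.
Proof.
case: (ltngtP i j) => ij; last exact: CmpEq.
  by apply: (@CmpUp _ _ (j - i.+1)); lia.
by apply: (@CmpDn _ _ (i - j.+1)); lia.
Qed.

Lemma ad_e_unit n (e f H : nat -> B) (sys : gl_system n e f H) k i j : 
  (k.+1 < n)%N -> (i < n)%N -> (j < n)%N -> let E := gl_unit e f H in
  ad (e k) (E i j) = E k j *+ (k.+1 == i) - E i k.+1 *+ (j == k).
Proof.
move=> hk hi hj E; case: (nat_cmpP i j) => [d Ej|d Ei|Ei]; [subst j|subst i|subst i].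
- rewrite {1}/E gl_unit_up.
  have [Ei|ki] := eqVneq k.+1 i.
    subst i; rewrite (ad_e_root sys B_torsion_free) //.
    by rewrite (_ : (k.+1 + d.+1 == k)%N = false) ?subr0 /E ?addSnnS ?gl_unit_up //; lia.
  have [jk|jk] := eqVneq (i + d.+1)%N k.
    by rewrite sub0r -jk -!addnS /E gl_unit_up rootS -adC.
  have [_ _ _ ->] := ad_root sys B_torsion_free hj => //; first by rewrite subrr.
  by rewrite eq_sym.
- have sys' := gl_system_swap sys; rewrite {1}/E gl_unit_dn.
  have [F0 F1 F2 _] := ad_root sys' B_torsion_free hi.
  have adee x : ad (e k) (- x) = ad (- e k) x by rewrite (raddfN (ad _)) /= adNl.
  rewrite adee; case: d F0 F1 F2 hi => [|d] F0 F1 F2 hi.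
    have [kj|kj] := eqVneq j k.
      by subst k; rewrite -adee /= opprK (gl_ef sys) // addn1 !eqxx !mulr1n /E !gl_unit_diag.
    rewrite eq_sym in kj; rewrite F0 ?addn0 // addn1 eqSS (negPf kj).
    by rewrite subrr.
  have [jk|kj] := eqVneq j k.
    subst k; rewrite (F1 d) // (_ : (j.+1 == j + d.+2)%N = false); last by lia.
    by rewrite sub0r mulr1n -addSnnS /E gl_unit_dn opprK.
  have [kjd|kjd] := eqVneq k.+1 (j + d.+2)%N.
    have -> : k = (j + d.+1)%N by lia.
    by rewrite (F2 d) // subr0 /E gl_unit_dn.
  by rewrite F0 ?subrr //; lia.
rewrite {1}/E gl_unit_diag adC (gl_He sys) // opprB (eq_sym k.+1) /E.
have [Ej|jk] := eqVneq j k.+1.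
  by rewrite Ej gl_unit_simple (gtn_eqF (ltnSn k)) !subr0.
by have [->|_] := eqVneq j k; rewrite ?gl_unit_simple.
Qed.

Section Casimir.
Variables (n : nat) (e f H : nat -> B).
Hypothesis sys : gl_system n e f H.
Local Notation E := (gl_unit e f H).

Lemma ad_f_unit k i j : (k.+1 < n)%N -> (i < n)%N -> (j < n)%N ->
  ad (f k) (E i j) = E k.+1 j *+ (k == i) - E i k *+ (j == k.+1).
Proof.
move=> hk hi hj; have := ad_e_unit (gl_system_swap sys) hk hj hi.
rewrite /= !gl_unit_swap adNl (raddfN (ad _)) /= opprK => ->.
by rewrite !mulNrn opprK addrC (eq_sym i) (eq_sym k.+1).
Qed.

Lemma ad_H_unit k i j : (k < n)%N -> (i < n)%N -> (j < n)%N ->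
  ad (H k) (E i j) = E k j *+ (k == i) - E i k *+ (j == k).
Proof.
move=> hk hi hj; case: (nat_cmpP i j) => [d Ej|d Ei|Ei]; [subst j|subst i|subst i].
- rewrite gl_unit_up (ad_H_root sys) // (eq_sym _ k).
  by congr (_ - _); case: eqP => // ->; rewrite gl_unit_up.
- rewrite gl_unit_dn (raddfN (ad _)) /= -adNl (ad_H_root (gl_system_swap sys)) //.
  rewrite addrC (eq_sym _ k) -mulNrn -[X in _ + X]opprK -[- (_ *+ (k == j))]mulNrn.
  by congr (_ - _); case: eqP => // ->; rewrite gl_unit_dn.
rewrite gl_unit_diag (gl_HH sys) // eq_sym.
by case: eqP => [->|_]; rewrite ?subrr.
Qed.

Definition casimir := \sum_(i < n) \sum_(j < n) E i j * E j i.

(** Any element acting on the matrix units as a matrix unit does commutes with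
    the invariant tensor that defines the Casimir element. *)
Lemma ad_casimir x p q : (p < n)%N -> (q < n)%N ->
  (forall i j, (i < n)%N -> (j < n)%N ->
    ad x (E i j) = E p j *+ (q == i) - E i q *+ (j == p)) ->
  ad x casimir = 0.
Proof.
move=> hp hq xE; have sum1 q' (F : nat -> B) : (q' < n)%N -> \sum_(i < n) F i *+ (q' == i) = F q'.
  move=> hq'; rewrite (bigD1 (Ordinal hq')) //= eqxx big1 ?addr0 // => i.
  by rewrite -val_eqE /= eq_sym => /negPf ->.
have sumE (F : nat -> nat -> B) (G : nat -> nat -> B) :
    (forall i j : 'I_n, F i j = G i j) ->
    \sum_(i < n) \sum_(j < n) F i j = \sum_(i < n) \sum_(j < n) G i j.
  by move=> FG; apply: eq_bigr => i _; apply: eq_bigr => j _.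
rewrite /casimir (raddf_sum (ad x)).
under eq_bigr do rewrite (raddf_sum (ad x)).
rewrite /= (sumE (fun i j => ad x (E i j * E j i))
    (fun i j => (E p j * E j i *+ (q == i) - E i q * E j i *+ (p == j)%N)
    + (E i j * E p i *+ (q == j)%N - E i j * E j q *+ (p == i)))); last first.
  move=> i j; rewrite adM !xE // mulrBl mulrBr !mulrnAl !mulrnAr.
  by rewrite (eq_sym (j : nat) p) (eq_sym (i : nat) p).
under eq_bigr do rewrite big_split /= !sumrB; rewrite big_split /= !sumrB.
rewrite (exchange_big_dep xpredT) //=.
under eq_bigr do rewrite (sum1 q (fun i => E p _ * E _ i)) //.
under [X in _ - X + _]eq_bigr do rewrite (sum1 p (fun j => E _ q * E j _)) //.
under [X in _ + (X - _)]eq_bigr do rewrite (sum1 q (fun j => E _ j * E p _)) //.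
rewrite [X in _ + (_ - X)](exchange_big_dep xpredT) //=.
under [X in _ + (_ - X)]eq_bigr do rewrite (sum1 p (fun i => E i _ * E _ q)) //.
by rewrite addrA subrK subrr.
Qed.

Lemma casimir_comm_e k : (k.+1 < n)%N -> casimir * e k = e k * casimir.
Proof.
move=> hk; apply/esym/ad_eq0P; apply: (ad_casimir (ltnW hk) hk).
by move=> i j hi hj; exact: (ad_e_unit sys hk hi hj).
Qed.

Lemma casimir_comm_f k : (k.+1 < n)%N -> casimir * f k = f k * casimir.
Proof.
move=> hk; apply/esym/ad_eq0P; apply: (ad_casimir hk (ltnW hk)).
by move=> i j hi hj; exact: ad_f_unit.
Qed.

Lemma casimir_comm_H k : (k < n)%N -> casimir * H k = H k * casimir.
Proof.
move=> hk; apply/esym/ad_eq0P; apply: (ad_casimir hk hk).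
by move=> i j hi hj; exact: ad_H_unit.
Qed.

Lemma ad_unit_step i d y : ad (E i (i + d.+2)) y =
  ad (E i (i + d.+1)) (ad (e (i + d.+1)%N) y) - ad (e (i + d.+1)%N) (ad (E i (i + d.+1)) y).
Proof. by rewrite ad_ad addrK !gl_unit_up. Qed.

Lemma ad_unit_col i d m : (i + d.+1 < m)%N -> (m < n)%N ->
  ad (E i (i + d.+1)) (E m i) = - E m (i + d.+1).
Proof.
elim: d => [|d IH] dm mn.
  rewrite gl_unit_up /= (ad_e_unit sys) ?eqxx; try lia.
  have -> : (i.+1 == m) = false by lia.
  by rewrite addn1 sub0r.
rewrite ad_unit_step IH; try lia.
rewrite (raddfN (ad _)) /= !(ad_e_unit sys) ?eqxx; try lia.
have [-> ->] : ((i + d.+1).+1 == m)%N = false /\ (i == i + d.+1)%N = false by split; lia.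
by rewrite !mulr0n subrr raddf0 !sub0r opprK mulr1n !addnS.
Qed.

(** This bracket is what turns the Casimir element into its ordered form, with
    the e-part on the right, on highest weight vectors. *)
Lemma ad_unit_opp i d : (i + d.+1 < n)%N ->
  ad (E i (i + d.+1)) (E (i + d.+1) i) = H i - H (i + d.+1)%N.
Proof.
elim: d => [|d IH] hd.
  rewrite gl_unit_up /= (ad_e_unit sys) ?eqxx; try lia.
  by rewrite addn1 !eqxx !gl_unit_diag.
rewrite ad_unit_step ad_unit_col; try lia.
rewrite (raddfN (ad _)) /= !(ad_e_unit sys) ?eqxx; try lia.
have [-> ->] : (i == i + d.+1)%N = false /\ ((i + d.+1).+1 == i + d.+2)%N = true by split; lia.
rewrite mulr1n !subr0 IH ?opprK; last by lia.
by rewrite !mulr1n !addnS !gl_unit_diag addrA subrK.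
Qed.

End Casimir.

End MatrixUnits.

(** * Quotient modules and weight decompositions *)

Section QuotientModule.
Variables (R : pzRingType) (V : lmodType R) (S : {pred V}).
Hypothesis S_submod : submod_closed S.

(** The predicate S, tagged with the proof that it is a submodule so that canonical
    structures can find it. *)
Definition submod_pred of submod_closed S : {pred V} := S.

Fact submod_pred_zmod_closed : zmod_closed (submod_pred S_submod).
Proof. exact: GRing.submod_closedB. Qed.

HB.instance Definition _ := GRing.isZmodClosed.Build V (submod_pred S_submod)
  submod_pred_zmod_closed.

Definition quot_mod := Quotient.quot (submod_pred S_submod).
HB.instance Definition _ := GRing.Zmodule.on quot_mod.
HB.instance Definition _ := EqQuotient.on quot_mod.

Definition qm_pi (x : V) : quot_mod := \pi_quot_mod x.

Lemma qm_piD : {morph qm_pi : x y / x + y}.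
Proof. by move=> x y; exact: (raddfD (\pi_quot_mod)). Qed.

Lemma qm_reprK x : qm_pi (repr x) = x.
Proof. exact: reprK. Qed.

Lemma qm_piE x y : qm_pi x = qm_pi y <-> x - y \in S.
Proof.
rewrite (Quotient.idealrBE (submod_pred S_submod)); split=> [h|/eqP h]; last exact: h.
by apply/eqP; exact: h.
Qed.

Definition qm_scale (a : R) (x : quot_mod) : quot_mod := qm_pi (a *: repr x).

Lemma qm_piZ a x : qm_scale a (qm_pi x) = qm_pi (a *: x).
Proof. apply/qm_piE; rewrite -scalerBr; apply: (GRing.submod_closed_semi S_submod).2.
by apply/qm_piE; rewrite qm_reprK. Qed.

Fact qm_scalerA a b x : qm_scale a (qm_scale b x) = qm_scale (a * b) x.
Proof. by rewrite -(qm_reprK x) !qm_piZ scalerA. Qed.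
Fact qm_scale1r : left_id 1 qm_scale.
Proof. by move=> x; rewrite -(qm_reprK x) qm_piZ scale1r. Qed.
Fact qm_scalerDr : right_distributive qm_scale +%R.
Proof.
move=> a x y; rewrite -(qm_reprK x) -(qm_reprK y).
by rewrite -qm_piD !qm_piZ -qm_piD scalerDr.
Qed.
Fact qm_scalerDl x : {morph qm_scale^~ x : a b / a + b}.
Proof. by move=> a b; rewrite -(qm_reprK x) !qm_piZ -qm_piD scalerDl. Qed.

HB.instance Definition _ := GRing.Zmodule_isLmodule.Build R quot_mod
  qm_scalerA qm_scale1r qm_scalerDr qm_scalerDl.

Fact qm_pi_is_linear : linear qm_pi.
Proof. by move=> a x y; rewrite qm_piD -qm_piZ. Qed.
HB.instance Definition _ :=
  GRing.isLinear.Build R V quot_mod *:%R qm_pi qm_pi_is_linear.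

Lemma qm_pi_eq0 x : qm_pi x = 0 <-> x \in S.
Proof. by rewrite -(raddf0 qm_pi) qm_piE subr0. Qed.

End QuotientModule.

Section Weights.
Variables (K : fieldType) (charK : [pchar K] =i pred0).
Variables (B : pzRingType) (sc : {rmorphism K -> B}).
Hypothesis scC : forall a b, sc a * b = b * sc a.
Variables (n : nat) (H : nat -> B).
Hypothesis HH : forall i j, (i < n)%N -> (j < n)%N -> ad (H i) (H j) = 0.

Lemma natK_neq0 k : k.+1%:R != 0 :> K.
Proof. by have /pcharf0P -> := charK. Qed.

Lemma intK_neq0 (a : int) : a != 0 -> a%:~R != 0 :> K.
Proof.
by case: a => [[|k]|k] // _; rewrite ?NegzE ?mulrNz ?oppr_eq0; exact: natK_neq0.
Qed.

Section OneModule.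
Variable V : lmodType B.
Implicit Types (u v x y z : V).

Lemma int_scale (a : int) v : a%:~R *: v = v *~ a.
Proof. exact: scaler_int. Qed.

Lemma scale_mulrz (b : B) v (a : int) : b *: (v *~ a) = (b *: v) *~ a.
Proof. exact: (raddfMz (GRing.scale b)). Qed.

Lemma sc_scaleC (b : B) a v : b *: (sc a *: v) = sc a *: (b *: v).
Proof. by rewrite !scalerA scC. Qed.

Lemma sc_mulrz (a : int) v : sc (a%:~R)^-1 *: (v *~ a) = if a == 0 then 0 else v.
Proof.
case: eqP => [->|/eqP /intK_neq0 a0]; first by rewrite scaler0.
by rewrite -int_scale -(rmorph_int sc) scalerA -rmorphM mulVf // rmorph1 scale1r.
Qed.

Lemma mod_torsion_free v (a : int) : v *~ a = 0 -> a != 0 -> v = 0.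
Proof.
by move=> va /negPf a0; have := sc_mulrz a v; rewrite va scaler0 a0.
Qed.

Definition weight (l : nat -> int) v := forall i, (i < n)%N -> H i *: v = v *~ l i.

(** Decomposition into eigenvectors of a single operator annihilated by a
    product of distinct linear factors: dividing out one factor at a time, the
    remaining eigenvectors of (h - a) y are rescaled and subtracted from y. *)
Lemma eigen_ind (h : B) (s : seq int) (C Q : V -> Prop) :
  uniq s ->
  (forall x y, C x -> C y -> C (x - y)) ->
  (forall a x, C x -> C (sc a *: x)) -> (forall x, C x -> C (h *: x)) ->
  Q 0 -> (forall x y, Q x -> Q y -> Q (x + y)) ->
  (forall a x, a \in s -> C x -> h *: x = x *~ a -> Q x) ->
  forall y, C y -> \prod_(a <- s) (h - a%:~R) *: y = 0 -> Q y.
Proof.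
move=> + CB CZ Ch; elim/last_ind: s Q => [|s a IH] Q us Q0 QD Qh y Cy.
  by rewrite big_nil scale1r => ->.
rewrite -cats1 big_cat big_seq1 /= -scalerA => hy.
move: us; rewrite rcons_uniq => /andP [as_ us].
have C0 : C 0 by rewrite -(subrr y); exact: CB.
have CD u v : C u -> C v -> C (u + v).
  by move=> Cu Cv; rewrite -[v]opprK -[- v]sub0r; apply: (CB) => //; apply: CB.
have CMz u (b : int) : C u -> C (u *~ b).
  by move=> Cu; rewrite -int_scale -(rmorph_int sc); exact: CZ.
suff [y' [Cy' [Qy' /eqP]]] : exists y', C y' /\ (Q y' /\ (h - a%:~R) *: y' = (h - a%:~R) *: y).
  rewrite -subr_eq0 -scalerBr => /eqP hyy.
  rewrite -(subrK y' y); apply: QD Qy'; apply: (Qh a); first by rewrite mem_rcons mem_head.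
    exact: CB.
  apply/eqP; rewrite -subr_eq0 -int_scale -scalerBl -(opprB y' y) scalerN.
  by rewrite hyy oppr0.
apply: (IH (fun z => exists y', C y' /\ (Q y' /\ (h - a%:~R) *: y' = z)) us) hy => //.
- by exists 0; rewrite scaler0.
- move=> _ _ [u [Cu [Qu <-]]] [v [Cv [Qv <-]]]; exists (u + v); split; first exact: CD.
  by split; [exact: QD | rewrite scalerDr].
- move=> b x bs Cx hx; have ba : b - a != 0.
    by rewrite subr_eq0; apply: contraNneq as_ => <-.
  (* x is rescaled so that h - a sends it back to x *)
  exists (sc ((b - a)%:~R)^-1 *: x); split; first exact: CZ.
  have hx' : h *: (sc (b - a)%:~R^-1 *: x) = (sc (b - a)%:~R^-1 *: x) *~ b.
    by rewrite sc_scaleC hx scale_mulrz.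
  split; first by apply: Qh hx'; [rewrite mem_rcons inE bs orbT | exact: CZ].
  by rewrite scalerBl hx' int_scale -mulrzBr -scale_mulrz sc_mulrz (negPf ba).
by rewrite scalerBl int_scale; apply: CB; [exact: Ch | exact: CMz].
Qed.

Variables (s : seq int) (us : uniq s).
Hypothesis Hs : forall i, (i < n)%N -> \prod_(a <- s) (H i - a%:~R) = 0.

(** Induction on the number of operators H_i that are already diagonalised; the
    eigenvectors of the next one are produced inside the previous eigenspaces. *)
Lemma weight_ind (C Q : V -> Prop) :
  (forall x y, C x -> C y -> C (x - y)) -> (forall b x, C x -> C (b *: x)) ->
  Q 0 -> (forall x y, Q x -> Q y -> Q (x + y)) ->
  (forall l x, (forall i, (i < n)%N -> l i \in s) -> C x -> weight l x -> Q x) ->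
  forall y, C y -> Q y.
Proof.
move=> CB CZ Q0 QD Qw y Cy.
suff: forall j, (j <= n)%N -> forall l y, C y ->
    (forall i, (i < n - j)%N -> l i \in s /\ H i *: y = y *~ l i) -> Q y.
  by move=> /(_ n (leqnn n) (fun=> 0) y Cy); apply=> i; rewrite subnn.
elim=> [_ l {Cy}y Cy wy|j IH hj l {Cy}y Cy wy].
  rewrite subn0 in wy; apply: (Qw l) => // i /wy []//.
pose m := (n - j.+1)%N; have mn : (m < n)%N by rewrite /m; lia.
pose C' x := C x /\ forall i, (i < m)%N -> l i \in s /\ H i *: x = x *~ l i.
apply: (@eigen_ind (H m) s C' Q) => //.
- move=> u v [Cu wu] [Cv wv]; split; first exact: CB.
  move=> i im; have [? hu] := wu i im; have [_ hv] := wv i im; split=> //.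
  by rewrite scalerBr hu hv mulrzBl.
- move=> a x [Cx wx]; split; first exact: CZ.
  by move=> i im; have [? hx] := wx i im; split; rewrite // sc_scaleC hx scale_mulrz.
- move=> x [Cx wx]; split; first exact: CZ.
  move=> i im; have [? hx] := wx i im; split=> //; rewrite scalerA.
  have /ad_eq0P -> := HH (ltn_trans im mn) mn.
  by rewrite -scalerA hx scale_mulrz.
- move=> a x as_ [Cx wx] hx.
  apply: (IH _ (fun i => if i == m then a else l i)) => //; first by lia.
  move=> i ij; case: eqP => [->|/eqP im] //; apply: wx; rewrite /m in im *; lia.
by rewrite Hs // scale0r.
Qed.

Lemma weightB l x y : weight l x -> weight l y -> weight l (x - y).
Proof. by move=> wx wy i hi; rewrite scalerBr wx // wy // mulrzBl. Qed.

Lemma weightZ l a x : weight l x -> weight l (sc a *: x).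
Proof. by move=> wx i hi; rewrite sc_scaleC wx // scale_mulrz. Qed.

(** A product of factors H_i - m_i, one for each summand, kills the sum and acts
    on z by a nonzero scalar. *)
Lemma weight_separation (I : eqType) (t : seq I) (P : pred I) (x : I -> V)
    (m : I -> nat -> int) l z :
  weight l z ->
  (forall j, j \in t -> P j -> weight (m j) (x j) /\ exists2 i, (i < n)%N & m j i != l i) ->
  z = \sum_(j <- t | P j) x j -> z = 0.
Proof.
move=> wz wx zE.
suff [b [a [a0 bz bx]]] : exists b : B, exists a : int, [/\ a != 0, b *: z = z *~ a &
    forall j, j \in t -> P j -> b *: x j = 0].
  apply: (@mod_torsion_free _ a) => //; rewrite -bz zE scaler_sumr.
  by rewrite big_seq_cond big1 // => j /andP [/bx]; apply.
elim: t {zE} wx => [|j t IH] wx; first by exists 1, 1; rewrite scale1r mulr1z.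
have [j' jt Pj|b [a [a0 bz bx]]] := IH; first by apply: wx; rewrite // inE jt orbT.
have [Pj|NPj] := boolP (P j); last first.
  exists b, a; split=> // j'; rewrite inE => /predU1P [->|]; last exact: bx.
  by rewrite (negPf NPj).
have [wj [i hi mi]] := wx j (mem_head _ _) Pj.
exists (b * (H i - (m j i)%:~R)), (a * (l i - m j i)); split.
- by rewrite mulf_neq0 // subr_eq0 eq_sym.
- by rewrite -scalerA scalerBl int_scale wz // -mulrzBr scale_mulrz bz -mulrzA.
move=> j'; rewrite -scalerA scalerBl int_scale inE => /predU1P [-> _|j't Pj'].
  by rewrite wj // subrr scaler0.
have [|wj' _] := wx j' _ Pj'; first by rewrite inE j't orbT.
by rewrite wj' // -mulrzBr scale_mulrz bx // mul0rz.
Qed.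

End OneModule.
End Weights.

(** * Highest weight theory modulo the relations *)

Definition sroot (k i : nat) : int := (i == k)%:Z - (i == k.+1)%:Z.
Definition wroot (w : seq nat) (i : nat) : int := \sum_(k <- w) sroot k i.

(** The eigenvalue (l, l + 2 rho) of the Casimir element on a highest weight
    vector of weight l, for the normalisation 2 rho = (n-1, n-3, ..., 1-n). *)
Definition casimir_eig (n : nat) (l : nat -> int) : int :=
  \sum_(i < n) l i * (l i + n%:Z - 1 - 2 * i%:Z).

Lemma sum_sroot n (g : nat -> int) k : (k.+1 < n)%N ->
  \sum_(i < n) sroot k i * g i = g k - g k.+1.
Proof.
move=> hk; rewrite (bigD1 (Ordinal (ltnW hk))) //= (bigD1 (Ordinal hk)) /=; last first.
  by rewrite -val_eqE /= gtn_eqF.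
rewrite big1 => [|i /andP []]; last first.
  by rewrite -!val_eqE /= /sroot => /negPf -> /negPf ->; rewrite subrr mul0r.
by rewrite /sroot !eqxx (ltn_eqF (ltnSn k)) (gtn_eqF (ltnSn k)); lia.
Qed.

Lemma sum_wroot n (g : nat -> int) w : all (fun k => k.+1 < n)%N w ->
  \sum_(i < n) wroot w i * g i = \sum_(k <- w) (g k - g k.+1).
Proof.
move=> /allP hw; under eq_bigr do rewrite /wroot mulr_suml.
rewrite exchange_big /=; apply: eq_big_seq => k /hw; exact: sum_sroot.
Qed.

Lemma wroot_cons k w i : wroot (k :: w) i = sroot k i + wroot w i.
Proof. exact: big_cons. Qed.

Definition dominant n (l : nat -> int) := forall k, (k.+1 < n)%N -> l k.+1 <= l k.

(** On dominant weights (l, l + 2 rho) is strictly increasing along positive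
    roots: the difference is a sum of terms (alpha_k, l + m + 2 rho) > 0. *)
Lemma casimir_eig_lt n l m w : all (fun k => k.+1 < n)%N w ->
  dominant n l -> dominant n m -> (forall i, (i < n)%N -> m i = l i + wroot w i) ->
  casimir_eig n m = casimir_eig n l -> w = [::].
Proof.
move=> hw dl dm ml /eqP; rewrite -subr_eq0 /casimir_eig -sumrB.
rewrite (eq_bigr (fun i : 'I_n => wroot w i * (m i + l i + n%:Z - 1 - 2 * i%:Z))); last first.
  by move=> i _; rewrite ml //; ring.
rewrite (sum_wroot (fun i => m i + l i + n%:Z - 1 - 2 * i%:Z)) //.
case: w hw ml => // k w /andP [hk /allP hw] _; rewrite big_cons; set S := \sum_(j <- w) _.
have S0 : 0 <= S.
  rewrite /S big_seq sumr_ge0 // => j /hw hj.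
  by have := dl j hj; have := dm j hj; lia.
by move=> /eqP h; exfalso; have := dl k hk; have := dm k hk; lia.
Qed.

Section HighestWeight.
Variables (K : fieldType) (charK : [pchar K] =i pred0).
Variables (B : pzRingType) (sc : {rmorphism K -> B}).
Hypothesis scC : forall a b, sc a * b = b * sc a.
Variables (n r s : nat) (e f H : nat -> B).
Hypothesis HH : forall i j, (i < n)%N -> (j < n)%N -> ad (H i) (H j) = 0.
Hypothesis ef : forall i j, (i.+1 < n)%N -> (j.+1 < n)%N ->
    ad (e i) (f j) = (H i - H i.+1) *+ (i == j).
Hypothesis He : forall i j, (i < n)%N -> (j.+1 < n)%N ->
    ad (H i) (e j) = e j *+ (i == j) - e j *+ (i == j.+1).
Hypothesis Hf : forall i j, (i < n)%N -> (j.+1 < n)%N ->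
    ad (H i) (f j) = f j *+ (i == j.+1) - f j *+ (i == j).
Hypothesis Htr : \sum_(i < n) H i = (r%:Z - s%:Z)%:~R.
Hypothesis Hprod : forall S : {set 'I_n}, S \proper [set: 'I_n] ->
  \prod_(0 <= k < (r + s).+1) (\sum_(i in S) H i + (k%:Z - r%:Z)%:~R) = 0.
Hypothesis gen_ind : forall P : B -> Prop, P 1 ->
  (forall x y, P x -> P y -> P (x + y)) -> (forall a x, P x -> P (sc a * x)) ->
  (forall k x, (k.+1 < n)%N -> P x -> P (e k * x)) ->
  (forall k x, (k.+1 < n)%N -> P x -> P (f k * x)) ->
  (forall i x, (i < n)%N -> P x -> P (H i * x)) -> forall b, P b.

Local Notation roots := (all (fun k => k.+1 < n)%N).
Local Notation weight := (weight n H).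

Definition ew w : B := \prod_(k <- w) e k.
Definition fw w : B := \prod_(k <- w) f k.

(** The possible eigenvalues of each H_i, by relation (e) for singletons. *)
Definition hweights : seq int := [seq r%:Z - k%:Z | k : nat <- iota 0 (r + s).+1].

Lemma hweights_uniq : uniq hweights.
Proof. by rewrite map_inj_uniq ?iota_uniq // => x y; lia. Qed.

Lemma mem_hweights a : (a \in hweights) = (- s%:Z <= a <= r%:Z).
Proof.
apply/mapP/idP => [[k]|h]; first by rewrite mem_iota => h ->; lia.
by exists (absz (r%:Z - a)); rewrite ?mem_iota; lia.
Qed.

Lemma prod_has0 (I : eqType) (t : seq I) (F : I -> B) j :
  j \in t -> F j = 0 -> \prod_(i <- t) F i = 0.
Proof.
elim: t => // i t IH; rewrite inE big_cons => /predU1P [->|jt] Fj.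
  by rewrite Fj mul0r.
by rewrite IH ?mulr0.
Qed.

Lemma H_annihilated i : (i < n)%N -> \prod_(a <- hweights) (H i - a%:~R) = 0.
Proof.
move=> hi; have [n1|n1] := eqVneq n 1%N.
  apply: (@prod_has0 _ _ _ (r%:Z - s%:Z)); first by rewrite mem_hweights; lia.
  rewrite -Htr (eq_bigl (fun j : 'I_n => j == Ordinal hi)) ?big_pred1_eq ?subrr //.
  by move=> j; apply/esym/eqP/val_inj => /=; have := ltn_ord j; lia.
have : [set Ordinal hi] \proper [set: 'I_n].
  by rewrite properEcard subsetT cards1 cardsT card_ord; lia.
move=> /Hprod; rewrite big_set1 /= /index_iota subn0 big_map => <-.
by apply: eq_bigr => k _; rewrite -mulrNz opprB.
Qed.

Section Vectors.
Variable V : lmodType B.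
Implicit Types v x y : V.

Lemma weight_e k l v : (k.+1 < n)%N -> weight l v ->
  weight (fun i => l i + sroot k i) (e k *: v).
Proof.
move=> hk wv i hi; rewrite scalerA.
have -> : H i * e k = ad (H i) (e k) + e k * H i by rewrite subrK.
rewrite He // scalerDl -scalerA wv // scale_mulrz scalerBl -!scalerMnl addrC.
by rewrite mulrzDr /sroot mulrzBr -!pmulrn.
Qed.

Lemma weight_f k l v : (k.+1 < n)%N -> weight l v ->
  weight (fun i => l i - sroot k i) (f k *: v).
Proof.
move=> hk wv i hi; rewrite scalerA.
have -> : H i * f k = ad (H i) (f k) + f k * H i by rewrite subrK.
rewrite Hf // scalerDl -scalerA wv // scale_mulrz scalerBl -!scalerMnl addrC.
by rewrite mulrzDr /sroot opprB mulrzBr -!pmulrn.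
Qed.

Lemma eq_weight l m v : (forall i, (i < n)%N -> l i = m i) -> weight l v -> weight m v.
Proof. by move=> lm wv i hi; rewrite -lm // wv. Qed.

Lemma weight_fw w l v : roots w -> weight l v ->
  weight (fun i => l i - wroot w i) (fw w *: v).
Proof.
move=> + wv; elim: w => [_|k w IH /= /andP [hk /IH hw]].
  rewrite /fw big_nil scale1r; apply: eq_weight wv => i _.
  by rewrite /wroot big_nil subr0.
rewrite /fw big_cons -scalerA; apply: eq_weight (weight_f hk hw) => i _.
by rewrite wroot_cons; ring.
Qed.

Lemma weight_range l v i : (i < n)%N -> weight l v -> v != 0 -> - s%:Z <= l i <= r%:Z.
Proof.
move=> hi wv; apply: contraNT; rewrite -mem_hweights => li.
suff h (t : seq int) : l i \notin t -> \prod_(a <- t) (H i - a%:~R) *: v = 0 -> v = 0.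
  by apply/eqP/(h hweights) => //; rewrite H_annihilated // scale0r.
elim/last_ind: t => [|t a IH]; first by rewrite big_nil scale1r.
rewrite mem_rcons inE negb_or => /andP [la /IH {}IH].
rewrite -cats1 big_cat big_seq1 /= -scalerA scalerBl wv // int_scale -mulrzBr.
rewrite scale_mulrz => /(mod_torsion_free charK sc); rewrite subr_eq0 => /(_ la).
exact: IH.
Qed.

Lemma weight_sum l v (S : {set 'I_n}) : weight l v ->
  (\sum_(i in S) H i) *: v = v *~ \sum_(i in S) l i.
Proof.
move=> wv; rewrite scaler_suml mulrz_sumr.
by apply: eq_bigr => i _; rewrite wv.
Qed.

Lemma weight_trace l v : weight l v -> v != 0 -> \sum_(i < n) l i = r%:Z - s%:Z.
Proof.
move=> wv; apply: contraNeq => h; apply/eqP.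
apply: (@mod_torsion_free _ charK _ sc _ _ (\sum_(i < n) l i - (r%:Z - s%:Z))).
  rewrite mulrzBr mulrz_sumr -int_scale -Htr scaler_suml.
  by apply/eqP; rewrite subr_eq0; apply/eqP/esym/eq_bigr => i _; rewrite wv.
by rewrite subr_eq0.
Qed.

Lemma weight_subset l v (S : {set 'I_n}) : S \proper [set: 'I_n] ->
  weight l v -> v != 0 -> - s%:Z <= \sum_(i in S) l i <= r%:Z.
Proof.
move=> SP wv; apply: contraNT => h.
suff hh (t : seq nat) : {subset t <= iota 0 (r + s).+1} ->
    \prod_(k <- t) (\sum_(i in S) H i + (k%:Z - r%:Z)%:~R) *: v = 0 -> v = 0.
  apply/eqP/(hh (index_iota 0 (r + s).+1)); last by rewrite Hprod // scale0r.
  by move=> k; rewrite /index_iota subn0.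
elim/last_ind: t => [|t k IH tI]; first by rewrite big_nil scale1r.
rewrite -cats1 big_cat big_seq1 /= -scalerA scalerDl (weight_sum _ wv) int_scale -mulrzDr.
rewrite scale_mulrz => /(mod_torsion_free charK sc) hv.
apply: IH; first by move=> j jt; apply: tI; rewrite mem_rcons inE jt orbT.
apply: hv; have := tI k; rewrite mem_rcons mem_head mem_iota => /(_ isT).
lia.
Qed.

End Vectors.

Lemma weight_spanning (V : lmodType B) (C Q : V -> Prop) :
  (forall x y, C x -> C y -> C (x - y)) -> (forall b x, C x -> C (b *: x)) ->
  Q 0 -> (forall x y, Q x -> Q y -> Q (x + y)) ->
  (forall l x, C x -> weight l x -> Q x) -> forall y, C y -> Q y.
Proof.
move=> CB CZ Q0 QD Qw; apply: (@weight_ind K charK B sc scC n H HH V hweights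
  hweights_uniq H_annihilated C Q) => // l x _; exact: Qw.
Qed.

(** Weights are bounded, so that a high power of x kills all weight vectors, and
    these span every module. *)
Lemma shift_nilp (x : B) k (d : int) (N : nat) : (k < n)%N ->
  (forall l (v : B^o), weight l v -> exists2 m, weight m (x *: v) & m k = l k + d) ->
  (r + s < N)%N -> d = 1 \/ d = -1 -> x ^+ N = 0.
Proof.
move=> hk xw hN hd; rewrite -[LHS]mulr1.
apply: (@weight_spanning B^o (fun=> True) (fun y : B^o => x ^+ N *: y = 0)) => //.
- by rewrite scaler0.
- by move=> y z hy hz; rewrite scalerDr hy hz addr0.
move=> l v _ wv; apply/eqP/negPn/negP => xv.
have v0 : v != 0 by apply: contraNneq xv => ->; rewrite scaler0.
suff [m wm mk] : exists2 m, weight m (x ^+ N *: v) & m k = l k + d * N%:Z.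
  have := weight_range hk wv v0; have := weight_range hk wm xv.
  by rewrite mk; case: hd => ->; lia.
elim: N {hN xv} => [|N [m wm mk]]; first by exists l; rewrite ?expr0 ?scale1r //; lia.
rewrite exprS -scalerA; have [m' wm' mk'] := xw _ _ wm.
by exists m' => //; rewrite mk' mk; lia.
Qed.

Lemma relations_gl_system : gl_system n e f H.
Proof.
split=> // k hk; exists (r + s).+1.
  apply: (@shift_nilp _ k 1) => //; [exact: ltnW | move=> l v wv | by left].
  exists (fun i => l i + sroot k i); first exact: weight_e.
  by rewrite /sroot eqxx (ltn_eqF (ltnSn k)).
apply: (@shift_nilp _ k (-1)) => //; [exact: ltnW | move=> l v wv | by right].
exists (fun i => l i - sroot k i); first exact: weight_f.
by rewrite /sroot eqxx (ltn_eqF (ltnSn k)).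
Qed.

Lemma module_torsion_free (V : lmodType B) (v : V) k : v *+ k.+1 = 0 -> v = 0.
Proof. by rewrite pmulrn => /(mod_torsion_free charK sc); apply. Qed.

Lemma ring_torsion_free (v : B) k : v *+ k.+1 = 0 -> v = 0.
Proof. exact: (@module_torsion_free B^o). Qed.

Local Notation c := (casimir n e f H).

Lemma casimirC b : c * b = b * c.
Proof.
have hs := relations_gl_system; have ht := ring_torsion_free.
elim/gen_ind: b => [|x y hx hy|a x hx|k x hk hx|k x hk hx|i x hi hx].
- by rewrite mulr1 mul1r.
- by rewrite mulrDr mulrDl hx hy.
- by rewrite mulrA -scC -!mulrA hx.
- by rewrite mulrA (casimir_comm_e ht hs) // -!mulrA hx.
- by rewrite mulrA (casimir_comm_f ht hs) // -!mulrA hx.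
by rewrite mulrA (casimir_comm_H hs) // -!mulrA hx.
Qed.

Section HwVectors.
Variable V : lmodType B.
Implicit Types v x y : V.

Definition hwvec l v := (forall k, (k.+1 < n)%N -> e k *: v = 0) /\ weight l v.

(** Otherwise v would be a lowest weight vector of positive weight for the sl2
    spanned by f_k, e_k, - h_k. *)
Lemma hwvec_dominant l v : hwvec l v -> v != 0 -> dominant n l.
Proof.
move=> [ev wv] v0 k hk; rewrite leNgt; apply: contra_neqN v0 => lk.
have [N fN] := gl_fN relations_gl_system hk.
pose m := absz (l k.+1 - l k - 1)%R.
apply: (@sl2_lowest_eq0 V ( *:%R (f k)) ( *:%R (e k)) ( *:%R (H k.+1 - H k)) N m).
- exact: module_torsion_free.
- move=> x /=; rewrite !scalerA -scalerBl -[f k * e k - _]/(ad (f k) (e k)) adC ef //.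
  by rewrite eqxx opprB.
- move=> x /=; rewrite !scalerA -scalerBl -[X in X *: _]/(ad (H k.+1 - H k) (f k)).
  rewrite adBl !Hf //; last exact: ltnW.
  rewrite !eqxx (ltn_eqF (ltnSn k)) (gtn_eqF (ltnSn k)) subr0 sub0r opprK.
  by rewrite -mulr2n scalerMnl.
- exact: ev.
- rewrite /= scalerBl !wv //; last exact: ltnW.
  by rewrite -mulrzBr pmulrn; congr (_ *~ _); rewrite /m; lia.
suff -> : iter N ( *:%R (f k)) v = f k ^+ N *: v by rewrite fN scale0r.
by elim: N {fN} => [|N IH]; rewrite ?scale1r // iterS IH scalerA exprS.
Qed.

Lemma hwvec_root0 i d v : (forall k, (k.+1 < n)%N -> e k *: v = 0) ->
  (i + d.+1 < n)%N -> root_vec e i d *: v = 0.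
Proof.
move=> ev; elim: d => [|d IH] hd; first by apply: ev; lia.
by rewrite rootS /ad scalerBl -!scalerA ev ?IH ?scaler0 ?subrr //; lia.
Qed.

(** For i < j one has E_ij v = 0, so that E_ij E_ji acts as [E_ij, E_ji] = H_i - H_j
    and E_ji E_ij acts as zero. *)
Lemma hwvec_casimir l v : hwvec l v -> c *: v = v *~ casimir_eig n l.
Proof.
move=> [ev wv]; rewrite /casimir scaler_suml.
pose a (i j : nat) : int := if (i < j)%N then l i - l j else if i == j then l i * l i else 0.
transitivity (v *~ \sum_(i < n) \sum_(j < n) a i j).
  rewrite mulrz_sumr; apply: eq_bigr => i _; rewrite scaler_suml mulrz_sumr.
  apply: eq_bigr => j _; case: (nat_cmpP i j) => [d Ej|d Ei|Eij].
  - have hd : (i + d.+1 < n)%N by rewrite -Ej.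
    have := ad_unit_opp ring_torsion_free relations_gl_system hd.
    rewrite -Ej /ad => /eqP; rewrite subr_eq => /eqP ->.
    rewrite scalerDl -scalerA.
    have -> : gl_unit e f H i j *: v = 0 by rewrite Ej gl_unit_up (hwvec_root0 ev hd).
    rewrite scaler0 addr0.
    by rewrite scalerBl !wv // -mulrzBr /a ifT //; lia.
  - have hd : (j + d.+1 < n)%N by rewrite -Ei.
    rewrite -scalerA.
    have -> : gl_unit e f H j i *: v = 0 by rewrite Ei gl_unit_up (hwvec_root0 ev hd).
    rewrite scaler0 /a !ifF ?mulr0z //; lia.
  rewrite Eij gl_unit_diag -scalerA wv // scale_mulrz wv //.
  by rewrite -mulrzA /a ltnn eqxx.
congr (_ *~ _); rewrite {}/a; move: (n) => N; elim: N => [|N IH].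
  by rewrite /casimir_eig !big_ord0.
rewrite big_ord_recr /= big_ord_recr /= ltnn eqxx.
under eq_bigr => i _ do rewrite big_ord_recr /= ltn_ord.
rewrite big_split /= IH [X in _ + (X + _)]big1; last first.
  by move=> j _; rewrite ltnNge ltnW //= gtn_eqF.
rewrite /casimir_eig big_ord_recr /= sumrB sumr_const card_ord -mulr_natl natz.
rewrite [X in _ = X + _](eq_bigr (fun i : 'I_N =>
  l i * (l i + N%:Z - 1 - 2 * i%:Z) + l i)); last first.
  by move=> i _; lia.
by rewrite big_split /= intS; ring.
Qed.

Lemma weight_ew w l v : roots w -> weight l v ->
  weight (fun i => l i + wroot w i) (ew w *: v).
Proof.
move=> + wv; elim: w => [_|k w IH /= /andP [hk /IH hw]].
  rewrite /ew big_nil scale1r; apply: eq_weight wv => i _.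
  by rewrite /wroot big_nil addr0.
rewrite /ew big_cons -scalerA; apply: eq_weight (weight_e hk hw) => i _.
by rewrite wroot_cons; ring.
Qed.

(** The quantity sum_i (n - i) l_i grows by one each time an e_k is applied, and
    it is bounded on weights. *)
Lemma hwvec_above l v : weight l v -> v != 0 ->
  exists2 w, roots w & ew w *: v != 0 /\ hwvec (fun i => l i + wroot w i) (ew w *: v).
Proof.
pose ht (l : nat -> int) := \sum_(i < n) l i * (n%:Z - i%:Z).
pose M := \sum_(i < n) r%:Z * (n%:Z - i%:Z).
have htM m (x : V) : weight m x -> x != 0 -> ht m <= M.
  move=> wx x0; apply: ler_sum => i _; apply: ler_wpM2r; first by have := ltn_ord i; lia.
  by have := weight_range (ltn_ord i) wx x0 => /andP [].
suff h d : forall l v, weight l v -> v != 0 -> M <= ht l + d%:Z ->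
    exists2 w, roots w & ew w *: v != 0 /\ hwvec (fun i => l i + wroot w i) (ew w *: v).
  by move=> wv v0; apply: (h (absz (M - ht l)) l v) => //; lia.
elim: d => [|d IH] {}l {}v wv v0 hM.
all: have [[k [hk ek0]]|ev] := pselect (exists k, (k.+1 < n)%N /\ e k *: v != 0).
2,4: exists [::] => //; rewrite /ew big_nil scale1r; split=> //; split;
  [move=> k hk; apply/eqP/negPn/negP => ek0; apply: ev; by exists k
  | by apply: eq_weight wv => i _; rewrite /wroot big_nil addr0].
all: have we := weight_e hk wv.
all: have hte : ht (fun i => l i + sroot k i) = ht l + 1
  by rewrite /ht; under eq_bigr do rewrite mulrDl;
     rewrite big_split /= (sum_sroot (fun i => n%:Z - i%:Z)) // intS; congr (_ + _); ring.
- by have := htM _ _ we ek0; rewrite hte; lia.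
have [|w hw [w0 hwv]] := IH _ _ we ek0; first by rewrite hte; lia.
exists (rcons w k); first by rewrite all_rcons hk.
have -> : ew (rcons w k) *: v = ew w *: (e k *: v).
  by rewrite scalerA /ew -cats1 big_cat big_seq1.
split=> //; split; first exact: hwv.1.
apply: eq_weight hwv.2 => i _; rewrite /wroot -cats1 big_cat big_seq1 /=; ring.
Qed.

(** Triangular decomposition: an e_k that moves to the right through an f-word
    leaves elements of the span behind and finally kills v. *)
Lemma hwvec_span l v b : hwvec l v -> exists2 t : seq (K * seq nat),
  all (fun p => roots p.2) t & b *: v = \sum_(p <- t) sc p.1 *: (fw p.2 *: v).
Proof.
move=> [ev wv]; pose P x := exists2 t : seq (K * seq nat),
  all (fun p => roots p.2) t & x = \sum_(p <- t) sc p.1 *: (fw p.2 *: v).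
have P0 : P 0 by exists [::]; rewrite ?big_nil.
have PD x y : P x -> P y -> P (x + y).
  by move=> [t ht ->] [u hu ->]; exists (t ++ u); rewrite ?all_cat ?ht // big_cat.
have PZ a x : P x -> P (sc a *: x).
  move=> [t ht ->]; exists [seq (a * p.1, p.2) | p <- t]; first by rewrite all_map.
  by rewrite big_map scaler_sumr; apply: eq_bigr => p _; rewrite scalerA -rmorphM.
have PMz x (m : int) : P x -> P (x *~ m).
  by rewrite -int_scale -(rmorph_int sc); exact: PZ.
have Pw w : roots w -> P (fw w *: v).
  move=> hw; exists [:: (1, w)]; first by rewrite /= hw.
  by rewrite big_seq1 rmorph1 scale1r.
have Pf k x : (k.+1 < n)%N -> P x -> P (f k *: x).
  move=> hk [t ht ->]; exists [seq (p.1, k :: p.2) | p <- t].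
    by rewrite all_map (eq_all (a2 := fun p => roots p.2)) // => p; rewrite /= hk.
  rewrite big_map scaler_sumr; apply: eq_bigr => p _.
  by rewrite /fw big_cons sc_scaleC // !scalerA mulrA.
have PH i w : (i < n)%N -> roots w -> P (H i *: (fw w *: v)).
  by move=> hi hw; rewrite (weight_fw hw wv hi); exact/PMz/Pw.
have Pe k w : (k.+1 < n)%N -> roots w -> P (e k *: (fw w *: v)).
  move=> hk; elim: w => [_|j w IH /= /andP [hj hw]].
    by rewrite /fw big_nil scale1r ev.
  rewrite /fw big_cons scalerA mulrA.
  have -> : e k * f j = ad (e k) (f j) + f j * e k by rewrite subrK.
  rewrite mulrDl scalerDl -!scalerA ef //.
  apply: (PD); last exact/Pf/IH.
  rewrite -scalerMnl pmulrn scalerBl; apply: (PMz).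
  rewrite -[- _]mulrN1z; apply: (PD); first by apply: PH; rewrite // ltnW.
  by apply: PMz; apply: PH.
have Pact z x : (forall w, roots w -> P (z *: (fw w *: v))) -> P x -> P (z *: x).
  move=> Pz [t /allP ht ->]; rewrite scaler_sumr big_seq.
  apply: big_ind => // p /ht hp; rewrite sc_scaleC //; exact/PZ/Pz.
elim/gen_ind: b => [|x y hx hy|a x hx|k x hk hx|k x hk hx|i x hi hx].
- by have := Pw [::] isT; rewrite /fw big_nil.
- by rewrite scalerDl; exact: PD.
- by rewrite -scalerA; exact: PZ.
- by rewrite -scalerA; apply: Pact hx => w hw; exact: Pe.
- by rewrite -scalerA; exact: Pf.
by rewrite -scalerA; apply: Pact hx => w hw; exact: PH.
Qed.

End HwVectors.
Lemma hwvec_pair (V1 V2 : lmodType B) l (v1 : V1) (v2 : V2) :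
  hwvec l v1 -> hwvec l v2 -> hwvec l ((v1, v2) : (V1 * V2)%type).
Proof.
move=> [e1 w1] [e2 w2]; split=> [k hk|i hi].
  by apply/eqP; rewrite -pair_eqE /pair_eq /= e1 // e2 // !eqxx.
rewrite -int_scale; apply/eqP; rewrite -pair_eqE /pair_eq /= w1 // w2 //.
by rewrite -!int_scale !eqxx.
Qed.

(** If b v1 is not zero for some b in I, the submodule I (v1, v2) of V1 x V2
    contains a highest weight vector (z, 0). By the Casimir element its weight is
    l, so it is a multiple of (v1, v2), which contradicts v2 != 0. *)
Lemma hwvec_annihilator (V1 V2 : lmodType B) l (v1 : V1) (v2 : V2) (I : B -> Prop) :
  (forall x y, I x -> I y -> I (x - y)) -> (forall b x, I x -> I (b * x)) ->
  hwvec l v1 -> hwvec l v2 -> v2 != 0 -> (forall b, I b -> b *: v2 = 0) ->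
  forall b, I b -> b *: v1 = 0.
Proof.
move=> IB IM h1 h2 v20 Iv2 b Ib.
apply: (@weight_spanning V1 (fun x => exists2 b, I b & x = b *: v1) (fun x => x = 0)) => //.
- by move=> _ _ [x Ix ->] [y Iy ->]; exists (x - y); [exact: IB | rewrite scalerBl].
- by move=> a _ [x Ix ->]; exists (a * x); [exact: IM | rewrite scalerA].
- by move=> x y -> ->; rewrite addr0.
2: by exists b.
move=> l' _ [b' Ib' ->] wb'; apply/eqP/negPn/negP => b'0.
have [w hw [w0]] := hwvec_above wb' b'0; rewrite scalerA; set u := ew w * b'.
rewrite scalerA -/u in w0; set m := (fun i => _) => hz.
have Iu : I u by exact: IM.
have v10 : v1 != 0 by apply: contraNneq w0 => ->; rewrite scaler0.
have dl := hwvec_dominant h1 v10; have dm := hwvec_dominant hz w0.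
have Ecas : casimir_eig n m = casimir_eig n l.
  apply/eqP; rewrite -subr_eq0; apply/negPn/negP => h.
  move/eqP: w0; apply; apply: (mod_torsion_free charK sc _ h).
  rewrite mulrzBr -(hwvec_casimir hz) scalerA casimirC -scalerA (hwvec_casimir h1).
  by rewrite scale_mulrz subrr.
(* in the sum of the two modules the coefficients of the f-words are the same for
   v1 and v2 *)
pose V : lmodType B := (V1 * V2)%type; pose v : V := (v1, v2).
have hv : hwvec l v by exact: hwvec_pair.
have [t /allP ht ut] := hwvec_span u hv.
have uvE : u *: v = (u *: v1, 0) by rewrite -(Iv2 u Iu).
have wu : weight m (u *: v).
  move=> i hi; rewrite uvE -int_scale; apply/eqP; rewrite -pair_eqE /pair_eq /=.
  by rewrite hz.2 // !scaler0 -int_scale !eqxx.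
have wt p : p \in t -> weight (fun i => l i - wroot p.2 i) (sc p.1 *: (fw p.2 *: v)).
  by move=> /ht hp; apply: weightZ => //; exact: weight_fw hv.2.
have eq_nil p : p \in t -> (forall i, (i < n)%N -> l i - wroot p.2 i = m i) -> p.2 = [::].
  move=> /ht hp hi; apply: (casimir_eig_lt hp dm dl) => // i /hi <-.
  by rewrite subrK.
have differ p : p \in t -> p.2 != [::] -> exists2 i, (i < n)%N & l i - wroot p.2 i != m i.
  move=> pt; apply: contra_neqP => np; apply: eq_nil => // i hi.
  by apply/eqP/negPn/negP => hne; apply: np; exists i.
have lm : forall i, (i < n)%N -> l i = m i.
  have [[p pt p0]|np] := pselect (exists2 p, p \in t &
      forall i, (i < n)%N -> l i - wroot p.2 i = m i).
    by move=> i hi; rewrite -p0 // (eq_nil p) // /wroot big_nil subr0.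
  exfalso; move/eqP: w0; apply.
  suff : u *: v = 0 by rewrite uvE => -[].
  apply: (@weight_separation K charK B sc n H V _ t predT
    (fun p => sc p.1 *: (fw p.2 *: v)) (fun p i => l i - wroot p.2 i) m) => //.
  move=> p pt _; split; first exact: wt.
  apply: contrapT => np'; apply: np; exists p => // i hi.
  by apply/eqP/negPn/negP => hne; apply: np'; exists i.
(* the only word of weight zero is the empty one *)
have uE : u *: v = sc (\sum_(p <- t | p.2 == [::]) p.1) *: v.
  apply/eqP; rewrite -subr_eq0; apply/eqP.
  apply: (@weight_separation K charK B sc n H V _ t (fun p => p.2 != [::])
    (fun p => sc p.1 *: (fw p.2 *: v)) (fun p i => l i - wroot p.2 i) m) => //.
  - by apply: weightB => //; apply: weightZ => //; exact: eq_weight hv.2.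
  - by move=> p pt p0; split; [exact: wt | exact: differ].
  rewrite ut (bigID (fun p => p.2 == [::])) /= rmorph_sum scaler_suml addrAC.
  rewrite (eq_bigr (fun p => sc p.1 *: v)) ?subrr ?add0r // => p /eqP ->.
  by rewrite /fw big_nil scale1r.
move: (uE); rewrite uvE; set a := \sum_(p <- t | _) _ => -[uE1 /esym /eqP uE2].
move/eqP: w0; apply; rewrite uE1.
have [->|a0] := eqVneq a 0; first by rewrite rmorph0 scale0r.
move: v20; rewrite -[v2](scale1r) -(rmorph1 sc) -(mulVf a0) rmorphM -scalerA.
by rewrite (eqP uE2) scaler0 eqxx.
Qed.

Definition bounded_weight (l : nat -> int) :=
  \sum_(i < n) l i = r%:Z - s%:Z /\
  forall S : {set 'I_n}, S \proper [set: 'I_n] -> - s%:Z <= \sum_(i in S) l i <= r%:Z.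

(** A weight l is encoded by the function i |-> l_i + s with values in 0, ..., r + s. *)
Definition casimir_eigs : seq int :=
  [seq casimir_eig n (fun i => oapp (fun j => (g j)%:Z - s%:Z) 0 (insub i))
     | g : {ffun 'I_n -> 'I_(r + s).+1}].

Lemma mem_casimir_eigs (V : lmodType B) l (v : V) : weight l v -> v != 0 ->
  casimir_eig n l \in casimir_eigs.
Proof.
move=> wv v0; apply/imageP; exists [ffun i : 'I_n => inord (absz (l i + s%:Z))] => //.
apply: eq_bigr => i _; rewrite valK /= ffunE inordK.
  by have := weight_range (ltn_ord i) wv v0; lia.
by have := weight_range (ltn_ord i) wv v0; lia.
Qed.

Definition hw_span : {pred B^o} := Defs.span (fun v : B^o => exists l, hwvec l v).

Lemma casimir_prod_eig (V : lmodType B) (v : V) a (t : seq int) (P : pred int) :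
  c *: v = v *~ a ->
  \prod_(b <- t | P b) (c - b%:~R) *: v = v *~ \prod_(b <- t | P b) (a - b).
Proof.
move=> cv; elim: t => [|b t IH]; first by rewrite !big_nil scale1r.
rewrite !big_cons; case: ifP => // _; rewrite -scalerA IH scale_mulrz scalerBl cv.
by rewrite int_scale -mulrzBr -mulrzA.
Qed.

(** Complete reducibility of the regular module: if the submodule M spanned by
    the highest weight vectors were proper, a highest weight vector of the
    quotient would lift, after applying the polynomial in the Casimir element
    that kills the other eigenspaces, to a highest weight vector outside M. *)
Lemma hw_span_full : (1 : B^o) \in hw_span.
Proof.
apply/negPn/negP => N1.
have MS : submod_closed hw_span by exact: span_submod_closed.
pose pi := @qm_pi B B^o hw_span MS.
have piE x : pi x = 0 <-> x \in hw_span by exact: qm_pi_eq0.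
have piZ b x : pi (b *: x) = b *: pi x by exact: linearZ.
have [x [l [wx Mx]]] : exists x : B^o, exists l, weight l x /\ x \notin hw_span.
  apply: contrapT => nx; move/negP: N1; apply.
  apply: (@weight_spanning B^o (fun=> True) (fun x => x \in hw_span)) => //.
  - exact: MS.1.
  - by move=> x y; exact: rpredD.
  move=> l x _ wx; apply/negPn/negP => Mx; apply: nx; by exists x, l.
have wpi m y : weight m y -> weight m (pi y).
  by move=> wy i hi; rewrite -piZ wy // -int_scale piZ int_scale.
have px0 : pi x != 0 by apply/eqP => /piE; apply/negP.
have [w hw [w0 hwx]] := hwvec_above (wpi _ _ wx) px0.
move: w0 hwx (weight_ew hw wx); rewrite -piZ.
set m := (fun i => _); set y := ew w *: x => y0 hy wy.
have dm := hwvec_dominant hy y0.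
pose a := casimir_eig n m.
(* q kills the eigenspaces of c other than that of a, and acts on y by a nonzero
   scalar modulo the span *)
pose q := \prod_(b <- casimir_eigs | b != a) (c - b%:~R).
have qC b : q * b = b * q.
  rewrite /q; elim/big_rec: _ => [|d p _ hp]; first by rewrite mul1r mulr1.
  rewrite -mulrA hp mulrA mulrBl casimirC mulrA mulrBr.
  by congr ((_ - _) * _); exact/esym/commr_int.
have qM z : z \in hw_span -> (c - a%:~R) *: (q *: z) = 0.
  move=> /asboolP; elim=> [|b u v [l' hu] _ IH]; first by rewrite !scaler0.
  rewrite !scalerDr IH addr0.
  have -> : (c - a%:~R) *: (q *: (b *: u)) = b *: ((c - a%:~R) *: (q *: u)).
    rewrite !scalerA; congr (_ *: _); rewrite -mulrA qC !mulrA.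
    by congr (_ * _); rewrite mulrBl mulrBr casimirC; congr (_ - _); apply/esym/commr_int.
  have [->|u0] := eqVneq u 0; first by rewrite !scaler0.
  have cu := hwvec_casimir hu.
  rewrite (casimir_prod_eig _ _ cu) scale_mulrz scalerBl cu int_scale -mulrzBr -mulrzA.
  have [->|ne] := eqVneq (casimir_eig n l') a; first by rewrite subrr mul0r scaler0.
  rewrite [X in _ * X](_ : _ = 0) ?mulr0 ?mulr0z ?scaler0 //.
  have cin := mem_casimir_eigs hu.2 u0.
  apply/eqP; rewrite prodf_seq_eq0; apply/hasP; exists (casimir_eig n l') => //.
  by rewrite ne subrr eqxx.
have eM k : (k.+1 < n)%N -> e k *: y \in hw_span.
  by move=> hk; apply/piE; rewrite piZ; exact: hy.1.
have hqy : hwvec m (q *: y).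
  split=> [k hk|i hi]; last first.
    by rewrite scalerA -qC -scalerA wy // scale_mulrz.
  apply/eqP/negPn/negP => ek0.
  have wqy : weight m (q *: y) by move=> i hi; rewrite scalerA -qC -scalerA wy // scale_mulrz.
  have [w' hw' [w'0 hz]] := hwvec_above (weight_e hk wqy) ek0.
  have := @casimir_eig_lt n m _ (k :: w') _ dm (hwvec_dominant hz w'0).
  have czE : casimir_eig n (fun i => m i + sroot k i + wroot w' i) = casimir_eig n m.
    apply/eqP; rewrite -subr_eq0; apply/negPn/negP => h.
    move/eqP: w'0; apply; apply: (mod_torsion_free charK sc _ h).
    rewrite mulrzBr -(hwvec_casimir hz) -[_ *~ casimir_eig n m]int_scale -scalerBl.
    rewrite scalerA mulrBl casimirC (_ : a%:~R * _ = ew w' * a%:~R); last exact/esym/commr_int.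
    rewrite -mulrBr -scalerA [e k *: _]scalerA -qC -scalerA qM ?scaler0 //; exact: eM.
  rewrite /= hk hw' => /(_ isT) h; suff : k :: w' = [::] by [].
  by apply: (h _ czE) => i hi; rewrite wroot_cons; ring.
have : pi (q *: y) = 0 by apply/piE/span_gen; exists m.
rewrite piZ (casimir_prod_eig _ _ (hwvec_casimir hy)).
move=> /(mod_torsion_free charK sc) h; move/eqP: y0; apply; apply: h.
by rewrite prodf_seq_neq0; apply/allP => b _; apply/implyP; rewrite subr_eq0 eq_sym.
Qed.

(** As 1 is in the span of the highest weight vectors u of the regular module, it
    is enough that I kills them; the quotient by J provides a highest weight
    vector of the same weight as u that is killed by I. *)
Theorem ideal_eq0 (I : B -> Prop) :
  (forall x y, I x -> I y -> I (x - y)) ->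
  (forall b x, I x -> I (b * x)) -> (forall b x, I x -> I (x * b)) ->
  (forall l, dominant n l -> bounded_weight l -> exists J : {pred B^o},
    [/\ submod_closed J, 1 \notin J, forall k, (k.+1 < n)%N -> e k \in J,
      forall i, (i < n)%N -> H i - (l i)%:~R \in J & forall b, I b -> b \in J]) ->
  forall b, I b -> b = 0.
Proof.
move=> IB IMl IMr hI b Ib; rewrite -[b]mulr1.
have /asboolP := hw_span_full.
suff h (y : B^o) : Defs.span_spec (fun v : B^o => exists l, hwvec l v) y ->
    forall b, I b -> b *: y = 0 by move=> /h/(_ b Ib).
move=> hy; elim: hy {b Ib} => [b|a u v [l hu] _ IH b] Ib; first by rewrite scaler0.
rewrite scalerDr IH // addr0 scalerA.
have [->|u0] := eqVneq u 0; first by rewrite scaler0.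
have bl : bounded_weight l.
  by split; [exact: weight_trace hu.2 u0 | move=> S hS; exact: weight_subset hu.2 u0].
have [J [JS J1 Je JH JI]] := hI l (hwvec_dominant hu u0) bl.
pose pi := @qm_pi B B^o J JS; have piE x : pi x = 0 <-> x \in J by exact: qm_pi_eq0.
have piZ b' : b' *: pi 1 = pi b' by rewrite -linearZ /=; congr pi; exact: mulr1.
apply: (@hwvec_annihilator _ _ l u (pi 1) I) => //; last exact: IMr.
- split=> [k hk|i hi]; first by rewrite piZ; apply/piE/Je.
  by apply/eqP; rewrite -int_scale -subr_eq0 -scalerBl piZ; apply/eqP/piE/JH.
- by apply/eqP => /piE; exact/negP.
by move=> b' /JI; rewrite piZ => /piE.
Qed.

End HighestWeight.

(** * Left invariant differentiation on the functions of bounded bidegree *)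

Section PolyLemmas.
Variables (K : fieldType) (charK : [pchar K] =i pred0).

Lemma poly_fun_eq0 (p : {poly K}) : (forall t, p.[t] = 0) -> p = 0.
Proof.
move=> p0; apply/eqP/negPn/negP => pn0.
have natI : injective (fun k : nat => k%:R : K).
  have key i j : (i < j)%N -> (i%:R == j%:R :> K) = false.
    move=> ij; rewrite eq_sym -subr_eq0 -natrB 1?ltnW //.
    by have /pcharf0P -> := charK; rewrite subn_eq0 leqNgt ij.
  by move=> i j /eqP; case: (ltngtP i j) => // ij; [|rewrite eq_sym]; rewrite key.
have := max_poly_roots (rs := [seq k%:R | k <- iota 0 (size p)]) pn0.
rewrite map_inj_uniq // iota_uniq size_map size_iota ltnn => h.
suff /h/(_ isT) : all (root p) [seq k%:R | k <- iota 0 (size p)] by [].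
by apply/allP => x _; rewrite /root p0.
Qed.

(** After multiplication by u the two polynomials take the same values everywhere,
    and the field is infinite. *)
Lemma poly_fun_eq (u p q : {poly K}) : u != 0 ->
  (forall t, u.[t] != 0 -> p.[t] = q.[t]) -> p = q.
Proof.
move=> u0 pq; apply/eqP; rewrite -subr_eq0; apply/eqP/(mulfI u0).
rewrite mulr0; apply: poly_fun_eq0 => t; rewrite hornerM hornerD hornerN.
by have [->|/pq ->] := eqVneq u.[t] 0; rewrite ?mul0r // subrr mulr0.
Qed.

Lemma coef1M (p q : {poly K}) : (p * q)`_1 = p`_0 * q`_1 + p`_1 * q`_0.
Proof. by rewrite coefM big_ord_recl big_ord1. Qed.

Lemma coef1X (p : {poly K}) k : p`_0 = 1 -> (p ^+ k)`_1 = k%:R * p`_1.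
Proof.
move=> p0; elim: k => [|k IH]; first by rewrite expr0 coef1 mul0r.
have pk0 : (p ^+ k)`_0 = 1.
  by rewrite -horner_coef0 horner_exp horner_coef0 p0 expr1n.
by rewrite exprS coef1M p0 pk0 IH mul1r mulr1 -natr1 mulrDl mul1r.
Qed.

End PolyLemmas.

Section Curve.
Variables (K : fieldType) (n : nat).
Implicit Types X Y : 'M[K]_n.

Definition curve X t : 'M[K]_n := 1%:M + t *: X.
Definition curvep X : 'M[{poly K}]_n := 1%:M + 'X *: map_mx polyC X.
Definition detp X : {poly K} := \det (curvep X).

Lemma horner_curvep X t : map_mx (horner_eval t) (curvep X) = curve X t.
Proof.
apply/matrixP => i j; rewrite !mxE /horner_eval hornerD hornerM hornerX hornerC.
by congr (_ + _); case: eqP => _; rewrite ?mulr1n ?mulr0n hornerC.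
Qed.

Lemma horner_detp X t : (detp X).[t] = \det (curve X t).
Proof. by rewrite -horner_curvep det_map_mx. Qed.

Lemma detp0 X : (detp X)`_0 = 1.
Proof. by rewrite -horner_coef0 horner_detp /curve scale0r addr0 det1. Qed.

Lemma detpX0 X k : (detp X ^+ k)`_0 = 1.
Proof. by rewrite -horner_coef0 horner_exp horner_coef0 detp0 expr1n. Qed.

Lemma detp_neq0 X : detp X != 0.
Proof. by apply/eqP => u0; have := detp0 X; rewrite u0 coef0 => /esym/eqP; rewrite oner_eq0. Qed.

Lemma curve_unit X t : (curve X t \in unitmx) = ((detp X).[t] != 0).
Proof. by rewrite horner_detp unitmxE unitfE. Qed.

Local Notation KG := (GLn K n -> K^o).

Definition curve_poly s X (f : KG) (g : GLn K n) (P : {poly K}) :=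
  forall t (h : GLn K n), val h = val g *m curve X t -> f h * (detp X).[t] ^+ s = P.[t].

(** f' is the derivative of f in the direction of the left invariant vector
    field of X: along each curve g (1 + t X) the function f is a polynomial P
    divided by a power of det (1 + t X), and f' g is the coefficient of t in the
    quotient. *)
Definition deriv_along s X (f f' : KG) := forall g, exists2 P : {poly K},
  curve_poly s X f g P & f' g = P`_1 - s%:R * (detp X)`_1 * P`_0.

Lemma curve_poly_eq s X f g P Q (charK : [pchar K] =i pred0) :
  curve_poly s X f g P -> curve_poly s X f g Q -> P = Q.
Proof.
move=> hP hQ; apply: (poly_fun_eq charK (detp_neq0 X)) => t; rewrite -curve_unit => tU.
have gU : val g *m curve X t \in unitmx by rewrite unitmx_mul (valP g).
pose h : GLn K n := exist (fun m => m \in unitmx) _ gU.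
by rewrite -(hP t h) // -(hQ t h).
Qed.

Lemma curve_poly_coef0 s X f g P : curve_poly s X f g P -> P`_0 = f g.
Proof.
move=> hP; rewrite -horner_coef0 -(hP _ g); last by rewrite /curve scale0r addr0 mulmx1.
by rewrite horner_coef0 detp0 expr1n mulr1.
Qed.

Lemma curve_poly_weaken s k X f g P :
  curve_poly s X f g P -> curve_poly (s + k) X f g (P * detp X ^+ k).
Proof. by move=> hP t h hh; rewrite exprD mulrA (hP t h hh) hornerM horner_exp. Qed.

(** The exponent of the determinant may be larger than necessary: extra factors
    det (1 + t X)^k multiply P and are compensated in f' g. *)
Lemma deriv_along_weaken s k X f f' :
  deriv_along s X f f' -> deriv_along (s + k) X f f'.
Proof.
move=> df g; have [P hP ->] := df g; exists (P * detp X ^+ k).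
  exact: curve_poly_weaken.
rewrite coef1M coef1X ?detp0 // !coef0M detpX0.
by rewrite natrD; ring.
Qed.

(** Coefficients of a matrix of polynomials, seen as a polynomial in matrices. *)
Definition mcoef k (M : 'M[{poly K}]_n) : 'M[K]_n := map_mx (fun p : {poly K} => p`_k) M.

Lemma mcoef0E M : mcoef 0 M = map_mx (horner_eval 0) M.
Proof. by apply/matrixP => i j; rewrite !mxE /horner_eval horner_coef0. Qed.

Lemma mcoef0M M N : mcoef 0 (M *m N) = mcoef 0 M *m mcoef 0 N.
Proof. by rewrite !mcoef0E map_mxM. Qed.

Lemma mcoef1M M N : mcoef 1 (M *m N) = mcoef 0 M *m mcoef 1 N + mcoef 1 M *m mcoef 0 N.
Proof.
apply/matrixP => i j; rewrite !mxE coef_sum -big_split /=.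
by apply: eq_bigr => k _; rewrite !mxE coef1M.
Qed.

Lemma map_mx_hornerC t (M : 'M[K]_n) : map_mx (horner_eval t) (map_mx polyC M) = M.
Proof. by apply/matrixP => i j; rewrite !mxE /horner_eval hornerC. Qed.

Section Operator.
Hypothesis charK : [pchar K] =i pred0.

Lemma deriv_along_uniq s s' X f f1 f2 :
  deriv_along s X f f1 -> deriv_along s' X f f2 -> f1 = f2.
Proof.
move=> /(deriv_along_weaken s') d1 /(deriv_along_weaken s); rewrite addnC => d2.
apply/funext => g; have [P hP ->] := d1 g; have [Q hQ ->] := d2 g.
by rewrite (curve_poly_eq charK hP hQ).
Qed.

Lemma deriv_alongM s s' X f f' g g' : deriv_along s X f f' -> deriv_along s' X g g' ->
  deriv_along (s + s') X (f * g) (f' * g + f * g').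
Proof.
move=> df dg x; have [P hP Pf] := df x; have [Q hQ Qg] := dg x.
exists (P * Q).
  by move=> t h hh; rewrite hornerM -(hP t h hh) -(hQ t h hh) exprD mulrACA.
rewrite coef1M coef0M natrD.
rewrite -[LHS]/(f' x * g x + f x * g' x) Pf Qg.
by rewrite -(curve_poly_coef0 hP) -(curve_poly_coef0 hQ); ring.
Qed.

Lemma deriv_alongP s X a f f' g g' : deriv_along s X f f' -> deriv_along s X g g' ->
  deriv_along s X (a *: f + g) (a *: f' + g').
Proof.
move=> df dg x; have [P hP Pf] := df x; have [Q hQ Qg] := dg x.
exists (a *: P + Q).
  move=> t h hh; rewrite hornerD hornerZ -(hP t h hh) -(hQ t h hh).
  by rewrite -[(a *: f + g) h]/(a * f h + g h) mulrDl mulrA.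
rewrite -[LHS]/(a * f' x + g' x) Pf Qg !coefD !coefZ; ring.
Qed.

Lemma deriv_along0 s X : deriv_along s X 0 0.
Proof.
move=> g; exists 0; first by move=> t h _; rewrite horner0 mul0r.
by rewrite !coef0 mulr0 subrr.
Qed.

Lemma deriv_along1 X : deriv_along 0 X 1 0.
Proof.
move=> g; exists 1; first by move=> t h _; rewrite hornerC mul1r.
by rewrite coef1 mul0r mul0r subrr.
Qed.

Lemma deriv_along_c X (M : 'M[K]_n) i j : deriv_along 0 X
  (fun g => (val g *m M) i j) (fun g => (val g *m (X *m M)) i j).
Proof.
move=> g; exists (((val g *m M) i j)%:P + (val g *m (X *m M)) i j *: 'X).
  move=> t h hh; rewrite mulr1 hh /curve -mulmxA mulmxDl mul1mx mulmxDr -scalemxAl -scalemxAr.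
  by rewrite hornerD hornerC hornerZ hornerX [LHS]mxE [X in _ + X]mxE mulrC.
by rewrite mul0r mul0r subr0 coefD coefC coefZ coefX /= mulr1 add0r.
Qed.

(** The inverse of 1 + t X is its adjugate divided by det (1 + t X), and the
    coefficient of t in (1 + t X) adj (1 + t X) = det (1 + t X) gives that of
    the adjugate. *)
Lemma deriv_along_d X (M : 'M[K]_n) i j : deriv_along 1 X
  (fun g => (M *m invmx (val g)) i j) (fun g => - ((M *m X) *m invmx (val g)) i j).
Proof.
move=> g; pose C := map_mx polyC (invmx (val g)); pose CM := map_mx polyC M.
exists ((CM *m (\adj (curvep X) *m C)) i j).
  move=> t h hh; rewrite expr1 -[RHS]/(horner_eval t _).
  set A := CM *m _.
  have -> : horner_eval t (A i j) = map_mx (horner_eval t) A i j by rewrite [RHS]mxE.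
  rewrite !map_mxM map_mx_adj horner_curvep !map_mx_hornerC horner_detp.
  have -> : \adj (curve X t) *m invmx (val g) = \det (curve X t) *: invmx (val h).
    rewrite -[invmx (val g)]mulmx1 -(mulmxV (valP h)) hh [invmx _ *m _]mulmxA.
    by rewrite [invmx _ *m _]mulmxA mulVmx ?(valP g) // mul1mx mulmxA mul_adj_mx mul_scalar_mx.
  by rewrite -scalemxAr [RHS]mxE mulrC.
have A0 : mcoef 0 (\adj (curvep X)) = 1%:M.
  by rewrite mcoef0E map_mx_adj horner_curvep /curve scale0r addr0 adj1.
have A1 : mcoef 1 (\adj (curvep X)) = ((detp X)`_1)%:M - X.
  have /(congr1 (mcoef 1)) := mul_mx_adj (curvep X).
  rewrite mcoef1M A0 mulmx1 mcoef0E horner_curvep /curve scale0r addr0 mul1mx.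
  have -> : mcoef 1 (curvep X) = X.
    apply/matrixP => k l; rewrite !mxE coefD mulrC coefMX coefC /=.
    by case: eqP; rewrite ?mulr1n ?mulr0n ?coef1 ?coef0 add0r.
  have -> : mcoef 1 (\det (curvep X))%:M = ((detp X)`_1)%:M.
    by apply/matrixP => k l; rewrite !mxE; case: eqP; rewrite ?mulr1n ?mulr0n ?coef0.
  by move=> <-; rewrite addrK.
have c0 N : mcoef 0 (map_mx polyC N) = N by rewrite mcoef0E map_mx_hornerC.
have c1 N : mcoef 1 (map_mx polyC N) = 0.
  by apply/matrixP => k l; rewrite !mxE coefC.
set A := CM *m _.
have -> : (A i j)`_1 = mcoef 1 A i j by rewrite [RHS]mxE.
have -> : (A i j)`_0 = mcoef 0 A i j by rewrite [RHS]mxE.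
rewrite {}/A !mcoef1M !mcoef0M A0 A1 !c0 !c1 mulmx0 mul0mx addr0 add0r mul1mx mulmxBl.
rewrite mul_scalar_mx mulmxBr -scalemxAr mulmxA.
set Z := M *m X *m _; set W := M *m _; rewrite !mxE; ring.
Qed.

Local Notation A := (@ratA_pred K n).

(** The family A(n,r,s) is the bigraded algebra generated by the coordinate
    functions, so that a property of its elements can be checked on these. *)
Lemma ratA_ind (P : nat -> nat -> KG -> Prop) :
  P 0 0 1 -> (forall r s, P r s 0) ->
  (forall r s a f g, f \in A r s -> g \in A r s -> P r s f -> P r s g -> P r s (a *: f + g)) ->
  (forall r s r' s' f g, f \in A r s -> g \in A r' s' -> P r s f -> P r' s' g ->
    P (r + r')%N (s + s')%N (f * g)) ->
  (forall i j, P 1 0 (coord_c i j)) -> (forall i j, P 0 1 (coord_d i j)) ->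
  forall r s f, f \in A r s -> P r s f.
Proof.
move=> P1 P0 PL PM Pc Pd.
pose Q r s f := f \in A r s /\ P r s f.
have Q1 : Q 0 0 1 by split; first exact: ratA1.
have QM r s r' s' f g : Q r s f -> Q r' s' g -> Q (r + r')%N (s + s')%N (f * g).
  by move=> [Af Pf] [Ag Pg]; split; [exact: ratAM | exact: PM].
have QX r s f k : Q r s f -> Q (k * r)%N (k * s)%N (f ^+ k).
  by move=> Qf; elim: k => [|k IH] //; rewrite exprS !mulSn; exact: QM.
have Qprod (I : finType) (r s : I -> nat) (F : I -> KG) :
    (forall i, Q (r i) (s i) (F i)) -> Q (\sum_i r i)%N (\sum_i s i)%N (\prod_i F i).
  by move=> QF; elim/big_rec3: _ => [|i f b a _ IH] //; exact: QM.
have Qb (a b : 'M[nat]_n) : Q (\sum_i \sum_j a i j)%N (\sum_i \sum_j b i j)%N (bimonomial a b).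
  have Z (F : 'M[nat]_n) : (\sum_i \sum_j F i j * 0 = 0)%N.
    by rewrite big1 // => i _; rewrite big1 // => j _; rewrite muln0.
  have M1 (F : 'M[nat]_n) : (\sum_i \sum_j F i j = \sum_i \sum_j F i j * 1)%N.
    by apply: eq_bigr => i _; apply: eq_bigr => j _; rewrite muln1.
  have Qc : Q (\sum_i \sum_j a i j * 1)%N (\sum_i \sum_j a i j * 0)%N
      (\prod_i \prod_j coord_c i j ^+ a i j).
    apply: (Qprod) => i; apply: Qprod => j; apply: QX.
    by split; [exact: coord_c_ratA | exact: Pc].
  have Qd : Q (\sum_i \sum_j b i j * 0)%N (\sum_i \sum_j b i j * 1)%N
      (\prod_i \prod_j coord_d i j ^+ b i j).
    apply: (Qprod) => i; apply: Qprod => j; apply: QX.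
    by split; [exact: coord_d_ratA | exact: Pd].
  by have := QM _ _ _ _ _ _ Qc Qd; rewrite !Z -!M1 addn0 add0n.
move=> r s f /asboolP; suff h : forall f, span_spec (is_bimonomial r s) f -> Q r s f.
  by move/h => [].
move=> {}f; elim=> [|a u v [c [d [hc hd ->]]] hv [Av Pv]].
  by split; [exact: rpred0 | exact: P0].
have [Ab Pb] : Q r s (bimonomial c d) by rewrite -hc -hd; exact: Qb.
by split; [rewrite rpredD ?rpredZ | exact: PL].
Qed.

(** The conditions are restricted to the A(n,r,s), since other functions need not
    be differentiable along X. *)
Record derivation (D : KG -> KG) : Prop := Derivation {
  derA : forall r s f, f \in A r s -> D f \in A r s;
  derP : forall r s a f g, f \in A r s -> g \in A r s -> D (a *: f + g) = a *: D f + D g;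
  derM : forall r s r' s' f g, f \in A r s -> g \in A r' s' -> D (f * g) = D f * g + f * D g;
  der0 : D 0 = 0 ;
  der1 : D 1 = 0 }.

(** This is how identities between vector fields are proved: compare them on the
    coordinate functions. *)
Lemma derivation_eq D1 D2 : derivation D1 -> derivation D2 ->
  (forall i j, D1 (coord_c i j) = D2 (coord_c i j)) ->
  (forall i j, D1 (coord_d i j) = D2 (coord_d i j)) ->
  forall r s f, f \in A r s -> D1 f = D2 f.
Proof.
move=> d1 d2 hc hd; apply: ratA_ind => //.
- by rewrite (der1 d1) (der1 d2).
- by move=> r s; rewrite (der0 d1) (der0 d2).
- by move=> r s a f g Af Ag hf hg; rewrite (derP d1 _ Af) // (derP d2 _ Af) // hf hg.
by move=> r s r' s' f g Af Ag hf hg; rewrite (derM d1 Af Ag) (derM d2 Af Ag) hf hg.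
Qed.

Lemma derivation_lin a D1 D2 : derivation D1 -> derivation D2 ->
  derivation (fun f => a *: D1 f + D2 f).
Proof.
move=> d1 d2; split.
- by move=> r s f Af; rewrite rpredD ?rpredZ ?(derA d1) ?(derA d2).
- move=> r s b f g Af Ag; rewrite (derP d1 _ Af) // (derP d2 _ Af) //.
  by rewrite !scalerDr !scalerA mulrC addrACA.
- move=> r s r' s' f g Af Ag; rewrite (derM d1 Af Ag) (derM d2 Af Ag).
  apply/funext => x.
  rewrite -[LHS]/(a * (D1 f x * g x + f x * D1 g x) + (D2 f x * g x + f x * D2 g x)).
  rewrite -[RHS]/((a * D1 f x + D2 f x) * g x + f x * (a * D1 g x + D2 g x)); ring.
- by rewrite (der0 d1) (der0 d2) scaler0 addr0.
by rewrite (der1 d1) (der1 d2) scaler0 addr0.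
Qed.

Lemma derivation_bracket D1 D2 : derivation D1 -> derivation D2 ->
  derivation (fun f => D1 (D2 f) - D2 (D1 f)).
Proof.
move=> d1 d2; have A1 := derA d1; have A2 := derA d2; split.
- by move=> r s f Af; apply: rpredB; [exact/A1/A2 | exact/A2/A1].
- move=> r s b f g Af Ag; rewrite (derP d1 _ Af) // (derP d2 _ Af) //.
  rewrite (derP d1 _ (A2 _ _ _ Af) (A2 _ _ _ Ag)) (derP d2 _ (A1 _ _ _ Af) (A1 _ _ _ Ag)).
  by rewrite scalerBr opprD addrACA.
- move=> r s r' s' f g Af Ag; rewrite (derM d1 Af Ag) (derM d2 Af Ag).
  have Dfg (D D' : KG -> KG) : derivation D -> derivation D' ->
      D (D' f * g + f * D' g) = D (D' f) * g + D' f * D g + (D f * D' g + f * D (D' g)).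
    move=> d d'; have A' := derA d'; rewrite -[D' f * g]scale1r.
    rewrite (derP d 1 (ratAM (A' _ _ _ Af) Ag) (ratAM Af (A' _ _ _ Ag))) scale1r.
    by rewrite (derM d (A' _ _ _ Af) Ag) (derM d Af (A' _ _ _ Ag)).
  rewrite !Dfg //; apply/funext => x.
  rewrite -[LHS]/(D1 (D2 f) x * g x + D2 f x * D1 g x + (D1 f x * D2 g x + f x * D1 (D2 g) x)
    - (D2 (D1 f) x * g x + D1 f x * D2 g x + (D2 f x * D1 g x + f x * D2 (D1 g) x))).
  rewrite -[RHS]/((D1 (D2 f) x - D2 (D1 f) x) * g x + f x * (D1 (D2 g) x - D2 (D1 g) x)); ring.
- by rewrite (der0 d1) (der0 d2) (der0 d1) subrr.
by rewrite (der1 d1) (der1 d2) (der0 d1) (der0 d2) subrr.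
Qed.

(** The derivative is chosen, rather than computed, because an element of
    A(n,r,s) is only given as a function; [ldiffE] shows that it is well defined. *)
Definition ldiff X (f : KG) : KG :=
  if pselect (exists f', exists s, deriv_along s X f f') is left h
  then projT1 (cid h) else 0.

Lemma ldiffE s X f f' : deriv_along s X f f' -> ldiff X f = f'.
Proof.
move=> df; rewrite /ldiff; case: pselect => [h|[]]; last by exists f', s.
by case: (cid h) => /= f2 [s' df2]; exact: deriv_along_uniq df2 df.
Qed.

Lemma mulmx_coord_c (M : 'M[K]_n) i j :
  (fun g : GLn K n => (val g *m M) i j) = \sum_k M k j *: coord_c i k :> KG.
Proof.
apply/funext => g; rewrite fct_sumE mxE; apply: eq_bigr => k _.
exact: mulrC.
Qed.

Lemma mulmx_coord_d (M : 'M[K]_n) i j :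
  (fun g : GLn K n => (M *m invmx (val g)) i j) = \sum_k M i k *: coord_d k j :> KG.
Proof. by apply/funext => g; rewrite fct_sumE mxE. Qed.

Lemma coord_cE i j : coord_c i j = fun g : GLn K n => (val g *m 1%:M) i j.
Proof. by apply/funext => g; rewrite mulmx1. Qed.

Lemma coord_dE i j : coord_d i j = fun g : GLn K n => (1%:M *m invmx (val g)) i j.
Proof. by apply/funext => g; rewrite mul1mx. Qed.

Lemma ldiff_spec X r s f : f \in A r s -> deriv_along s X f (ldiff X f) /\ ldiff X f \in A r s.
Proof.
move=> Af; suff [f' Af' df] : exists2 f', f' \in A r s & deriv_along s X f f'.
  by rewrite (ldiffE df).
elim/ratA_ind: {f} Af => [|r1 s1|r1 s1 a f g _ _ [f' Af df] [g' Ag dg]|||i j].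
- by exists 0; [exact: rpred0 | exact: deriv_along1].
- by exists 0; [exact: rpred0 | exact: deriv_along0].
- by exists (a *: f' + g'); [rewrite rpredD ?rpredZ | exact: deriv_alongP].
- move=> r1 s1 r2 s2 f g Af Ag [f' Af' df] [g' Ag' dg].
  exists (f' * g + f * g'); last exact: deriv_alongM.
  by rewrite rpredD //; exact: ratAM.
- move=> i j; exists (fun g => (val g *m (X *m 1%:M)) i j).
    by rewrite mulmx_coord_c rpred_sum // => k _; rewrite rpredZ ?coord_c_ratA.
  by rewrite coord_cE; exact: deriv_along_c.
exists (fun g => - ((1%:M *m X) *m invmx (val g)) i j).
  rewrite [X in X \in _](_ : _ = - (fun g : GLn K n => ((1%:M *m X) *m invmx (val g)) i j)) //.
  by rewrite mulmx_coord_d rpredN rpred_sum // => k _; rewrite rpredZ ?coord_d_ratA.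
by rewrite coord_dE; exact: deriv_along_d.
Qed.

Lemma ldiff_derivation X : derivation (ldiff X).
Proof.
have dD r s f (Af : f \in A r s) := (ldiff_spec X Af).1; split.
- by move=> r s f /(ldiff_spec X) [].
- by move=> r s a f g Af Ag; apply: ldiffE; apply: (deriv_alongP _ (dD _ _ _ Af) (dD _ _ _ Ag)).
- by move=> r s r' s' f g Af Ag; apply: ldiffE; apply: (deriv_alongM (dD _ _ _ Af) (dD _ _ _ Ag)).
- exact: ldiffE (deriv_along0 0 X).
exact: ldiffE (deriv_along1 X).
Qed.

Lemma ldiff_c X (M : 'M[K]_n) i j : ldiff X (fun g => (val g *m M) i j) =
  (fun g => (val g *m (X *m M)) i j).
Proof. exact: ldiffE (deriv_along_c _ _ _ _). Qed.

Lemma ldiff_d X (M : 'M[K]_n) i j : ldiff X (fun g => (M *m invmx (val g)) i j) =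
  (fun g => - ((M *m X) *m invmx (val g)) i j).
Proof. exact: ldiffE (deriv_along_d _ _ _ _). Qed.

Lemma ldiff_lin X Y a r s f : f \in A r s -> ldiff (a *: X + Y) f = a *: ldiff X f + ldiff Y f.
Proof.
move=> Af; apply: (@derivation_eq (ldiff (a *: X + Y))
  (fun f => a *: ldiff X f + ldiff Y f) _ _ _ _ r s f Af) => [||i j|i j].
- exact: ldiff_derivation.
- by apply: derivation_lin; exact: ldiff_derivation.
- rewrite coord_cE !ldiff_c; apply/funext => g.
  by rewrite !mulmx1 mulmxDr -scalemxAr mxE [X in X + _]mxE.
rewrite coord_dE !ldiff_d; apply/funext => g.
have -> : (1%:M *m (a *: X + Y) *m invmx (val g)) i j =
    a * (X *m invmx (val g)) i j + (Y *m invmx (val g)) i j.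
  by rewrite mul1mx mulmxDl -scalemxAl [LHS]mxE [X in X + _]mxE.
by rewrite opprD -mulrN !mul1mx.
Qed.

Lemma ldiff_bracket X Y r s f : f \in A r s ->
  ldiff X (ldiff Y f) - ldiff Y (ldiff X f) = ldiff (X *m Y - Y *m X) f.
Proof.
move=> Af; apply: (@derivation_eq (fun f => ldiff X (ldiff Y f) - ldiff Y (ldiff X f))
  (ldiff (X *m Y - Y *m X)) _ _ _ _ r s f Af) => [||i j|i j].
- by apply: derivation_bracket; exact: ldiff_derivation.
- exact: ldiff_derivation.
- rewrite coord_cE !ldiff_c; apply/funext => g.
  rewrite -[LHS]/((val g *m (X *m (Y *m 1%:M))) i j - (val g *m (Y *m (X *m 1%:M))) i j).
  by rewrite !mulmx1 mulmxBr [RHS]mxE [X in _ = _ + X]mxE.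
have dN Z W : ldiff Z (fun g => - (W *m invmx (val g)) i j) =
    (fun g => ((W *m Z) *m invmx (val g)) i j).
  rewrite [X in ldiff _ X](_ : _ = (fun g => ((- W) *m invmx (val g)) i j)); last first.
    by apply/funext => g; rewrite mulNmx [RHS]mxE.
  by rewrite ldiff_d; apply/funext => g; rewrite !mulNmx [X in - X]mxE opprK.
rewrite coord_dE !ldiff_d !dN; apply/funext => g.
rewrite -[LHS]/((1%:M *m Y *m X *m invmx (val g)) i j - (1%:M *m X *m Y *m invmx (val g)) i j).
by rewrite !mul1mx mulmxBl [X in _ = - X]mxE [X in _ = - (_ + X)]mxE opprB.
Qed.

End Operator.
End Curve.

(** * Left invariant vector fields in the rational Schur algebra *)

Section Action.
Variables (K : fieldType) (n : nat) (charK : [pchar K] =i pred0).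
Variables (r s : nat).
Local Notation KG := (GLn K n -> K^o).
Local Notation A := (@ratA_pred K n).
Local Notation RS := (ratSchur K n r s).
Local Notation RA := (ratA K n r s).
Local Notation ldiff := (@ldiff K n).
Local Notation one_GL := (GLn_one K n).
Implicit Types (X Y : 'M[K]_n) (f g : RA) (phi psi : RS).

(** Left translation by x maps the curve g (1 + t X) to x g (1 + t X). *)
Lemma ldiff_translate X (f : KG) (r' s' : nat) (x : GLn K n) : f \in A r' s' ->
  ldiff X (fun y => f (GLn_mul x y)) = (fun y => ldiff X f (GLn_mul x y)).
Proof.
move=> Af; apply: (ldiffE charK (s := s')) => g.
have [P hP Pf] := (ldiff_spec charK X Af).1 (GLn_mul x g); exists P => //.
by move=> t h hh; apply: hP => /=; rewrite hh mulmxA.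
Qed.

Fact vfield_subproof X : scalar (fun f : RA => ldiff X f one_GL).
Proof.
move=> a f g; rewrite ratA_valD ratA_valZ.
by rewrite (derP (ldiff_derivation charK X) a (ratAP f) (ratAP g)).
Qed.

Definition vfield X : RS := rs_of (vfield_subproof X).

Lemma contractM phi psi f : contract (phi * psi) f = contract phi (contract psi f).
Proof.
apply: val_inj; apply/funext => x.
rewrite -[LHS]/(phi (contract psi (translate f x))).
rewrite -[RHS]/(phi (translate (contract psi f) x)); congr (phi _).
apply: val_inj; apply/funext => y.
rewrite -[LHS]/(psi (translate (translate f x) y)).
rewrite -[RHS]/(psi (translate f (GLn_mul x y))); congr (psi _).
by apply: val_inj; apply/funext => z; rewrite /= GLn_mulA.
Qed.

Lemma contract1 f : contract 1 f = f.
Proof. by apply: val_inj; apply/funext => x; rewrite /= GLn_mulg1. Qed.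

Lemma contractZ phi a f : contract phi (a *: f) = a *: contract phi f.
Proof.
have c0 : contract phi 0 = 0.
  by have := contractP (-1) phi 0 0; rewrite scaler0 addr0 scaleN1r addNr.
by have := contractP a phi f 0; rewrite c0 !addr0.
Qed.

Lemma contractDl phi psi f : contract (phi + psi) f = contract phi f + contract psi f.
Proof. by apply: val_inj; rewrite -[RHS]/(ratA_val _) ratA_valD. Qed.

Lemma contractZl a phi f : contract (a *: phi) f = a *: contract phi f.
Proof. by apply: val_inj; rewrite -[RHS]/(ratA_val _) ratA_valZ. Qed.

Lemma contract_one phi f : contract phi f one_GL = phi f.
Proof.
rewrite -[LHS]/(phi (translate f one_GL)); congr (phi _).
by apply: val_inj; apply/funext => x; rewrite /= GLn_mul1g.
Qed.

Lemma contract_inj phi psi : (forall f, contract phi f = contract psi f) -> phi = psi.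
Proof. by move=> h; apply: ratSchurP => f; rewrite -!contract_one h. Qed.

(** The dual acts on A(n,r,s) through [contract], and vector fields act by
    differentiation; products in the dual become compositions of operators. *)
Lemma contract_vfield X f : contract (vfield X) f = ldiff X f :> KG.
Proof.
apply/funext => x; rewrite -[LHS]/(ldiff X (translate f x) one_GL).
rewrite -[X in ldiff _ X]/(fun y => f (GLn_mul x y)) (ldiff_translate _ _ (ratAP f)).
by rewrite GLn_mulg1.
Qed.

Lemma vfield_lin a X Y : vfield (a *: X + Y) = a *: vfield X + vfield Y.
Proof.
apply: ratSchurP => f; rewrite -[LHS]/(ldiff _ f one_GL) (ldiff_lin charK _ _ _ (ratAP f)).
by [].
Qed.

Fact vfield_is_linear : linear vfield. Proof. exact: vfield_lin. Qed.
HB.instance Definition _ := GRing.isLinear.Build K 'M[K]_n RS *:%R vfield vfield_is_linear.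

Lemma vfield_bracket X Y : vfield X * vfield Y - vfield Y * vfield X = vfield (X *m Y - Y *m X).
Proof.
rewrite -[X in _ + X = _]scaleN1r; apply: contract_inj => f; apply: val_inj.
rewrite -[RHS]/(ratA_val (contract (vfield _) f)) contract_vfield.
rewrite -(ldiff_bracket charK _ _ (ratAP f)) contractDl contractZl !contractM.
by rewrite -[LHS]/(ratA_val _) ratA_valD ratA_valZ !contract_vfield scaleN1r.
Qed.

Lemma vfield_trace : vfield 1%:M = (r%:R - s%:R) *: (1 : RS).
Proof.
apply: ratSchurP => f; rewrite -[LHS]/(ldiff _ f one_GL).
rewrite -[RHS]/(((r%:R - s%:R) *: (f : KG)) one_GL); congr (_ one_GL).
move: (ratA_val f) (ratAP f) => {}f; move: r s => r0 s0 Af.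
elim/ratA_ind: {f r0 s0} Af => [|r0 s0|r0 s0 a f g Af Ag hf hg||i j|i j].
- by rewrite (der1 (ldiff_derivation charK _)) subrr scale0r.
- by rewrite (der0 (ldiff_derivation charK _)) scaler0.
- by rewrite (derP (ldiff_derivation charK _) _ Af) // hf hg scalerDr !scalerA mulrC.
- move=> r0 s0 r1 s1 f g Af Ag hf hg.
  rewrite (derM (ldiff_derivation charK _) Af Ag) hf hg; apply/funext => x.
  rewrite -[LHS]/((r0%:R - s0%:R) * f x * g x + f x * ((r1%:R - s1%:R) * g x)).
  by rewrite -[RHS]/(((r0 + r1)%:R - (s0 + s1)%:R) * (f x * g x)) !natrD; ring.
- by rewrite coord_cE (ldiff_c charK) mulmx1 subr0 scale1r.
rewrite coord_dE (ldiff_d charK) mulmx1 sub0r scaleN1r.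
by apply/funext => g.
Qed.

Definition diag_set (S : {set 'I_n}) : 'M[K]_n := \sum_(i in S) delta_mx i i.

Lemma mulmx_diag_set (M : 'M[K]_n) S i j : (M *m diag_set S) i j = (j \in S)%:R * M i j.
Proof.
rewrite /diag_set mulmx_sumr summxE.
have E k : (M *m delta_mx k k) i j = (j == k)%:R * M i j.
  rewrite mxE (bigD1 k) //= big1 ?addr0 => [|l /negPf lk]; rewrite mxE ?lk ?mulr0 //.
  by rewrite eqxx; case: eqP => [->|]; rewrite ?mulr0 ?mulr1 ?mul0r ?mul1r.
under eq_bigr do rewrite E; rewrite -mulr_suml -natr_sum.
congr (_%:R * _); have [jS|jS] := boolP (j \in S).
  rewrite (bigD1 j) //= eqxx big1 // => k /andP [_ /negPf kj].
  by rewrite eq_sym kj.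
by rewrite big1 // => k kS; case: eqP jS => // ->; rewrite kS.
Qed.

Lemma diag_set_mulmx (M : 'M[K]_n) S i j : (diag_set S *m M) i j = (i \in S)%:R * M i j.
Proof.
have -> : diag_set S = (diag_set S)^T.
  by rewrite /diag_set linear_sum; apply: eq_bigr => k _; rewrite /= trmx_delta.
by rewrite -[M]trmxK -trmx_mul mxE mulmx_diag_set !mxE.
Qed.

(** The weight of the coordinate functions is 0 or 1 for c_ij and 0 or -1 for
    d_ij, and weights add up in products. *)
Definition diag_eigen (S : {set 'I_n}) (r' s' : nat) (f : KG) : Prop :=
  f \in A r' s' /\ exists2 m : int, - s'%:Z <= m <= r'%:Z &
    ldiff (diag_set S) f = m%:~R *: f.

Lemma scaleKGl a (f g : KG) : a *: (f * g) = a *: f * g.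
Proof. by apply/funext => x; exact: mulrA. Qed.

Lemma scaleKGr a (f g : KG) : a *: (f * g) = f * (a *: g).
Proof. by apply/funext => x; exact: mulrCA. Qed.

Lemma diag_eigen_mul S r1 s1 r2 s2 (f g : KG) : diag_eigen S r1 s1 f ->
  diag_eigen S r2 s2 g -> diag_eigen S (r1 + r2) (s1 + s2) (f * g).
Proof.
move=> [Af [a ha fa]] [Ag [b hb gb]]; split; first exact: ratAM.
exists (a + b); first by lia.
rewrite (derM (ldiff_derivation charK _) Af Ag) fa gb intrD scalerDl.
by rewrite -scaleKGl -scaleKGr.
Qed.

Lemma diag_eigen_span S r' s' (f : KG) : f \in A r' s' -> f \in Defs.span (diag_eigen S r' s').
Proof.
have d := ldiff_derivation charK (diag_set S).
move=> Af; elim/ratA_ind: {r' s' f} Af => [|r0 s0|r0 s0 a f g Af Ag hf hg||i j|i j].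
- apply: span_gen; split; first exact: ratA1.
  by exists 0; rewrite ?(der1 d) ?scale0r.
- exact: rpred0.
- by rewrite rpredD ?rpredZ.
- move=> r1 s1 r2 s2 f g _ _ /asboolP + /asboolP hg.
  elim=> [|a u v hu _ IH]; first by rewrite mul0r rpred0.
  rewrite mulrDl rpredD // -scaleKGl rpredZ //.
  elim: hg => [|b u' v' hu' _ IH']; first by rewrite mulr0 rpred0.
  rewrite mulrDr rpredD // -scaleKGr rpredZ //.
  exact/span_gen/diag_eigen_mul.
- apply: span_gen; split; first exact: coord_c_ratA.
  exists (j \in S)%:R; first by case: (_ \in _).
  rewrite coord_cE (ldiff_c charK); apply/funext => g.
  rewrite mulmx1 mulmx_diag_set -[RHS]/(_ * (val g *m 1%:M) i j) mulmx1.
  by case: (_ \in _).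
apply: span_gen; split; first exact: coord_d_ratA.
exists (- (i \in S)%:R); first by case: (_ \in _).
rewrite coord_dE (ldiff_d charK); apply/funext => g.
rewrite mul1mx diag_set_mulmx -[RHS]/(_ * (1%:M *m invmx (val g)) i j) mul1mx.
by case: (_ \in _); rewrite ?mulN1r ?mul0r ?mul1r ?oppr0.
Qed.

Lemma diag_eigen_ratA S r' s' (f : KG) :
  Defs.span_spec (diag_eigen S r' s') f -> f \in A r' s'.
Proof.
by elim=> [|a u v [Au _] _ Av]; [exact: rpred0 | rewrite rpredD ?rpredZ].
Qed.

Lemma contract_prod X (f : RA) m (I : Type) (t : seq I) (a : I -> K) :
  contract (vfield X) f = m *: f ->
  contract (\prod_(k <- t) (vfield X + a k *: (1 : RS))) f = (\prod_(k <- t) (m + a k)) *: f.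
Proof.
move=> fm; elim: t => [|k t IH]; first by rewrite !big_nil contract1 scale1r.
rewrite !big_cons contractM IH contractZ contractDl contractZl contract1 fm.
by rewrite -scalerDl scalerA mulrC.
Qed.

Lemma vfield_diag_prod (S : {set 'I_n}) :
  \prod_(0 <= k < (r + s).+1) (vfield (diag_set S) + (k%:R - r%:R) *: (1 : RS)) = 0.
Proof.
set phi := \prod_(_ <= _ < _) _.
apply: ratSchurP => f; rewrite -[RHS]/(0 : K).
have /asboolP := diag_eigen_span S (ratAP f).
suff h u : Defs.span_spec (diag_eigen S r s) u ->
    forall f : RA, f = u :> KG -> phi f = 0 by move/h; apply.
elim=> [|a {}u v [Au [m hm um]] hv IH] {}f fE.
  by rewrite (_ : f = 0) ?linear0 //; apply: val_inj.
pose fu := RatA Au; pose fv := RatA (diag_eigen_ratA hv).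
have -> : f = a *: fu + fv by apply: val_inj; rewrite /= fE.
rewrite linearP (IH fv) // addr0 -contract_one (contract_prod (m := m%:~R)); last first.
  apply: val_inj; rewrite -[RHS]/(ratA_val _) ratA_valZ.
  by rewrite -[LHS]/(ratA_val (contract _ _)) contract_vfield.
have -> : \prod_(0 <= k < (r + s).+1) (m%:~R + (k%:R - r%:R)) = 0 :> K.
  apply/eqP; rewrite prodf_seq_eq0; apply/hasP; exists (absz (r%:Z - m)).
    by rewrite mem_index_iota; lia.
  rewrite /=; set k := absz _; have -> : m = r%:Z - k%:Z by rewrite /k; lia.
  by rewrite intrB -!pmulrn; apply/eqP; ring.
by rewrite scale0r mulr0.
Qed.

End Action.

(** * Vector fields generate the rational Schur algebra *)

Section Separation.
Variables (K : fieldType) (n : nat) (charK : [pchar K] =i pred0).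
Local Notation KG := (GLn K n -> K^o).
Local Notation A := (@ratA_pred K n).
Local Notation ldiff := (@ldiff K n).
Local Notation one_GL := (GLn_one K n).

Lemma comp_poly_shift_coef (p : {poly K}) t :
  (p \Po ('X + t%:P))`_0 = p.[t] /\ (p \Po ('X + t%:P))`_1 = p^`().[t].
Proof.
split; first by rewrite -horner_coef0 horner_comp hornerD hornerX hornerC add0r.
have -> : (p \Po ('X + t%:P))`_1 = ((p \Po ('X + t%:P))^`())`_0.
  by rewrite coef_deriv mulr1n.
rewrite deriv_comp derivD derivX derivC addr0 mulr1.
by rewrite -horner_coef0 horner_comp hornerD hornerX hornerC add0r.
Qed.

Lemma ldiff_sum r s (f : KG) (X : 'M[K]_n) : f \in A r s ->
  ldiff X f = \sum_i \sum_j X i j *: ldiff (delta_mx i j) f.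
Proof.
move=> Af; have DD a Y Z : ldiff (a *: Y + Z) f = a *: ldiff Y f + ldiff Z f.
  exact: (ldiff_lin charK _ _ _ Af).
have D0 : ldiff 0 f = 0.
  by have := DD (-1) 0 0; rewrite scaler0 addr0 scaleN1r addNr.
rewrite {1}(matrix_sum_delta X).
have S1 (I : finType) (F : I -> 'M[K]_n) : ldiff (\sum_i F i) f = \sum_i ldiff (F i) f.
  apply: (big_morph (ldiff^~ f) _ D0) => Y Z.
  by have := DD 1 Y Z; rewrite !scale1r.
rewrite S1; apply: eq_bigr => i _; rewrite S1; apply: eq_bigr => j _.
by have := DD (X i j) (delta_mx i j) 0; rewrite !addr0 D0 addr0.
Qed.

(** Along t |-> 1 + t X the logarithmic derivative is (1 + t X)^-1 X, so that
    the derivative of f along this curve is a combination of left invariant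
    derivatives of f, with coefficients that are polynomial up to the
    determinant. *)
Lemma curve_poly_ode r s (f : KG) X P (PP : 'I_n -> 'I_n -> {poly K}) :
  f \in A r s -> curve_poly s X f one_GL P ->
  (forall i j, curve_poly s X (ldiff (delta_mx i j) f) one_GL (PP i j)) ->
  P^`() * detp X - s%:R * (detp X)^`() * P =
  \sum_i \sum_j (\adj (curvep X) *m map_mx polyC X) i j * PP i j.
Proof.
move=> Af hP hPP; apply: (poly_fun_eq charK (detp_neq0 X)) => t0 ut0.
set u := detp X in ut0 *.
have gU : curve X t0 \in unitmx by rewrite curve_unit.
pose g : GLn K n := exist (fun m => m \in unitmx) _ gU.
pose Y := invmx (val g) *m X.
have curveE t : val g *m curve Y t = curve X (t0 + t).
  rewrite /curve mulmxDr mulmx1 -scalemxAr /Y mulKVmx //= /curve.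
  by rewrite -addrA -scalerDl.
(* the curve g (1 + t Y) is the curve 1 + (t0 + t) X *)
have uY : u.[t0] *: detp Y = u \Po ('X + t0%:P).
  apply/eqP; rewrite -subr_eq0; apply/eqP/(poly_fun_eq0 charK) => t.
  rewrite hornerD hornerN hornerZ horner_comp hornerD hornerX hornerC /u !horner_detp.
  by rewrite -[X in X * _]/(\det (val g)) -det_mulmx curveE (addrC t) subrr.
have [Q hQ DfQ] := (ldiff_spec charK Y Af).1 g.
have QP : u.[t0] ^+ s *: Q = P \Po ('X + t0%:P).
  apply: (poly_fun_eq charK (detp_neq0 Y)) => t; rewrite -curve_unit => cU.
  have hU : val g *m curve Y t \in unitmx by rewrite unitmx_mul gU.
  pose h : GLn K n := exist (fun m => m \in unitmx) _ hU.
  rewrite hornerZ horner_comp hornerD hornerX hornerC.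
  rewrite -(hQ t h) // -(hP _ h); last by rewrite /= mul1mx curveE addrC.
  by rewrite mulrCA -exprMn -hornerZ uY horner_comp hornerD hornerX hornerC.
have [P0 P1] := comp_poly_shift_coef P t0; rewrite -QP !coefZ in P0 P1.
have [u0 u1] := comp_poly_shift_coef u t0; rewrite -uY !coefZ in u0 u1.
have DfE : ldiff Y f g * u.[t0] ^+ s.+1 = P^`().[t0] * u.[t0] - s%:R * u^`().[t0] * P.[t0].
  by rewrite DfQ -P0 -P1 -u1 exprS; ring.
have E : (s%:R : {poly K}).[t0] = s%:R by rewrite -polyC_natr hornerC.
rewrite hornerD hornerN !hornerM E -DfE (ldiff_sum Y Af) [RHS]horner_sum.
rewrite fct_sumE mulr_suml. apply: eq_bigr => i _.
rewrite fct_sumE mulr_suml [RHS]horner_sum; apply: eq_bigr => j _.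
rewrite -[X in X * _]/(Y i j * ldiff (delta_mx i j) f g) hornerM -(hPP i j t0 g); last first.
  by rewrite mul1mx.
have -> : ((\adj (curvep X) *m map_mx polyC X) i j).[t0] = u.[t0] * Y i j.
  rewrite -[LHS]/(horner_eval t0 _).
  have -> (M : 'M[{poly K}]_n) : horner_eval t0 (M i j) = map_mx (horner_eval t0) M i j.
    by rewrite [RHS]mxE.
  rewrite map_mxM map_mx_adj horner_curvep map_mx_hornerC /Y /u horner_detp.
  have -> : \adj (curve X t0) = \det (curve X t0) *: invmx (curve X t0).
    by rewrite -[LHS]mulmx1 -(mulmxV gU) mulmxA mul_adj_mx mul_scalar_mx.
  by rewrite -scalemxAl [LHS]mxE.
by rewrite exprS; ring.
Qed.

Lemma coefM_low (p q : {poly K}) m : (forall k, (k < m)%N -> p`_k = 0) ->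
  (p * q)`_m = p`_m * q`_0.
Proof.
move=> pk; rewrite coefM big_ord_recr /= subnn big1 ?add0r // => i _.
by rewrite pk ?mul0r.
Qed.

(** The restriction of f to t |-> 1 + t (g - 1) has all coefficients zero: by
    [curve_poly_ode] the coefficient of t^(m+1), multiplied by m + 1, is a
    combination of coefficients of degree at most m of functions in N. *)
Lemma invariant_derivatives_separate r s (N : KG -> Prop) :
  (forall f, N f -> f \in A r s) -> (forall f X, N f -> N (ldiff X f)) ->
  (forall f, N f -> f one_GL = 0) -> forall f, N f -> f = 0.
Proof.
move=> NA ND N1 f Nf; apply/funext => g.
pose X := val g - 1%:M.
have ex f' : N f' -> exists P, curve_poly s X f' one_GL P.
  by move=> Nf'; have [P hP _] := (ldiff_spec charK X (NA _ Nf')).1 one_GL; exists P.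
have coefs0 m : forall f' P, N f' -> curve_poly s X f' one_GL P -> P`_m = 0.
  elim/ltn_ind: m => -[_|m IH] f' P Nf' hP.
    by rewrite (curve_poly_coef0 hP) N1.
  have exD i j : exists P, curve_poly s X (ldiff (delta_mx i j) f') one_GL P.
    by apply/ex/ND.
  have /choice [PP hPP] : forall ij : 'I_n * 'I_n, exists P,
      curve_poly s X (ldiff (delta_mx ij.1 ij.2) f') one_GL P by move=> [i j]; exact: exD.
  have := curve_poly_ode (PP := fun i j => PP (i, j)) (NA _ Nf') hP (fun i j => hPP (i, j)).
  move=> /(congr1 (fun p : {poly K} => p`_m)); rewrite coefB coef_sum.
  rewrite [RHS]big1 => [|i _]; last first.
    rewrite coef_sum big1 // => j _; rewrite mulrC coefM_low.
      by rewrite (IH m _ _ _ _ (hPP (i, j))) ?mul0r //; exact: ND.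
    by move=> k km; apply: (IH k _ _ _ _ (hPP (i, j))); [exact: ltnW | exact: ND].
  rewrite coefM_low; last first.
    by move=> k km; rewrite coef_deriv (IH k.+1 _ _ _ Nf' hP) ?mul0rn // ltnS.
  rewrite coef_deriv detp0 mulr1 [_ * P]mulrC coefM_low; last first.
    by move=> k km; apply: (IH k _ _ _ Nf' hP); exact: ltnW.
  rewrite (IH m _ _ _ Nf' hP) // mul0r subr0 -mulr_natl => /eqP.
  by rewrite mulf_eq0 => /orP [|/eqP //]; have /pcharf0P -> := charK.
have [P hP] := ex f Nf.
have P0 : P = 0 by apply/polyP => k; rewrite (coefs0 k f P Nf hP) coef0.
have := hP 1 g; rewrite mul1mx /curve scale1r addrC subrK => /(_ erefl) /eqP.
rewrite P0 horner0 mulf_eq0 => /orP [/eqP //|].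
rewrite expf_eq0 => /andP [_]; rewrite horner_detp /curve scale1r addrC subrK.
by have := valP g; rewrite unitmxE unitfE => /negPf ->.
Qed.

End Separation.

Section FiniteDual.
Variables (K : fieldType).

(** A matrix of maximal rank with rows in W has row space W, and membership in a
    row space is tested by the columns of [cokermx]. *)
Lemma row_subspace_bidual N (W : 'rV[K]_N -> Prop) (v : 'rV[K]_N) :
  W 0 -> (forall a x y, W x -> W y -> W (a *: x + y)) ->
  (forall y : 'cV[K]_N, (forall w, W w -> w *m y = 0) -> v *m y = 0) -> W v.
Proof.
move=> W0 WL vW.
have Wmul m (D : 'M[K]_(m, N)) (d : 'rV[K]_m) : (forall i, W (row i D)) -> W (d *m D).
  move=> DW; rewrite mulmx_sum_row; apply: big_ind => // [x y Wx Wy|i _].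
    by rewrite -[x]scale1r; exact: WL.
  by rewrite -[_ *: _]addr0; exact: WL.
pose Q k := `[< exists2 M : 'M[K]_N, (forall i, W (row i M)) & \rank M = k >].
have exQ : exists k, Q k.
  exists 0%N; apply/asboolP; exists 0; rewrite ?mxrank0 // => i.
  by rewrite row0.
have QN k : Q k -> (k <= N)%N by move=> /asboolP [M _ <-]; exact: rank_leq_row.
have [k /asboolP [M MW Mk] kmax] := ex_maxnP exQ QN.
have WM w : W w -> (w <= M)%MS.
  move=> Ww; pose M' := (M + w)%MS.
  have M'W i : W (row i M').
    have /submxP [D MD] : (row i M' <= col_mx M w)%MS.
      by rewrite (submx_trans (row_sub i _)) // /M' addsmxE.
    rewrite MD; apply: Wmul => j; case: (split_ordP j) => l ->.
      by rewrite rowKu.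
    by rewrite rowKd (_ : row l w = w) //; apply/rowP => p; rewrite mxE ord1.
  have : (\rank M' <= \rank M)%N by rewrite Mk; apply: kmax; apply/asboolP; exists M'.
  rewrite (geq_leqif (mxrank_leqif_sup (addsmxSl M w))) => h.
  exact: submx_trans (addsmxSr M w) h.
have vM : (v <= M)%MS.
  rewrite submxE; apply/eqP/matrixP => i j; rewrite [RHS]mxE.
  have vC : v *m col j (cokermx M) = 0.
    by apply: vW => w /WM; rewrite submxE => /eqP wM; rewrite colE mulmxA wM mul0mx.
  have := congr1 (fun A : 'M_1 => A i 0) vC; rewrite [RHS]mxE => <-.
  by rewrite !mxE; apply: eq_bigr => l _; rewrite [in RHS]mxE.
by have /submxP [D ->] := vM; exact: Wmul.
Qed.

Variables (n r s : nat).
Local Notation RS := (ratSchur K n r s).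
Local Notation RA := (ratA K n r s).

(** The exponents of a bimonomial in A(n,r,s) are bounded by r and s. *)
Lemma ratA_finite_span : exists N, exists b : 'I_N -> RA,
  forall f, exists c : 'I_N -> K, f = \sum_k c k *: b k.
Proof.
pose T : finType := ('M['I_r.+1]_n * 'M['I_s.+1]_n)%type.
pose nm m (a : 'M['I_m.+1]_n) : 'M[nat]_n := map_mx (@nat_of_ord m.+1) a.
pose b (t : T) : RA := insubd 0 (@bimonomial K n (nm _ t.1) (nm _ t.2)).
suff h f : exists c : T -> K, f = \sum_t c t *: b t.
  exists #|T|, (fun k => b (enum_val k)) => f; have [c ->] := h f.
  exists (fun k => c (enum_val k)).
  by rewrite (reindex (@enum_val T T)) //; exact: onW_bij (enum_val_bij T).
have /asboolP := ratAP f; move: (ratAP f).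
suff h u : Defs.span_spec (is_bimonomial r s) u ->
    exists c : T -> K, u = \sum_t c t *: (ratA_val (b t)).
  move=> _ /h [c fE]; exists c; apply: val_inj; rewrite /= fE.
  rewrite -[RHS]/(ratA_val _) ratA_val_sum.
  by apply: eq_bigr => t _; rewrite ratA_valZ.
elim=> [|a v w [a1 [b1 [ha hb ->]]] _ [c ->]].
  by exists (fun=> 0); rewrite big1 // => t _; rewrite scale0r.
have entry_le (M : 'M[nat]_n) m : (\sum_i \sum_j M i j = m)%N ->
    nm m (map_mx inord M) = M.
  move=> Mm; apply/matrixP => i j; rewrite !mxE inordK // ltnS -Mm.
  by rewrite (bigD1 i) //= (bigD1 j) //= -addnA leq_addr.
pose t0 : T := (map_mx inord a1, map_mx inord b1).
have bt0 : ratA_val (b t0) = @bimonomial K n a1 b1.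
  rewrite /b /= !entry_le // -[ratA_val _]/(val _) insubdK //.
  by apply: span_gen; exists a1, b1.
exists (fun t => (if t == t0 then a else 0) + c t).
under [RHS]eq_bigr do rewrite scalerDl; rewrite big_split /=; congr (_ + _).
rewrite (bigD1 t0) //= eqxx bt0 big1 ?addr0 // => t /negPf ->.
by rewrite scale0r.
Qed.

Lemma ratSchur_bidual (W : RS -> Prop) :
  W 0 -> (forall a x y, W x -> W y -> W (a *: x + y)) ->
  (forall f : RA, (forall phi, W phi -> phi f = 0) -> f = 0) -> forall phi, W phi.
Proof.
move=> W0 WL sep phi; have [N [b hb]] := ratA_finite_span.
pose ev (psi : RS) : 'rV[K]_N := \row_k psi (b k).
have ev_inj psi psi' : ev psi = ev psi' -> psi = psi'.
  move=> E; apply: ratSchurP => f; have [c ->] := hb f.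
  rewrite !linear_sum; apply: eq_bigr => k _; rewrite !linearZ /=.
  by have /rowP/(_ k) := E; rewrite !mxE => ->.
suff [psi Wpsi /ev_inj ->] : exists2 psi, W psi & ev phi = ev psi by [].
apply: (@row_subspace_bidual N (fun v => exists2 psi, W psi & v = ev psi)).
- by exists 0 => //; apply/rowP => k; rewrite !mxE.
- move=> a _ _ [x Wx ->] [y Wy ->]; exists (a *: x + y); first exact: WL.
  by apply/rowP => k; rewrite !mxE.
move=> y hy; pose f : RA := \sum_k y k 0 *: b k.
have evE psi : ev psi *m y = (psi f)%:M.
  apply/matrixP => i j; rewrite !ord1 !mxE mulr1n /f linear_sum.
  by apply: eq_bigr => k _; rewrite linearZ /= mxE mulrC.
have f0 : f = 0.
  apply: sep => psi Wpsi; have := hy (ev psi); rewrite evE => /(_ _)/matrixP/(_ 0 0).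
  by rewrite !mxE mulr1n; apply; exists psi.
by rewrite evE f0 linear0; apply/matrixP => i j; rewrite !mxE mul0rn.
Qed.

End FiniteDual.

(** * Highest weight functions *)

Section HighestWeightFunctions.
Variables (K : fieldType) (n : nat) (charK : [pchar K] =i pred0).
Local Notation KG := (GLn K n -> K^o).
Local Notation A := (@ratA_pred K n).
Local Notation ldiff := (@ldiff K n).
Local Notation one_GL := (GLn_one K n).
Implicit Types (S : {set 'I_n}) (g : GLn K n).

Lemma ratA_prod (I : finType) (a b : I -> nat) (F : I -> KG) :
  (forall i, F i \in A (a i) (b i)) -> \prod_i F i \in A (\sum_i a i)%N (\sum_i b i)%N.
Proof.
by move=> FA; elim/big_rec3: _ => [|i f q p _ IH]; [exact: ratA1 | exact: ratAM].
Qed.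

Lemma det_transvection (i j : 'I_n) (c : K) : (i <= j)%N ->
  \det (1%:M + c *: delta_mx i j) = 1 + c * (i == j)%:R.
Proof.
move=> ij; rewrite -det_tr det_trig; last first.
  apply/is_trig_mxP => k l kl; rewrite !mxE -(val_eqE l k) /= (gtn_eqF kl) add0r.
  rewrite (_ : (l == i) && (k == j) = false) ?mulr0 //.
  by apply/negP => /andP [/eqP El /eqP Ek]; move: kl ij; rewrite El Ek; lia.
rewrite (bigD1 j) //= big1 ?mulr1 => [|k kj]; rewrite !mxE eqxx.
  by rewrite andbT eq_sym.
by rewrite (negPf kj) andbF mulr0 addr0.
Qed.

Lemma detp_transvection (i j : 'I_n) : (i <= j)%N ->
  detp (delta_mx i j : 'M[K]_n) = 1 + (i == j)%:R *: 'X.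
Proof.
move=> ij; apply/eqP; rewrite -subr_eq0; apply/eqP/(poly_fun_eq0 charK) => t.
rewrite hornerD hornerN horner_detp /curve det_transvection //.
by rewrite hornerD hornerC hornerZ hornerX mulrC subrr.
Qed.

(** The minor of c on the rows and columns in S, as the determinant of the
    matrix whose other columns are those of the identity. *)
Definition minor_c S (g : GLn K n) : K :=
  \det (\matrix_(i, j) if j \in S then val g i j else (i == j)%:R).

Definition minor_d S (g : GLn K n) : K :=
  \det (\matrix_(i, j) if i \in S then invmx (val g) i j else (i == j)%:R).

Lemma sum_set_card S : (\sum_(i < n) (i \in S) = #|S|)%N.
Proof. by rewrite -sum1_card [RHS]big_mkcond; apply: eq_bigr => i _ /=; case: ifP. Qed.

Lemma const_ratA (a : K) : (fun=> a : K^o) \in A 0 0.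
Proof.
rewrite (_ : (fun=> a) = a *: (1 : KG)); first by rewrite rpredZ ?ratA1.
by apply/funext => g; exact/esym/mulr1.
Qed.

Lemma minor_c_ratA S : (minor_c S : KG) \in A #|S| 0.
Proof.
have -> : (minor_c S : KG) = \sum_(p : {perm 'I_n}) (-1) ^+ p *:
    (\prod_i (fun g => if i \in S then val g (p i) i else (p i == i)%:R : K^o) : KG).
  apply/funext => g; rewrite fct_sumE /minor_c -det_tr /determinant; apply: eq_bigr => p _.
  rewrite -[RHS]/(_ * _) fct_prodE; congr (_ * _); apply: eq_bigr => i _.
  by rewrite !mxE.
rewrite rpred_sum // => p _; rewrite rpredZ //.
have h := @ratA_prod _ (fun i : 'I_n => nat_of_bool (i \in S)) (fun=> 0%N)
  (fun i g => if i \in S then val g (p i) i else (p i == i)%:R : K^o).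
rewrite sum_set_card sum_nat_const muln0 in h; apply: h => i.
by case: (i \in S); [exact: coord_c_ratA | exact: const_ratA].
Qed.

Lemma minor_d_ratA S : (minor_d S : KG) \in A 0 #|S|.
Proof.
have -> : (minor_d S : KG) = \sum_(p : {perm 'I_n}) (-1) ^+ p *:
    (\prod_i (fun g => if i \in S then invmx (val g) i (p i) else (i == p i)%:R : K^o) : KG).
  apply/funext => g; rewrite fct_sumE /minor_d /determinant; apply: eq_bigr => p _.
  rewrite -[RHS]/(_ * _) fct_prodE; congr (_ * _); apply: eq_bigr => i _.
  by rewrite !mxE.
rewrite rpred_sum // => p _; rewrite rpredZ //.
have h := @ratA_prod _ (fun=> 0%N) (fun i : 'I_n => nat_of_bool (i \in S))
  (fun i g => if i \in S then invmx (val g) i (p i) else (i == p i)%:R : K^o).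
rewrite sum_set_card sum_nat_const muln0 in h; apply: h => i.
by case: (i \in S); [exact: coord_d_ratA | exact: const_ratA].
Qed.

Lemma minor_c1 S : minor_c S one_GL = 1.
Proof.
rewrite /minor_c [X in \det X](_ : _ = 1%:M) ?det1 //.
by apply/matrixP => i j; rewrite !mxE; case: ifP.
Qed.

Lemma minor_d1 S : minor_d S one_GL = 1.
Proof.
rewrite /minor_d [X in \det X](_ : _ = 1%:M) ?det1 //.
by apply/matrixP => i j; rewrite !mxE /= invmx1; case: ifP; rewrite ?mxE.
Qed.

(** Right multiplication by an upper triangular matrix b acts on the first columns
    through the corresponding diagonal block of b. *)
Lemma minor_c_curve S (i0 j0 : 'I_n) t g h : (i0 <= j0)%N ->
  (forall i j : 'I_n, (i <= j)%N -> j \in S -> i \in S) ->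
  val h = val g *m curve (delta_mx i0 j0) t ->
  minor_c S h = minor_c S g * (1 + t * ((j0 \in S) && (i0 == j0))%:R).
Proof.
move=> ij Sdown hE; have := @det_transvection i0 j0 (t * (j0 \in S)%:R) ij.
rewrite -mulrA -natrM mulnb => <-; rewrite -det_mulmx; congr (\det _).
have mul_delta (M : 'M[K]_n) i j : (M *m delta_mx i0 j0) i j = (j == j0)%:R * M i i0.
  rewrite mxE (bigD1 i0) //= big1 ?addr0 => [|l /negPf lk]; rewrite mxE ?lk ?mulr0 //.
  by rewrite eqxx mulrC.
apply/matrixP => i j; rewrite mulmxDr mulmx1 -scalemxAr.
rewrite [RHS]mxE [X in _ + X]mxE mul_delta !mxE hE /curve mulmxDr mulmx1 -scalemxAr.
rewrite [X in if _ then X else _]mxE [X in if _ then _ + X else _]mxE mul_delta.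
have [->|jj0] := eqVneq j j0; last by rewrite !mul0r !mulr0 !addr0.
case: ifP => [jS|_]; last by rewrite mulr0 mul0r addr0.
by rewrite (Sdown _ _ ij jS) mulr1.
Qed.

(** Here the last rows of the inverse matrix are concerned, and the block of b
    appears on the left. *)
Lemma minor_d_curve S (i0 j0 : 'I_n) t g h : (i0 <= j0)%N ->
  (forall i j : 'I_n, (i <= j)%N -> i \in S -> j \in S) ->
  val h = val g *m curve (delta_mx i0 j0) t ->
  minor_d S h * (1 + t * ((i0 \in S) && (i0 == j0))%:R) = minor_d S g.
Proof.
move=> ij Sup hE; have := @det_transvection i0 j0 (t * (i0 \in S)%:R) ij.
rewrite -mulrA -natrM mulnb => <-; rewrite mulrC -det_mulmx; congr (\det _).
have delta_mul (M : 'M[K]_n) i j : (delta_mx i0 j0 *m M) i j = (i == i0)%:R * M j0 j.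
  rewrite mxE (bigD1 j0) //= big1 ?addr0 => [|l /negPf lk]; rewrite mxE ?lk ?andbF ?mul0r //.
  by rewrite eqxx andbT.
have gE : invmx (val g) = curve (delta_mx i0 j0) t *m invmx (val h).
  by rewrite -[LHS]mulmx1 -(mulmxV (valP h)) hE !mulmxA mulVmx ?(valP g) // mul1mx.
apply/matrixP => i j; rewrite mulmxDl mul1mx -scalemxAl.
rewrite [LHS]mxE [X in _ + X]mxE delta_mul !mxE gE /curve mulmxDl mul1mx -scalemxAl.
rewrite [X in _ = if _ then X else _]mxE [X in _ = if _ then _ + X else _]mxE delta_mul.
have [->|ii0] := eqVneq i i0; last by rewrite !mul0r !mulr0 !addr0.
case: ifP => [iS|_]; last by rewrite mulr0 mul0r addr0.
by rewrite (Sup _ _ ij iS) mulr1.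
Qed.

(** Invariance under the upper unitriangular matrices (the case i < j) and the
    weight (the case i = j) are combined in one equation. *)
Definition hwfun (r s : nat) (m : 'I_n -> int) (f : KG) : Prop :=
  [/\ f \in A r s, f one_GL = 1 & forall i j : 'I_n, (i <= j)%N ->
    ldiff (delta_mx i j) f = ((i == j)%:R * (m i)%:~R) *: f].

Lemma hwfun1 : hwfun 0 0 (fun=> 0) 1.
Proof.
split=> // [|i j ij]; first exact: ratA1.
by rewrite (der1 (ldiff_derivation charK _)) mulr0 scale0r.
Qed.

Lemma hwfun_mul r1 s1 m1 f1 r2 s2 m2 f2 : hwfun r1 s1 m1 f1 -> hwfun r2 s2 m2 f2 ->
  hwfun (r1 + r2) (s1 + s2) (fun i => m1 i + m2 i) (f1 * f2).
Proof.
move=> [Af1 f11 Df1] [Af2 f21 Df2]; split; first exact: ratAM.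
  by rewrite -[LHS]/(f1 _ * f2 _) f11 f21 mulr1.
move=> i j ij; rewrite (derM (ldiff_derivation charK _) Af1 Af2) Df1 // Df2 //.
by rewrite intrD mulrDr scalerDl -scaleKGl -scaleKGr.
Qed.

Lemma hwfun_prod N (r s : nat -> nat) (m : nat -> 'I_n -> int) (f : nat -> KG) :
  (forall c, hwfun (r c) (s c) (m c) (f c)) ->
  hwfun (\sum_(c < N) r c) (\sum_(c < N) s c) (fun i => \sum_(c < N) m c i) (\prod_(c < N) f c).
Proof.
move=> hf; elim: N => [|N IH].
  rewrite !big_ord0 (_ : (fun i : 'I_n => _) = fun=> 0); first exact: hwfun1.
  by apply/funext => i; rewrite big_ord0.
rewrite !big_ord_recr /=.
rewrite (_ : (fun i : 'I_n => _) = fun i => (\sum_(c < N) m c i) + m N i); first exact: hwfun_mul.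
by apply/funext => i; rewrite big_ord_recr.
Qed.

Lemma hwfun_minor_c S : (forall i j : 'I_n, (i <= j)%N -> j \in S -> i \in S) ->
  hwfun #|S| 0 (fun i => (i \in S)%:R) (minor_c S).
Proof.
move=> Sdown; split; [exact: minor_c_ratA | exact: minor_c1 |].
move=> i j ij; apply: (ldiffE charK (s := 0)) => g.
exists (minor_c S g *: (1 + ((j \in S) && (i == j))%:R *: 'X)).
  move=> t h hE; rewrite (minor_c_curve ij Sdown hE) mulr1.
  by rewrite hornerZ hornerD hornerC hornerZ hornerX [_ * t]mulrC.
rewrite mul0r mul0r subr0 coefZ coefD coef1 coefZ coefX /= add0r mulr1.
rewrite -[LHS]/(_ * minor_c S g) mulrC; congr (_ * _).
by case: eqP => [->|]; rewrite ?andbT ?andbF ?mul0r // mul1r; case: (_ \in _).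
Qed.

Lemma hwfun_minor_d S : (forall i j : 'I_n, (i <= j)%N -> i \in S -> j \in S) ->
  hwfun 0 #|S| (fun i => - (i \in S)%:R) (minor_d S).
Proof.
move=> Sup; split; [exact: minor_d_ratA | exact: minor_d1 |].
move=> i j ij; apply: (ldiffE charK (s := ((i \in S) && (i == j)))) => g.
exists (minor_d S g)%:P.
  move=> t h hE; rewrite hornerC -(minor_d_curve ij Sup hE) detp_transvection //.
  congr (_ * _); rewrite hornerD hornerC hornerZ hornerX [_ * t]mulrC.
  by case: (i \in S); case: eqP; rewrite ?expr1 ?expr0 ?mulr0 ?addr0.
rewrite detp_transvection // coefD coef1 coefZ coefX !coefC /= !add0r mulr1.
rewrite -[LHS]/(_ * minor_d S g).
by case: (i \in S); case: eqP; rewrite ?mul1r ?mul0r ?oppr0 ?mulr0 ?mulN1r ?mulr1 ?mul0r.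
Qed.

Lemma ratA1_diag k : (0 < n)%N -> (1 : KG) \in A k k.
Proof.
move=> n0; elim: k => [|k IH]; first exact: ratA1.
pose i0 := Ordinal n0.
have -> : (1 : KG) = \sum_j coord_c i0 j * coord_d j i0 * 1.
  apply/funext => g; rewrite fct_sumE; have := mulmxV (valP g).
  move=> /matrixP/(_ i0 i0); rewrite !mxE eqxx => E.
  rewrite -[LHS]/(true%:R : K) -E; apply: eq_bigr => j _.
  by rewrite -[RHS]/(_ * _ * 1) mulr1.
rewrite rpred_sum // => j _; rewrite -add1n; apply: ratAM IH.
by have := ratAM (coord_c_ratA K i0 j) (coord_d_ratA K j i0); rewrite addn0 add0n.
Qed.

Lemma sum_lt_pos (a : int) (N : nat) : a <= N%:Z ->
  \sum_(c < N) ((c%:Z < a)%R : nat)%:Z = Num.max a 0.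
Proof.
move=> aN; have key m : \sum_(c < m) ((c%:Z < a)%R : nat)%:Z = Num.min m%:Z (Num.max a 0).
  elim: m => [|m IH]; first by rewrite big_ord0; lia.
  by rewrite big_ord_recr /= IH; lia.
by rewrite key; lia.
Qed.

(** The function is a product of minors of c, one for each column of the Young
    diagram of the positive part of l, and of minors of d for the negative part,
    padded with factors sum_j c_1j d_j1 = 1 to reach the bidegree (r, s). The
    bound on subsets, applied to the support of the positive part, shows that its
    size is at most r; by the trace condition the negative part then has size at
    most s. *)
Lemma exists_hwfun r s (l : nat -> int) : (0 < n)%N -> dominant n l ->
  \sum_(i < n) l i = r%:Z - s%:Z ->
  (forall S : {set 'I_n}, S \proper [set: 'I_n] -> - s%:Z <= \sum_(i in S) l i <= r%:Z) ->
  exists f, hwfun r s (fun i => l i) f.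
Proof.
move=> n0 dl ltr lS.
have mono (i j : 'I_n) : (i <= j)%N -> l j <= l i.
  move=> ij; have := ltn_ord j; rewrite -(subnKC ij); elim: (j - i)%N => [|d IH] hd.
    by rewrite addn0.
  by rewrite addnS in hd *; apply: le_trans (dl _ hd) (IH (ltnW hd)).
pose pos := \sum_(i < n) Num.max (l i) 0; pose neg := \sum_(i < n) Num.max (- l i) 0.
have pos_neg : pos - neg = r%:Z - s%:Z.
  by rewrite -ltr /pos /neg -sumrB; apply: eq_bigr => i _; lia.
have full (T : {set 'I_n}) : ~~ (T \proper [set: 'I_n]) -> \sum_(i in T) l i = r%:Z - s%:Z.
  rewrite properT negbK => /eqP ->; rewrite -ltr.
  by apply: eq_bigl => i; rewrite inE.
have pos_r : pos <= r%:Z.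
  have -> : pos = \sum_(i in [set i : 'I_n | 0 < l i]) l i.
    rewrite /pos [RHS]big_mkcond; apply: eq_bigr => i _ /=.
    by rewrite inE; case: ifP; lia.
  have [hT|/full ->] := boolP ([set i : 'I_n | 0 < l i] \proper [set: 'I_n]); last by lia.
  by have /andP [] := lS _ hT.
have neg_s : neg <= s%:Z by lia.
have le_pos (i : 'I_n) : l i <= pos.
  rewrite /pos (bigD1 i) //=; apply: le_trans (_ : Num.max (l i) 0 <= _); first by lia.
  by rewrite lerDl sumr_ge0 // => j _; lia.
have le_neg (i : 'I_n) : - l i <= neg.
  rewrite /neg (bigD1 i) //=; apply: le_trans (_ : Num.max (- l i) 0 <= _); first by lia.
  by rewrite lerDl sumr_ge0 // => j _; lia.
pose Sp (c : nat) : {set 'I_n} := [set i : 'I_n | c%:Z < l i].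
pose Sm (c : nat) : {set 'I_n} := [set i : 'I_n | c%:Z < - l i].
have hc (c : nat) : hwfun #|Sp c| 0 (fun i : 'I_n => (i \in Sp c)%:R) (minor_c (Sp c)).
  apply: hwfun_minor_c => i j ij; rewrite !inE => h.
  exact: lt_le_trans h (mono _ _ ij).
have hd (c : nat) : hwfun 0 #|Sm c| (fun i : 'I_n => - (i \in Sm c)%:R) (minor_d (Sm c)).
  apply: hwfun_minor_d => i j ij; rewrite !inE => h.
  by apply: lt_le_trans h _; rewrite lerN2; exact: mono.
have := hwfun_mul (hwfun_prod r hc) (hwfun_prod s hd).
rewrite !sum_nat_const !muln0 addn0 add0n.
set p := (\sum_(c < r) _)%N; set q := (\sum_(c < s) _)%N; set f := _ * _.
have sumZ (N : nat) (T : nat -> {set 'I_n}) :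
    (\sum_(c < N) #|T c|)%N%:Z = \sum_(i < n) \sum_(c < N) ((i \in T c) : nat)%:Z.
  rewrite (big_morph Posz PoszD (erefl 0%:Z)) [RHS]exchange_big; apply: eq_bigr => c _.
  by rewrite -sum_set_card (big_morph Posz PoszD (erefl 0%:Z)).
have pE : p%:Z = pos.
  rewrite /p sumZ; apply: eq_bigr => i _.
  by under eq_bigr do rewrite inE; rewrite sum_lt_pos //; exact: le_trans (le_pos i) _.
have qE : q%:Z = neg.
  rewrite /q sumZ; apply: eq_bigr => i _.
  by under eq_bigr do rewrite inE; rewrite sum_lt_pos //; exact: le_trans (le_neg i) _.
move=> [Af f1 Df]; exists f.
have [k [-> ->]] : exists k, r = (p + k)%N /\ s = (q + k)%N by exists (r - p)%N; lia.
split=> //; first by rewrite -[f]mulr1; apply: ratAM Af (ratA1_diag _ n0).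
move=> i j ij; rewrite Df //; congr ((_ * _%:~R) *: f).
rewrite sumrN; under eq_bigr do rewrite inE natz.
rewrite sum_lt_pos; last exact: le_trans (le_pos i) _.
under eq_bigr do rewrite inE natz.
by rewrite sum_lt_pos; [lia | exact: le_trans (le_neg i) _].
Qed.

End HighestWeightFunctions.

(** * Evaluation of the free algebra *)

Section FreeAlgebra.
Variables (K : comNzRingType) (I : choiceType).
Local Notation F := (free_alg K I).

Lemma malgU_scale (a : K) (m : {fmonom I}) : << a *g m >> = a *: (<< m >> : F).
Proof.
apply/malgP => k; rewrite mcoeffZ !mcoeffU.
by case: eqP => _; rewrite ?mulr1n ?mulr0n ?mulr0 ?mulr1.
Qed.

Lemma free_scalerAr (a : K) (x y : F) : x * (a *: y) = a *: (x * y).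
Proof.
have mulC (z : F) : z * a%:MP = a *: z.
  rewrite malgM_def fgmulgU malgZ_def; apply: eq_bigr => m _.
  by rewrite mulm1 mulrC.
by rewrite -!mulC mulrA.
Qed.

Lemma malgU_mul (m1 m2 : {fmonom I}) : (<< m1 >> * << m2 >> : F) = << mmul m1 m2 >>.
Proof. by rewrite malgM_def fgmulUU mulr1. Qed.

Lemma free_alg_ind (P : F -> Prop) : P 1 ->
  (forall x y, P x -> P y -> P (x + y)) -> (forall a x, P x -> P (a *: x)) ->
  (forall i x, P x -> P (free_gen K i * x)) -> forall x, P x.
Proof.
move=> P1 PD PZ Pg x.
have P0 : P 0 by rewrite -(scale0r (1 : F)); exact: PZ.
rewrite [x]monalgE; apply: big_ind => // m _; rewrite malgU_scale; apply: PZ.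
case: m => s; elim: s => [|i s IH].
  by rewrite -fmoneE.
rewrite (_ : FMonom (i :: s) = mmul (fmu i) (FMonom s)); last first.
  by rewrite /mmul /= fmmulE fmuE.
by rewrite -malgU_mul; exact: Pg.
Qed.

Variables (S : pzRingType) (sc : {rmorphism K -> S}) (v : I -> S).
Hypothesis scC : forall a b, sc a * b = b * sc a.

Definition word_eval (m : {fmonom I}) : S := \prod_(i <- (m : seq I)) v i.

Definition free_lift (x : F) : S := \sum_(m <- msupp x) sc x@_m * word_eval m.

Lemma free_liftEw (d : {fset {fmonom I}}) (x : F) : (msupp x `<=` d)%fset ->
  free_lift x = \sum_(m <- d) sc x@_m * word_eval m.
Proof.
move=> le; rewrite [LHS](big_fset_incl _ le) => //= m _ /mcoeff_outdom ->.
by rewrite raddf0 mul0r.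
Qed.

Lemma free_lift_lin a x y : free_lift (a *: x + y) = sc a * free_lift x + free_lift y.
Proof.
pose d := (msupp (a *: x + y) `|` (msupp x `|` msupp y))%fset.
rewrite !(@free_liftEw d) ?fsubsetUl //.
- rewrite mulr_sumr -big_split; apply: eq_bigr => m _ /=.
  by rewrite mcoeffD mcoeffZ rmorphD rmorphM mulrDl mulrA.
- by rewrite (fsubset_trans _ (fsubsetUr _ _)) ?fsubsetUr.
by rewrite (fsubset_trans _ (fsubsetUr _ _)) ?fsubsetUl.
Qed.

Lemma free_liftU m : free_lift << m >> = word_eval m.
Proof.
rewrite (@free_liftEw [fset m]%fset) ?msuppU_le // big_seq_fset1 mcoeffUU.
by rewrite rmorph1 mul1r.
Qed.

Lemma free_lift_gen i : free_lift (free_gen K i) = v i.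
Proof. by rewrite free_liftU /word_eval fmuE big_seq1. Qed.

Lemma free_lift1 : free_lift 1 = 1.
Proof. by rewrite free_liftU /word_eval fm1 big_nil. Qed.

Lemma free_liftM x y : free_lift (x * y) = free_lift x * free_lift y.
Proof.
have L0 : free_lift 0 = 0.
  by have := free_lift_lin (-1) 0 0; rewrite scaler0 addr0 rmorphN rmorph1 mulN1r addNr.
have LD u w : free_lift (u + w) = free_lift u + free_lift w.
  by have := free_lift_lin 1 u w; rewrite scale1r rmorph1 mul1r.
have LZ a u : free_lift (a *: u) = sc a * free_lift u.
  by have := free_lift_lin a u 0; rewrite !addr0 L0 addr0.
have Lg i u : free_lift (free_gen K i * u) = v i * free_lift u.
  rewrite [u]monalgE; elim/big_rec: _ => [|m w _ IH]; first by rewrite mulr0 L0 mulr0.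
  rewrite mulrDr !LD mulrDr IH malgU_scale; congr (_ + _).
  rewrite free_scalerAr !LZ malgU_mul !free_liftU mulrA -scC -mulrA; congr (_ * _).
  by rewrite /word_eval /mmul /= fmmulE fmuE big_cons.
elim/free_alg_ind: x => [|x1 x2 h1 h2|a x hx|i x hx].
- by rewrite mul1r free_lift1 mul1r.
- by rewrite mulrDl !LD h1 h2 mulrDl.
- by rewrite -scalerAl !LZ hx mulrA.
by rewrite -mulrA !Lg hx mulrA.
Qed.

End FreeAlgebra.

(** * The presented algebra *)

Section PresentedAlgebra.
Variables (K : fieldType) (n r s : nat).
Local Notation I := (gen_index n).
Local Notation F := (free_alg K I).
Local Notation B := (ratSchur_presented K n r s).
Local Notation relr := (@relator K n r s).

Definition rel_pi (x : F) : B := aq_pi relr x.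

Lemma rel_piD x y : rel_pi (x + y) = rel_pi x + rel_pi y. Proof. exact: (raddfD (aq_pi relr)). Qed.
Lemma rel_piB x y : rel_pi (x - y) = rel_pi x - rel_pi y. Proof. exact: (raddfB (aq_pi relr)). Qed.
Lemma rel_piM x y : rel_pi (x * y) = rel_pi x * rel_pi y. Proof. exact: (rmorphM (aq_pi relr)). Qed.
Lemma rel_pi1 : rel_pi 1 = 1. Proof. exact: (rmorph1 (aq_pi relr)). Qed.
Lemma rel_pi0 : rel_pi 0 = 0. Proof. exact: (raddf0 (aq_pi relr)). Qed.
Lemma rel_piZ a x : rel_pi (a *: x) = a *: rel_pi x. Proof. exact: (linearZZ (aq_pi relr)). Qed.
Lemma rel_pi_eq0 x : relr x -> rel_pi x = 0.
Proof. by move=> hx; apply/aq_pi_eq0/ideal_gen_sub. Qed.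
Lemma rel_piK (x : B) : rel_pi (repr x) = x. Proof. exact: aq_reprK. Qed.

Definition scB (a : K) : B := a *: (1 : B).

Fact scB_is_zmod_morphism : zmod_morphism scB.
Proof. by move=> a b; rewrite /scB scalerBl. Qed.
Fact scB_is_monoid_morphism : monoid_morphism scB.
Proof.
split=> [|a b]; first exact: scale1r.
rewrite /scB -scalerA; rewrite -[RHS](alg_quot_scalerAl a (1 : B) (b *: (1 : B))).
by congr (_ *: _); apply/esym/mul1r.
Qed.
HB.instance Definition _ := GRing.isZmodMorphism.Build K B scB scB_is_zmod_morphism.
HB.instance Definition _ := GRing.isMonoidMorphism.Build K B scB scB_is_monoid_morphism.

Lemma scB_mul a (b : B) : scB a * b = a *: b.
Proof. by rewrite /scB -[LHS](alg_quot_scalerAl a (1 : B) b); congr (_ *: _); apply: mul1r. Qed.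

Lemma scBC a (b : B) : scB a * b = b * scB a.
Proof. by rewrite scB_mul /scB -presented_scalerAr mulr1. Qed.

Definition eB (k : nat) : B := if insub k is Some i then rel_pi (gen_e K i) else 0.
Definition fB (k : nat) : B := if insub k is Some i then rel_pi (gen_f K i) else 0.
Definition hB (k : nat) : B := if insub k is Some i then rel_pi (gen_H K i) else 0.

Lemma eB_ord (i : 'I_n.-1) : eB i = rel_pi (gen_e K i).
Proof. by rewrite /eB valK. Qed.
Lemma fB_ord (i : 'I_n.-1) : fB i = rel_pi (gen_f K i).
Proof. by rewrite /fB valK. Qed.
Lemma hB_ord (i : 'I_n) : hB i = rel_pi (gen_H K i).
Proof. by rewrite /hB valK. Qed.

Lemma ord_pred_exists k : (k.+1 < n)%N -> exists i : 'I_n.-1, k = i.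
Proof. by move=> hk; have hk' : (k < n.-1)%N := ltac:(lia); exists (Ordinal hk'). Qed.

Lemma rel_pi_eq x y : relr (x - y) -> rel_pi x = rel_pi y.
Proof. by move=> /rel_pi_eq0; rewrite rel_piB => /eqP; rewrite subr_eq0 => /eqP. Qed.

Lemma relHH i j : (i < n)%N -> (j < n)%N -> ad (hB i) (hB j) = 0.
Proof.
move=> hi hj; rewrite -[i]/(val (Ordinal hi)) -[j]/(val (Ordinal hj)).
rewrite !hB_ord /ad -!rel_piM -rel_piB.
exact/rel_pi_eq0/RelHH.
Qed.

Lemma rel_ef i j : (i.+1 < n)%N -> (j.+1 < n)%N ->
  ad (eB i) (fB j) = (hB i - hB i.+1) *+ (i == j).
Proof.
move=> /ord_pred_exists [{}i ->] /ord_pred_exists [{}j ->].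
rewrite eB_ord fB_ord /ad -!rel_piM -rel_piB (rel_pi_eq (RelEF K r s i j)) rel_piZ rel_piB val_eqE.
by case: eqP => [->|_]; rewrite ?scale0r // scale1r -!hB_ord.
Qed.

Lemma rel_He i j : (i < n)%N -> (j.+1 < n)%N ->
  ad (hB i) (eB j) = eB j *+ (i == j) - eB j *+ (i == j.+1).
Proof.
move=> hi /ord_pred_exists [{}j ->]; rewrite -[i]/(val (Ordinal hi)) eB_ord hB_ord.
rewrite /ad -!rel_piM -rel_piB (rel_pi_eq (RelHE K r s (Ordinal hi) j)) rel_piZ.
rewrite wform_eps_alpha rmorphB /= scalerBl -!val_eqE /=.
by case: (i == j); case: (i == j.+1); rewrite ?scale1r ?scale0r.
Qed.

Lemma rel_Hf i j : (i < n)%N -> (j.+1 < n)%N ->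
  ad (hB i) (fB j) = fB j *+ (i == j.+1) - fB j *+ (i == j).
Proof.
move=> hi /ord_pred_exists [{}j ->]; rewrite -[i]/(val (Ordinal hi)) fB_ord hB_ord.
rewrite /ad -!rel_piM -rel_piB (rel_pi_eq (RelHF K r s (Ordinal hi) j)) rel_piZ.
rewrite wform_eps_alpha rmorphB /= opprB scalerBl -!val_eqE /=.
by case: (i == j); case: (i == j.+1); rewrite ?scale1r ?scale0r.
Qed.

Lemma rel_pi_sum (J : Type) (t : seq J) (P : pred J) (G : J -> F) :
  rel_pi (\sum_(j <- t | P j) G j) = \sum_(j <- t | P j) rel_pi (G j).
Proof. exact: (raddf_sum (aq_pi relr)). Qed.

Lemma rel_tr : \sum_(i < n) hB i = (r%:Z - s%:Z)%:~R.
Proof.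
under eq_bigr do rewrite hB_ord.
rewrite -rel_pi_sum (rel_pi_eq (RelTrace K n r s)) rel_piZ rel_pi1.
by rewrite -[LHS]/(scB _) -(rmorph_int scB) intrB.
Qed.

Lemma rel_prod (T : {set 'I_n}) : T \proper [set: 'I_n] ->
  \prod_(0 <= k < (r + s).+1) (\sum_(i in T) hB i + (k%:Z - r%:Z)%:~R) = 0.
Proof.
move=> hT; have := rel_pi_eq0 (RelProd K r s hT).
rewrite (big_morph rel_pi rel_piM rel_pi1) => E; rewrite -[RHS]E; apply: eq_bigr => k _.
apply: etrans (esym (rel_piD _ _)). congr (_ + _); last first.
  by rewrite rel_piZ rel_pi1 -[RHS]/(scB _) -(rmorph_int scB) intrB.
by rewrite [RHS]rel_pi_sum; apply: eq_bigr => i _; rewrite hB_ord.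
Qed.

Lemma presented_ind (P : B -> Prop) : P 1 ->
  (forall x y, P x -> P y -> P (x + y)) -> (forall a x, P x -> P (scB a * x)) ->
  (forall k x, (k.+1 < n)%N -> P x -> P (eB k * x)) ->
  (forall k x, (k.+1 < n)%N -> P x -> P (fB k * x)) ->
  (forall i x, (i < n)%N -> P x -> P (hB i * x)) -> forall b, P b.
Proof.
move=> P1 PD PZ Pe Pf PH b; rewrite -(rel_piK b); move: (repr b) => x.
elim/free_alg_ind: x => [|x y hx hy|a x hx|[[i|i]|i] x hx].
- by rewrite rel_pi1.
- by rewrite rel_piD; exact: PD.
- by rewrite rel_piZ -scB_mul; exact: PZ.
- rewrite rel_piM -[rel_pi _]/(rel_pi (gen_e K i)) -eB_ord.
  by apply: Pe => //; have := ltn_ord i; lia.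
- rewrite rel_piM -[rel_pi _]/(rel_pi (gen_f K i)) -fB_ord.
  by apply: Pf => //; have := ltn_ord i; lia.
by rewrite rel_piM -[rel_pi _]/(rel_pi (gen_H K i)) -hB_ord; exact: PH.
Qed.

End PresentedAlgebra.

(** * The isomorphism *)

Section Isomorphism.
Variables (K : fieldType) (charK : [pchar K] =i pred0).
Variables (n r s : nat) (n_gt0 : (0 < n)%N).
Local Notation I := (gen_index n).
Local Notation F := (free_alg K I).
Local Notation B := (ratSchur_presented K n r s).
Local Notation RS := (ratSchur K n r s).
Local Notation RA := (ratA K n r s).
Local Notation relr := (@relator K n r s).
Local Notation vf X := (vfield charK r s X).
Local Notation rel_pi := (@rel_pi K n r s).

Definition scS (a : K) : RS := a *: (1 : RS).

Fact scS_is_zmod_morphism : zmod_morphism scS.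
Proof. by move=> a b; rewrite /scS scalerBl. Qed.
Fact scS_is_monoid_morphism : monoid_morphism scS.
Proof.
split=> [|a b]; first exact: scale1r.
by rewrite /scS -ratSchur_scalerAl mul1r scalerA.
Qed.
HB.instance Definition _ := GRing.isZmodMorphism.Build K RS scS scS_is_zmod_morphism.
HB.instance Definition _ := GRing.isMonoidMorphism.Build K RS scS scS_is_monoid_morphism.

Lemma scS_mul a (b : RS) : scS a * b = a *: b.
Proof. by rewrite /scS -ratSchur_scalerAl mul1r. Qed.

Lemma scSC a (b : RS) : scS a * b = b * scS a.
Proof. by rewrite scS_mul /scS -ratSchur_scalerAr mulr1. Qed.

Definition gen_field (i : I) : RS :=
  match i with
  | inl (inl i) => vf (delta_mx (ord_cur i) (ord_succ i))
  | inl (inr i) => vf (delta_mx (ord_succ i) (ord_cur i))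
  | inr i => vf (delta_mx i i)
  end.

Definition gen_lift (x : F) : RS := free_lift scS gen_field x.

Lemma gen_liftP a x y : gen_lift (a *: x + y) = a *: gen_lift x + gen_lift y.
Proof. by rewrite /gen_lift (free_lift_lin scS) scS_mul. Qed.
Lemma gen_liftM x y : gen_lift (x * y) = gen_lift x * gen_lift y.
Proof. exact: (free_liftM gen_field scSC). Qed.
Lemma gen_lift1 : gen_lift 1 = 1.
Proof. exact: (free_lift1 scS gen_field). Qed.
Lemma gen_lift0 : gen_lift 0 = 0.
Proof. by have := gen_liftP (-1) 0 0; rewrite scaler0 addr0 scaleN1r addNr. Qed.
Lemma gen_liftZ a x : gen_lift (a *: x) = a *: gen_lift x.
Proof. by have := gen_liftP a x 0; rewrite gen_lift0 !addr0. Qed.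
Lemma gen_liftD x y : gen_lift (x + y) = gen_lift x + gen_lift y.
Proof. by have := gen_liftP 1 x y; rewrite !scale1r. Qed.
Lemma gen_liftB x y : gen_lift (x - y) = gen_lift x - gen_lift y.
Proof. by have := gen_liftP (-1) y x; rewrite !scaleN1r addrC => ->; rewrite addrC. Qed.
Lemma gen_lift_e i : gen_lift (gen_e K i) = vf (delta_mx (ord_cur i) (ord_succ i)).
Proof. exact: (free_lift_gen scS gen_field). Qed.
Lemma gen_lift_f i : gen_lift (gen_f K i) = vf (delta_mx (ord_succ i) (ord_cur i)).
Proof. exact: (free_lift_gen scS gen_field). Qed.
Lemma gen_lift_H i : gen_lift (gen_H K i) = vf (delta_mx i i).
Proof. exact: (free_lift_gen scS gen_field). Qed.

Lemma vfield_delta_bracket (i j k l : 'I_n) :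
  vf (delta_mx i j) * vf (delta_mx k l) - vf (delta_mx k l) * vf (delta_mx i j) =
  (j == k)%:R *: vf (delta_mx i l) - (l == i)%:R *: vf (delta_mx k j).
Proof.
rewrite vfield_bracket !mul_delta_mx_cond raddfB /= !raddfMn /=.
by rewrite !scaler_nat mulNrn.
Qed.

Lemma ord_cur_eq (i j : 'I_n.-1) : (ord_cur i == ord_cur j) = (i == j).
Proof. by []. Qed.
Lemma ord_succ_eq (i j : 'I_n.-1) : (ord_succ i == ord_succ j) = (i == j).
Proof. by []. Qed.

Lemma gen_lift_bracket x y : gen_lift (x * y - y * x) =
  gen_lift x * gen_lift y - gen_lift y * gen_lift x.
Proof. by apply: etrans (gen_liftB _ _) _; congr (_ - _); exact: gen_liftM. Qed.

Lemma gen_lift_sub0 x y a : gen_lift x = a -> gen_lift y = a -> gen_lift (x - y) = 0.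
Proof. by rewrite gen_liftB => -> ->; rewrite subrr. Qed.

Lemma gen_lift_relator x : relr x -> gen_lift x = 0.
Proof.
case=> [i j|i j|i j|i j||T hT].
- apply: etrans (gen_lift_bracket (gen_H K i) (gen_H K j)) _.
  rewrite (gen_lift_H i) (gen_lift_H j) vfield_delta_bracket (eq_sym j).
  by case: eqP => [->|_]; rewrite ?subrr // !scale0r subrr.
- apply: gen_lift_sub0; first exact: gen_lift_bracket.
  apply: etrans (gen_liftZ _ _) _; rewrite (gen_liftB (gen_H K _) (gen_H K _)).
  rewrite (gen_lift_H (ord_cur j)) (gen_lift_H (ord_succ j)) (gen_lift_e i) (gen_lift_f j).
  rewrite vfield_delta_bracket ord_succ_eq ord_cur_eq (eq_sym j).
  by case: eqP => [->|_]; rewrite ?scale0r ?subrr // !scale1r.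
- apply: gen_lift_sub0; first exact: gen_lift_bracket.
  apply: etrans (gen_liftZ _ _) _; rewrite (gen_lift_H i) (gen_lift_e j) vfield_delta_bracket.
  rewrite wform_eps_alpha rmorphB scalerBl (eq_sym (ord_succ j)) /=.
  by congr (_ - _); case: eqP => [->|_]; rewrite ?scale0r.
- apply: gen_lift_sub0; first exact: gen_lift_bracket.
  apply: etrans (gen_liftZ _ _) _; rewrite (gen_lift_H i) (gen_lift_f j) vfield_delta_bracket.
  rewrite wform_eps_alpha rmorphB opprB scalerBl (eq_sym (ord_cur j)) /=.
  by congr (_ - _); case: eqP => [->|_]; rewrite ?scale0r.
- apply: (gen_lift_sub0 (a := (r%:R - s%:R) *: (1 : RS))); last first.
    by apply: etrans (gen_liftZ _ _) _; rewrite gen_lift1.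
  rewrite (big_morph gen_lift gen_liftD gen_lift0) -(@vfield_trace K n charK r s).
  rewrite scalar_mx_sum_delta raddf_sum.
  by apply: eq_bigr => i _; rewrite (gen_lift_H i) scale1r.
rewrite (big_morph gen_lift gen_liftM gen_lift1) -[RHS](vfield_diag_prod charK r s T).
apply: eq_bigr => k _; apply: etrans (gen_liftD _ _) _; congr (_ + _); last first.
  by apply: etrans (gen_liftZ _ _) _; rewrite gen_lift1.
rewrite (big_morph gen_lift gen_liftD gen_lift0) /diag_set raddf_sum.
by apply: eq_bigr => i _; rewrite gen_lift_H.
Qed.

Lemma gen_lift_ideal x : x \in ideal_gen relr -> gen_lift x = 0.
Proof.
move=> /asboolP; elim=> [y /gen_lift_relator //||y z _ hy _ hz|a y _ hy|a y _ hy].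
- exact: gen_lift0.
- by rewrite gen_liftB hy hz subrr.
- by rewrite gen_liftM hy mulr0.
by rewrite gen_liftM hy mul0r.
Qed.

Definition schur_map (x : B) : RS := gen_lift (repr x).

Lemma schur_map_pi x : schur_map (rel_pi x) = gen_lift x.
Proof.
apply/eqP; rewrite -subr_eq0 -gen_liftB; apply/eqP/gen_lift_ideal/aq_piE.
exact: aq_reprK.
Qed.

Lemma schur_mapP a x y : schur_map (a *: x + y) = a *: schur_map x + schur_map y.
Proof.
by rewrite -(rel_piK x) -(rel_piK y) -rel_piZ -rel_piD !schur_map_pi gen_liftP.
Qed.

Lemma schur_mapM x y : schur_map (x * y) = schur_map x * schur_map y.
Proof. by rewrite -(rel_piK x) -(rel_piK y) -rel_piM !schur_map_pi gen_liftM. Qed.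

Lemma schur_map1 : schur_map 1 = 1.
Proof. by rewrite -rel_pi1 schur_map_pi gen_lift1. Qed.

Lemma schur_map0 : schur_map 0 = 0.
Proof. by rewrite -rel_pi0 schur_map_pi gen_lift0. Qed.

Lemma schur_mapB x y : schur_map (x - y) = schur_map x - schur_map y.
Proof. by rewrite -(rel_piK x) -(rel_piK y) -rel_piB !schur_map_pi gen_liftB. Qed.

(** Every matrix unit is an iterated commutator of those next to the diagonal. *)
Lemma vfield_generated X : exists x, gen_lift x = vf X.
Proof.
pose W phi := exists x, gen_lift x = phi.
have WB p q : W p -> W q -> W (p - q).
  by move=> [x <-] [y <-]; exists (x - y); rewrite gen_liftB.
have WD p q : W p -> W q -> W (p + q).
  by move=> [x <-] [y <-]; exists (x + y); rewrite gen_liftD.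
have WM p q : W p -> W q -> W (p * q).
  by move=> [x <-] [y <-]; exists (x * y); rewrite gen_liftM.
have WZ a p : W p -> W (a *: p).
  by move=> [x <-]; exists (a *: x); rewrite gen_liftZ.
have step (i j k : 'I_n) : i != k -> W (vf (delta_mx i j)) -> W (vf (delta_mx j k)) ->
    W (vf (delta_mx i k)).
  move=> ik Wij Wjk; have := WB _ _ (WM _ _ Wij Wjk) (WM _ _ Wjk Wij).
  by rewrite vfield_delta_bracket eqxx scale1r eq_sym (negPf ik) scale0r subr0.
have up (d : nat) (i j : 'I_n) : (j = i + d.+1 :> nat)%N ->
    W (vf (delta_mx i j)) /\ W (vf (delta_mx j i)).
  elim: d i j => [|d IH] i j ijE.
    have [k ik] : exists k : 'I_n.-1, (i = k :> nat)%N.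
      by apply: ord_pred_exists; have := ltn_ord j; rewrite ijE addn1.
    have -> : i = ord_cur k by apply: val_inj.
    have -> : j = ord_succ k by apply: val_inj; rewrite /= ijE ik addn1.
    by split; [exists (gen_e K k); exact: gen_lift_e | exists (gen_f K k); exact: gen_lift_f].
  have hk : (i + d.+1 < n)%N by have := ltn_ord j; lia.
  pose k := Ordinal hk; have [Wik Wki] := IH i k erefl.
  have [l kl] : exists l : 'I_n.-1, (k = l :> nat)%N.
    by apply: ord_pred_exists; have := ltn_ord j; rewrite ijE /= addnS.
  have kE : k = ord_cur l by apply: val_inj.
  have jE : j = ord_succ l by apply: val_inj; rewrite /= -kl ijE /= addnS.
  have ij : i != j by rewrite -val_eqE /=; lia.
  split; first by apply: step ij Wik _; rewrite kE jE; exists (gen_e K l); exact: gen_lift_e.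
  by apply: step _ _ Wki; [rewrite eq_sym | rewrite kE jE; exists (gen_f K l); exact: gen_lift_f].
have Wd (i j : 'I_n) : W (vf (delta_mx i j)).
  case: (nat_cmpP i j) => [d /up [] //|d /up [] //|/val_inj ->].
  by exists (gen_H K j); exact: gen_lift_H.
rewrite (matrix_sum_delta X) raddf_sum; apply: (big_ind W) => [||i _].
- by exists 0; exact: gen_lift0.
- exact: WD.
rewrite raddf_sum; apply: (big_ind W) => [||j _].
- by exists 0; exact: gen_lift0.
- exact: WD.
by rewrite /= linearZ; apply: WZ; exact: Wd.
Qed.

(** The functions killed by the image are stable under invariant derivatives, as
    the image is a subalgebra containing the vector fields. *)
Lemma gen_lift_surj phi : exists x, gen_lift x = phi.
Proof.
apply: (@ratSchur_bidual K n r s (fun phi => exists x, gen_lift x = phi)).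
- by exists 0; exact: gen_lift0.
- by move=> a _ _ [x <-] [y <-]; exists (a *: x + y); exact: gen_liftP.
move=> f hf; apply: val_inj.
apply: (@invariant_derivatives_separate K n charK r s
  (fun g => exists2 f : RA, g = f & forall x, gen_lift x f = 0)).
- by move=> _ [f' -> _]; exact: ratAP.
- move=> _ X [f' -> hf']; exists (contract (vf X) f'); first by rewrite contract_vfield.
  have [y yX] := vfield_generated X; move=> x.
  by rewrite -[LHS]/((gen_lift x * vf X) f') -yX -gen_liftM.
- by move=> _ [f' -> /(_ 1)]; rewrite gen_lift1.
by exists f => // x; apply: hf; exists x.
Qed.

Lemma schur_map_surj phi : exists x, schur_map x = phi.
Proof. by have [x <-] := gen_lift_surj phi; exists (rel_pi x); exact: schur_map_pi. Qed.

(** The left ideal required by [ideal_eq0] is the annihilator of the highest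
    weight function of weight l under the action through [schur_map]. *)
Lemma schur_map_eq0 b : schur_map b = 0 -> b = 0.
Proof.
move: b; apply: (ideal_eq0 charK (@scBC K n r s) (@relHH K n r s) (@rel_ef K n r s)
  (@rel_He K n r s) (@rel_Hf K n r s) (@rel_tr K n r s) (@rel_prod K n r s)
  (@presented_ind K n r s)).
- by move=> x y hx hy; rewrite schur_mapB hx hy subrr.
- by move=> b x hx; rewrite schur_mapM hx mulr0.
- by move=> b x hx; rewrite schur_mapM hx mul0r.
move=> l dl [ltr lS]; have [f0 [Af f1 Df]] := exists_hwfun charK n_gt0 dl ltr lS.
pose f := RatA Af.
have cf X (a : K) : ldiff X f0 = a *: (f0 : GLn K n -> K^o) -> contract (vf X) f = a *: f.
  move=> h; apply: val_inj; rewrite -[LHS]/(ratA_val _) contract_vfield.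
  by rewrite -[RHS]/(ratA_val _) ratA_valZ.
have c0 phi : contract phi (0 : RA) = 0.
  by rewrite -(scale0r (0 : RA)) contractZ !scale0r.
exists (fun b : B^o => `[< contract (schur_map b) f = 0 >]); split.
- split=> [|a u v /asboolP hu /asboolP hv]; apply/asboolP.
    by rewrite schur_map0 -(scale0r (0 : RS)) contractZl scale0r.
  have -> : schur_map (a *: u + v) = schur_map a * schur_map u + schur_map v.
    by have := schur_mapP 1 (a * u) v; rewrite !scale1r schur_mapM.
  by rewrite contractDl contractM hu hv c0 addr0.
- apply/asboolP; rewrite schur_map1 contract1 => /(congr1 (fun g : RA => ratA_val g (GLn_one K n))).
  by rewrite -[LHS]/(f0 _) f1 => /eqP; rewrite oner_eq0.
- move=> k hk; have [i ->] := ord_pred_exists hk; apply/asboolP.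
  rewrite eB_ord schur_map_pi gen_lift_e (cf _ 0) ?scale0r // Df /=; last exact: leqnSn.
  by rewrite -val_eqE /= (ltn_eqF (ltnSn i)) mul0r scale0r.
- move=> i hi; apply/asboolP; rewrite -[i]/(val (Ordinal hi)) hB_ord.
  rewrite schur_mapB schur_map_pi gen_lift_H.
  have -> : schur_map (l (val (Ordinal hi)))%:~R = (l i)%:~R *: (1 : RS).
    by rewrite -(rmorph_int (@scB K n r s)) -schur_map1 -[RHS]addr0 -schur_map0 -schur_mapP addr0.
  rewrite -scaleN1r contractDl !contractZl contract1 (cf _ (l i)%:~R); last first.
    by rewrite Df // eqxx mul1r.
  by rewrite scaleN1r subrr.
by move=> b hb; apply/asboolP; rewrite hb -(scale0r (0 : RS)) contractZl scale0r.
Qed.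

Lemma schur_map_inj : injective schur_map.
Proof.
by move=> x y E; apply/eqP; rewrite -subr_eq0; apply/eqP/schur_map_eq0; rewrite schur_mapB E subrr.
Qed.

End Isomorphism.

Theorem corollary2p4 (K : closedFieldType) (charK : [pchar K] =i pred0)
    (n r s : nat) (n_gt0 : (1 <= n)%N) :
  exists phi : {linear ratSchur K n r s -> ratSchur_presented K n r s},
    monoid_morphism phi /\ bijective phi.
Proof.
have fI := @schur_map_inj K charK n r s n_gt0; have fS := @schur_map_surj K charK n r s n_gt0.
have fP := @schur_mapP K charK n r s; have fM := @schur_mapM K charK n r s.
have f1 := @schur_map1 K charK n r s.
move: (@schur_map K charK n r s) fI fS fP fM f1 => f fI fS fP fM f1.
have [g gK] := choice fS.
have fK : cancel f g by move=> x; apply: fI; rewrite gK.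
have g_lin : linear g by move=> a x y; apply: fI; rewrite gK fP !gK.
pose phi : {linear ratSchur K n r s -> ratSchur_presented K n r s} :=
  HB.pack_for {linear ratSchur K n r s -> ratSchur_presented K n r s} g
    (GRing.isLinear.Build K (ratSchur K n r s) (ratSchur_presented K n r s) *:%R g g_lin).
exists phi; split; last by exists f.
by split=> [|x y]; apply: fI; rewrite gK ?f1 // fM !gK.
Qed.
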